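(* Let $(M,\Sigma,\pi)$ be a non-planar, r-framed, 2-ruled 4-fold in $\mathbb{C}^4\cong\mathbb{R}^8$, with $\Sigma$ a connected real analytic 2-manifold, defined by orthogonal real analytic maps $\phi_1,\phi_2:\Sigma\to\mathcal{S}^7$ and a real analytic map $\psi:\Sigma\to\mathbb{R}^8$ by $$M=\{r_1\phi_1(\sigma)+r_2\phi_2(\sigma)+\psi(\sigma): r_1,r_2\in\mathbb{R},\ \sigma\in\Sigma\}.$$ Then $M$ is special Lagrangian if and only if $\omega(\phi_1,\phi_2)\equiv0$ and there exist, locally (near each point of $\Sigma$), oriented coordinates $(s,t)$ on $\Sigma$ such that $$\omega\Big(\phi_j,\frac{\partial\phi_k}{\partial s}\Big)\equiv0\ \ (j,k=1,2),\qquad \omega\Big(\phi_j,\frac{\partial\psi}{\partial s}\Big)\equiv0\ \ (j=1,2),$$ $$\frac{\partial\phi_1}{\partial t}=\phi_1\times\phi_2\times\frac{\partial\phi_1}{\partial s}+f\phi_2,\qquad \frac{\partial\phi_2}{\partial t}=\phi_1\times\phi_2\times\frac{\partial\phi_2}{\partial s}-f\phi_1,\qquad \frac{\partial\psi}{\partial t}=\phi_1\times\phi_2\times\frac{\partial\psi}{\partial s}+g_1\phi_1+g_2\phi_2$$ for some real analytic real-valued functions $f,g_1,g_2$ (defined on the domain of the coordinates), where $\times$ denotes the special Lagrangian triple cross product on $\mathbb{C}^4$ defined by $\operatorname{Re}\Omega$.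
   Context: Identify $\mathbb{R}^8\cong\mathbb{C}^4$ by $z_1=x_1+ix_2$, $z_2=x_3+ix_4$, $z_3=x_5+ix_6$, $z_4=x_7+ix_8$, with Euclidean metric $g$. Let $\omega=\frac{i}{2}\sum_{j=1}^4dz_j\wedge d\bar z_j$ and $\Omega=dz_1\wedge dz_2\wedge dz_3\wedge dz_4$. A real 4-dimensional submanifold of $\mathbb{C}^4$ is special Lagrangian (with phase 1) if, for a suitable orientation, $\operatorname{Re}\Omega$ restricts to the Riemannian volume form on each of its tangent spaces. The triple cross product used here is defined by $g(x\times y\times z,w)=\operatorname{Re}\Omega(x,y,z,w)$ for all $w\in\mathbb{C}^4$. A 2-ruled 4-fold $(M,\Sigma,\pi)$ in $\mathbb{R}^n$ is an (immersed) 4-dimensional submanifold $M$ with a smooth map $\pi:M\to\Sigma$ to a 2-manifold such that every fibre $\pi^{-1}(\sigma)$ is an affine 2-plane. An r-framing is a smoothly varying choice of oriented orthonormal basis $(\phi_1(\sigma),\phi_2(\sigma))$ of (the direction of) each fibre; $M$ is then the image of $\iota_M:\mathbb{R}^2\times\Sigma\to\mathbb{R}^n$, $\iota_M(r_1,r_2,\sigma)=r_1\phi_1(\sigma)+r_2\phi_2(\sigma)+\psi(\sigma)$. ''Orthogonal'' maps means $g(\phi_1,\phi_2)\equiv0$. $M$ may have singularities, namely points where $\iota_M$ fails to be an immersion, provided these form a nowhere dense subset of each fibre $\mathbb{R}^2\times\{\sigma\}$; ''special Lagrangian'' then refers to the nonsingular part. ''Non-planar'' means that $M$ is not contained in an affine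 4-plane. Local coordinates $(s,t)$ on $\Sigma$ are oriented if $\Phi(\phi_1,\phi_2,\partial\iota_M/\partial s,\partial\iota_M/\partial t)>0$ at the points where $\iota_M$ is an immersion, where $\Phi=\frac12\omega\wedge\omega+\operatorname{Re}\Omega$. *)

(* Defs.v *)
From HB Require Import structures.
From mathcomp Require Import all_boot all_order all_fingroup all_algebra.
From mathcomp Require Import all_classical all_reals all_analysis.
From mathcomp Require Import complex ring.
Set Implicit Arguments.
Unset Strict Implicit.
Unset Printing Implicit Defensive.
Import Order.TTheory GRing.Theory Num.Theory.
Import numFieldNormedType.Exports.
Local Open Scope classical_set_scope.
Local Open Scope ring_scope.

Section Forms.
Context {R : realType}.
Implicit Types x y z w : 'rV[R]_8.

Definition inner x y : R := \sum_(k < 8) x 0 k * y 0 k.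

(* With coordinates of R^8 and C^4 numbered from 1, this is
   z_(j+1) = x_(2j+1) + i x_(2j+2). *)
Definition zcoord (j : 'I_4) x : R[i] :=
  Complex (x 0 (inord j.*2)) (x 0 (inord j.*2.+1)).

Definition wedge11 (a b : 'rV[R]_8 -> R[i]) x y : R[i] := a x * b y - a y * b x.

Definition omegaC x y : R[i] :=
  Complex 0 1 / 2%:R *
    \sum_(j < 4) wedge11 (zcoord j) (fun v => conjc (zcoord j v)) x y.

Definition omega x y : R := complex.Re (omegaC x y).

Definition quad x y z w : 'I_4 -> 'rV[R]_8 := tnth [tuple x; y; z; w].

(* (dz_1 /\ dz_2 /\ dz_3 /\ dz_4)(v_1, ..., v_4) = det (dz_j(v_i)) *)
Definition Omega (v : 'I_4 -> 'rV[R]_8) : R[i] :=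
  \det (\matrix_(i < 4, j < 4) zcoord j (v i)).

Definition ReOmega x y z w : R := complex.Re (Omega (quad x y z w)).

(* wedge product of two 2-forms, with the normalization 1 / (2! 2!) *)
Definition wedge22 (a b : 'rV[R]_8 -> 'rV[R]_8 -> R) (v : 'I_4 -> 'rV[R]_8) : R :=
  (2%:R * 2%:R)^-1 *
  \sum_(s : 'S_4) (-1) ^+ odd_perm s *
    a (v (s (@Ordinal 4 0 isT))) (v (s (@Ordinal 4 1 isT))) *
    b (v (s (@Ordinal 4 2 isT))) (v (s (@Ordinal 4 3 isT))).

Definition Cayley x y z w : R :=
  2%:R^-1 * wedge22 omega omega (quad x y z w) + ReOmega x y z w.

(* the vector dual to ReOmega x y z, see crossP and cross_unique *)
Definition cross x y z : 'rV[R]_8 := \row_k ReOmega x y z (delta_mx 0 k).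

End Forms.

Section Analytic.
Context {R : realType}.

(* f is, near x, the sum of an absolutely convergent double power series *)
Definition analytic_at (f : 'rV[R]_2 -> R) (x : 'rV[R]_2) : Prop :=
  exists (a : nat -> nat -> R) (rho : R), 0 < rho /\
    forall h : 'rV[R]_2, `|h| < rho ->
      summable [set: nat * nat]
        (fun k => (a k.1 k.2 * h 0 0 ^+ k.1 * h 0 1 ^+ k.2)%:E) /\
      (fun n : nat => \sum_(i < n) \sum_(j < n) a i j * h 0 0 ^+ i * h 0 1 ^+ j)
        @ \oo --> f (x + h).

Definition vanalytic_at m (f : 'rV[R]_2 -> 'rV[R]_m) (x : 'rV[R]_2) : Prop :=
  forall k, analytic_at (fun y => f y 0 k) x.

End Analytic.

Section Charts.
Context {R : realType} {S : topologicalType}.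

(* Only the values of cmap on cdom and of cinv on cmap @` cdom matter. *)
Record chart := Chart {
  cdom : set S;
  cmap : S -> 'rV[R]_2;
  cinv : 'rV[R]_2 -> S;
  cdom_open : open cdom;
  cimg_open : open (cmap @` cdom);
  cmapK : forall u, cdom u -> cinv (cmap u) = u;
  cmap_continuous : forall u, cdom u -> {for u, continuous cmap};
  cinv_continuous : forall u, cdom u -> {for cmap u, continuous cinv}
}.

Definition transition_analytic (c c' : chart) : Prop :=
  forall u, cdom c u -> cdom c' u -> vanalytic_at (cmap c' \o cinv c) (cmap c u).

Definition compatible (c c' : chart) : Prop :=
  transition_analytic c c' /\ transition_analytic c' c.

(* partial derivatives with respect to the coordinates (s, t) given by c *)
Definition partial_s m (c : chart) (f : S -> 'rV[R]_m) (u : S) : 'rV[R]_m :=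
  'D_(delta_mx 0 0) (f \o cinv c) (cmap c u).
Definition partial_t m (c : chart) (f : S -> 'rV[R]_m) (u : S) : 'rV[R]_m :=
  'D_(delta_mx 0 1) (f \o cinv c) (cmap c u).

End Charts.
Arguments chart : clear implicits.

Record analyticSurface (R : realType) := AnalyticSurface {
  surface_space :> topologicalType;
  atlas : set (chart R surface_space);
  surface_hausdorff : hausdorff_space surface_space;
  surface_second_countable : @second_countable surface_space;
  atlas_cover : forall u, exists2 c, atlas c & cdom c u;
  atlas_compatible : forall c c', atlas c -> atlas c' -> compatible c c'
}.

Section Surfaces.
Context {R : realType} {S : analyticSurface R}.

Definition coordinates (c : chart R S) : Prop :=
  forall c', atlas c' -> compatible c c'.

Definition analytic_map m (f : S -> 'rV[R]_m) : Prop :=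
  forall c u, atlas c -> cdom c u -> vanalytic_at (f \o cinv c) (cmap c u).

Definition analytic_on_chart (c : chart R S) (f : S -> R) : Prop :=
  forall u, cdom c u -> analytic_at (f \o cinv c) (cmap c u).

End Surfaces.

Definition nowhere_dense (T : topologicalType) (A : set T) : Prop :=
  interior (closure A) = set0.

Section Ruled.
Context {R : realType} {S : analyticSurface R}.
Variables phi1 phi2 psi : S -> 'rV[R]_8.

(* (r 0 0, r 0 1) is (r_1, r_2) *)
Definition iota_M (r : 'rV[R]_2) (u : S) : 'rV[R]_8 :=
  r 0 0 *: phi1 u + r 0 1 *: phi2 u + psi u.

Definition local_iota (c : chart R S) (y : 'rV[R]_(2 + 2)) : 'rV[R]_8 :=
  iota_M (lsubmx y) (cinv c (rsubmx y)).

(* The rows span the image of the differential of iota_M at p. *)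
Definition tangent_mx (c : chart R S) (p : 'rV[R]_2 * S) : 'M[R]_(2 + 2, 8) :=
  jacobian (local_iota c) (row_mx p.1 (cmap c p.2)).

(* row_free: the differential of iota_M at p is injective *)
Definition immersion_at (p : 'rV[R]_2 * S) : Prop :=
  exists c, [/\ atlas c, cdom c p.2 & row_free (tangent_mx c p)].

Definition singularities_nowhere_dense : Prop :=
  forall u : S, nowhere_dense [set r : 'rV[R]_2 | ~ immersion_at (r, u)].

Definition planar : Prop :=
  exists (q : 'rV[R]_8) (W : 'M[R]_(4, 8)),
    row_free W /\ forall r u, (iota_M r u - q <= W)%MS.

(* An orientation of the nonsingular part, presented by a (possibly
   discontinuous) choice of oriented orthonormal bases E p of its tangent
   spaces.  For p' near p, the sign of det (E p' (E p)^T) compares the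
   orientation at p' with the one at p through orthogonal projection, so the
   last clause says that the orientation is locally constant. *)
Definition orientation (E : 'rV[R]_2 * S -> 'M[R]_(4, 8)) : Prop :=
  [/\ forall p, immersion_at p -> E p *m (E p)^T = 1%:M,
      forall p c, immersion_at p -> atlas c -> cdom c p.2 ->
        (E p :=: tangent_mx c p)%MS &
      forall p, immersion_at p ->
        \forall p' \near p, immersion_at p' -> 0 < \det (E p' *m (E p)^T)].

(* \det (v *m (E p)^T) is the Riemannian volume form of the tangent space
   oriented by E p, evaluated at the rows of v. *)
Definition special_lagrangian : Prop :=
  exists2 E, orientation E &
    forall p, immersion_at p -> forall v : 'M[R]_(4, 8), (v <= E p)%MS ->
      complex.Re (Omega (fun i => row i v)) = \det (v *m (E p)^T).

Definition oriented_coordinates (c : chart R S) : Prop :=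
  coordinates c /\
  forall u r, cdom c u -> immersion_at (r, u) ->
    0 < Cayley (phi1 u) (phi2 u) (partial_s c (iota_M r) u)
          (partial_t c (iota_M r) u).

End Ruled.

Section FormsTheory.
Context {R : realType}.
Implicit Types x y z w : 'rV[R]_8.

Lemma omegaCE x y :
  omegaC x y = (\sum_(j < 4) (x 0 (inord j.*2) * y 0 (inord j.*2.+1)
                              - x 0 (inord j.*2.+1) * y 0 (inord j.*2)))%:C%C.
Proof.
rewrite /omegaC mulr_sumr rmorph_sum /=; apply: eq_bigr => j _.
rewrite /wedge11 /zcoord /=.
set a := x _ _; set b := x _ _; set c := y _ _; set d := y _ _.
have n2 : (2%:R : R[i]) != 0 by rewrite pnatr_eq0.
apply: (mulfI n2); rewrite mulrA mulrCA mulfV // mulr1.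
rewrite mulr_natl mulr2n; simpc; congr Complex.
  by ring.
by ring.
Qed.

Lemma omegaE x y :
  omega x y = \sum_(j < 4) (x 0 (inord j.*2) * y 0 (inord j.*2.+1)
                            - x 0 (inord j.*2.+1) * y 0 (inord j.*2)).
Proof. by rewrite /omega omegaCE. Qed.

Lemma ReOmega_coord x y z w :
  ReOmega x y z w = \sum_(k < 8) ReOmega x y z (delta_mx 0 k) * w 0 k.
Proof.
have zE j : zcoord j w = \sum_(k < 8) zcoord j (delta_mx 0 k) * (w 0 k)%:C%C.
  have -> : zcoord j w = (w 0 (inord j.*2))%:C%C
                       + Complex 0 1 * (w 0 (inord j.*2.+1))%:C%C.
    by rewrite /zcoord; simpc.
  transitivity (\sum_(k < 8) ((inord j.*2 == k)%:R * (w 0 k)%:C%C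
                 + Complex 0 1 * (inord j.*2.+1 == k)%:R * (w 0 k)%:C%C)).
    rewrite big_split /=; congr (_ + _).
      rewrite (bigD1 (inord j.*2)) //= eqxx mul1r big1 ?addr0 // => k.
      by rewrite eq_sym => /negPf ->; rewrite mul0r.
    rewrite (bigD1 (inord j.*2.+1)) //= eqxx mulr1 big1 ?addr0 // => k.
    by rewrite eq_sym => /negPf ->; rewrite mulr0 mul0r.
  apply: eq_bigr => k _; rewrite -mulrDl; congr (_ * _).
  rewrite /zcoord !mxE eqxx /= -!(rmorph_nat (real_complex R)) /=.
  by simpc.
have expand v : Omega (quad x y z v) = \sum_j zcoord j v *
    cofactor (\matrix_(a < 4, b < 4) zcoord b (quad x y z 0 a)) ord_max j.
  rewrite /Omega (expand_det_row _ ord_max); apply: eq_bigr => j _.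
  rewrite mxE; congr (_ * _); rewrite /cofactor; congr (_ * \det _).
  apply/matrixP => a b; rewrite !mxE.
  by case: a => -[|[|[|]]].
rewrite /ReOmega expand; under eq_bigr do rewrite zE mulr_suml.
rewrite exchange_big /= raddf_sum; apply: eq_bigr => k _ /=.
rewrite expand.
have -> (c : R[i]) (a : R) : complex.Re c * a = complex.Re (c * a%:C%C).
  by case: c => ? ?; simpc.
congr complex.Re; rewrite mulr_suml; apply: eq_bigr => j _.
by rewrite mulrAC.
Qed.

Lemma crossP x y z w : inner (cross x y z) w = ReOmega x y z w.
Proof. by rewrite ReOmega_coord; apply: eq_bigr => k _; rewrite mxE. Qed.

Lemma cross_unique x y z v :
  (forall w, inner v w = ReOmega x y z w) -> v = cross x y z.
Proof.
move=> H; apply/rowP => k; rewrite mxE -H /inner (bigD1 k) //= big1.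
  by rewrite mxE !eqxx mulr1 addr0.
by move=> l /negPf lk; rewrite mxE lk andbF mulr0.
Qed.

End FormsTheory.

(* Main.v *)
Require Import Defs.
From HB Require Import structures.
From mathcomp Require Import all_boot all_order all_fingroup all_algebra.
From mathcomp Require Import all_classical all_reals all_analysis.
From mathcomp Require Import complex ring lra.
Set Implicit Arguments.
Unset Strict Implicit.
Unset Printing Implicit Defensive.
Import Order.TTheory GRing.Theory Num.Theory.
Import numFieldNormedType.Exports.
Local Open Scope classical_set_scope.
Local Open Scope ring_scope.

(* Write [J = cross p q] for orthonormal [p = phi1], [q = phi2] with
   [omega p q = 0]: on the complex orthogonal of p and q it is an isometry with
   [J^2 = -1], and a 4-plane containing p, q is special Lagrangian iff it is
   spanned by p, q, v, J v with v in that orthogonal.  Given the equations, the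
   tangent planes are of this form, whence the "if" part.

   Conversely, let [chi = iota_M r0] for an immersion point and let a bar denote
   the component orthogonal to p and q.  The special Lagrangian condition says
   that [bar chi_t] is a combination [X bar chi_s + Y J (bar chi_s)]; solving the
   analytic Beltrami equation with coefficients X, Y gives coordinates in which
   [bar chi_t = J (bar chi_s)].  In these coordinates the condition on every
   other [iota_M r] shows that either [bar phi_t = J phi_s] for both phi's, which
   is the required system, or all first derivatives of phi1, phi2 lie in
   [W = span (p, q, v, J v)], v = bar chi_s.  In the second case comparing mixed
   derivatives modulo W shows that W is locally constant; by analytic
   continuation over the connected surface M lies in an affine 4-plane, which
   is excluded. *)

(** * Weighted norms of polynomials *)

(** The special Lagrangian condition is given only at immersion points, which are dense in each
    fibre. It is therefore rewritten as division-free identities, polynomial in r (isotropy and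
    [pencil]), which extend to all r; the freedom to move r at a fixed point of the surface is what
    separates the two cases. The sign of Y depends on the atlas chart and is never determined: once
    bar chi_t = J (bar chi_s), the value of Re Omega on p, q, chi_s, chi_t is |bar chi_s|^2, so the
    new coordinates are oriented automatically. Analyticity enters in three places: the Beltrami
    equation is solved by power series, the resulting change of coordinates needs an analytic
    inverse, and a plane found on one chart must be spread over the whole surface. All estimates are
    made on polynomials, in a weighted l1 norm of the coefficients. The plane is spread by encoding
    it as linear equations with constant coefficients, to which the identity theorem applies one at
    a time. *)

Section PolyNorm.
Context {R : realFieldType}.

Lemma ler_double (x : R) : 0 <= x -> x <= 2 * x.
Proof. by move=> x0; rewrite ler_peMl // ler1n. Qed.

(** The ring stays abstract so that the construction below can be iterated: the absolute value on R
    yields a norm on [{poly R}], which in turn yields one on [{poly {poly R}}]. *)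
Record seminorm (A : comNzRingType) (nu : A -> R) : Prop := Seminorm {
  snorm0 : nu 0 = 0;
  snorm_ge0 : forall x, 0 <= nu x;
  snormD : forall x y, nu (x + y) <= nu x + nu y;
  snormN : forall x, nu (- x) = nu x;
  snormM : forall x y, nu (x * y) <= nu x * nu y;
  snorm1 : nu 1 <= 1
}.

(** This weighted l1 norm is submultiplicative, dominates values on the ball of radius rho, and
    controls every coefficient, which the sup over real points would not do directly. *)
Definition pnorm (A : comNzRingType) (nu : A -> R) (rho : R) (p : {poly A}) : R :=
  \sum_(i < size p) nu p`_i * rho ^+ i.

Section Pnorm.
Context {A : comNzRingType} {nu : A -> R}.
Hypothesis nuP : seminorm nu.

Lemma snorm_sum (I : Type) (r : seq I) (P : pred I) (F : I -> A) :
  nu (\sum_(i <- r | P i) F i) <= \sum_(i <- r | P i) nu (F i).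
Proof.
elim/big_ind2 : _ => //; first by rewrite (snorm0 nuP).
by move=> x1 x2 y1 y2 h1 h2; apply: le_trans (snormD nuP _ _) (lerD h1 h2).
Qed.

Lemma snormX x i : nu (x ^+ i) <= nu x ^+ i.
Proof.
elim: i => [|i IH]; first by rewrite !expr0 (snorm1 nuP).
rewrite !exprS; apply: le_trans (snormM nuP _ _) _.
by rewrite ler_wpM2l // (snorm_ge0 nuP).
Qed.

Lemma pnormE (rho : R) n (p : {poly A}) : (size p <= n)%N ->
  pnorm nu rho p = \sum_(i < n) nu p`_i * rho ^+ i.
Proof.
move=> pn; rewrite /pnorm (big_ord_widen n (fun i => nu p`_i * rho ^+ i) pn).
rewrite big_mkcond /=; apply: eq_bigr => i _; case: ltnP => // h.
by rewrite nth_default // (snorm0 nuP) mul0r.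
Qed.

Variable rho : R.
Hypothesis rho0 : 0 <= rho.
Local Notation N := (pnorm nu rho).

Lemma pnorm_ge0 p : 0 <= N p.
Proof. by apply: sumr_ge0 => i _; rewrite mulr_ge0 ?exprn_ge0 ?(snorm_ge0 nuP). Qed.

Lemma pnorm0 : N 0 = 0.
Proof. by rewrite /pnorm size_poly0 big_ord0. Qed.

Lemma pnormN p : N (- p) = N p.
Proof.
rewrite /pnorm size_polyN; apply: eq_bigr => i _.
by rewrite coefN (snormN nuP).
Qed.

Lemma pnormD p q : N (p + q) <= N p + N q.
Proof.
set n := maxn (size p) (size q).
rewrite (@pnormE _ n (p + q)) ?(leq_trans (size_polyD _ _)) //.
rewrite (@pnormE _ n p) ?leq_maxl // (@pnormE _ n q) ?leq_maxr //.
rewrite -big_split /=; apply: ler_sum => i _.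
by rewrite coefD -mulrDl ler_wpM2r ?exprn_ge0 // (snormD nuP).
Qed.

Lemma pnormMX p : N (p * 'X) = N p * rho.
Proof.
have sz : (size (p * 'X)%R <= (size p).+1)%N.
  by case: (eqVneq p 0) => [->|p0]; rewrite ?mul0r ?size_poly0 // size_mulX.
rewrite (pnormE _ sz) big_ord_recl coefMX eqxx (snorm0 nuP) mul0r add0r.
rewrite /pnorm mulr_suml; apply: eq_bigr => i _.
by rewrite coefMX /= /bump /= add1n exprSr mulrA.
Qed.

Lemma pnormC c : N c%:P = nu c.
Proof. by rewrite (@pnormE _ 1) ?size_polyC_leq1 // big_ord1 coefC eqxx expr0 mulr1. Qed.

Lemma pnormMXaddC p c : N (p * 'X + c%:P) = N p * rho + nu c.
Proof.
have sz : (size (p * 'X + c%:P)%R <= (size p).+1)%N by rewrite size_MXaddC; case: ifP.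
rewrite (pnormE _ sz) big_ord_recl coefD coefMX coefC !eqxx add0r expr0 mulr1.
rewrite addrC /pnorm mulr_suml; congr (_ + _); apply: eq_bigr => i _.
by rewrite coefD coefMX coefC /= /bump /= add1n addr0 exprSr mulrA.
Qed.

Lemma pnormCM c p : N (c%:P * p) <= nu c * N p.
Proof.
rewrite mul_polyC (@pnormE _ (size p)) ?size_scale_leq // /pnorm mulr_sumr.
apply: ler_sum => i _; rewrite coefZ mulrA ler_wpM2r ?exprn_ge0 //.
exact: snormM nuP _ _.
Qed.

Lemma pnormM p q : N (p * q) <= N p * N q.
Proof.
elim/poly_ind: p => [|p c IH]; first by rewrite mul0r pnorm0 mul0r.
rewrite mulrDl pnormMXaddC mulrDl; apply: le_trans (pnormD _ _) _.
by apply: lerD (pnormCM _ _); rewrite !(mulrAC _ _ q) pnormMX mulrAC ler_wpM2r.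
Qed.

Lemma pnorm_seminorm : seminorm N.
Proof.
split; [exact: pnorm0|exact: pnorm_ge0|exact: pnormD|exact: pnormN|exact: pnormM|].
by rewrite pnormC (snorm1 nuP).
Qed.

Lemma pnorm_polyX : N 'X <= rho.
Proof.
by rewrite -['X]mul1r pnormMX pnormC ler_piMl // (snorm1 nuP).
Qed.

Lemma pnorm_le_radius sigma p : rho <= sigma -> N p <= pnorm nu sigma p.
Proof.
move=> rs; apply: ler_sum => i _; rewrite ler_wpM2l ?(snorm_ge0 nuP) //.
by rewrite lerXn2r // nnegrE // (le_trans rho0).
Qed.

Lemma natr_le_exp2 n : n%:R <= 2 ^+ n :> R.
Proof. by rewrite -natrX ler_nat ltnW // ltn_expl. Qed.

Lemma snorm_natmul a n : nu (a *+ n) <= nu a *+ n.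
Proof.
elim: n => [|n IH]; first by rewrite !mulr0n (snorm0 nuP).
by rewrite !mulrS; apply: le_trans (snormD nuP _ _) _; rewrite lerD2l.
Qed.

(** A Cauchy estimate without integrals: doubling the radius gains [2 ^+ i] in degree i, which
    absorbs the factor i created by the derivative. *)
Lemma pnorm_deriv p : N p^`() * rho <= pnorm nu (2 * rho) p.
Proof.
rewrite -pnormMX (@pnormE _ (size p)); last first.
  case: (eqVneq p 0) => [->|p0]; first by rewrite deriv0 mul0r size_poly0.
  case: (eqVneq p^`() 0) => [->|d0]; first by rewrite mul0r size_poly0.
  by rewrite size_mulX // lt_size_deriv.
apply: ler_sum => -[[|i] hi] _ /=.
  by rewrite coefMX eqxx (snorm0 nuP) mul0r mulr_ge0 ?(snorm_ge0 nuP).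
rewrite coefMX /= coef_deriv exprMn mulrCA mulrA ler_wpM2r ?exprn_ge0 //.
apply: le_trans (snorm_natmul _ _) _.
by rewrite -[leLHS]mulr_natl ler_wpM2r ?(snorm_ge0 nuP) // natr_le_exp2.
Qed.

End Pnorm.

Lemma pnorm_mono (A : comNzRingType) (mu nu : A -> R) rho p :
  0 <= rho -> (forall a, mu a <= nu a) -> pnorm mu rho p <= pnorm nu rho p.
Proof. by move=> r0 mn; apply: ler_sum => i _; rewrite ler_wpM2r ?exprn_ge0. Qed.

Section Evaluation.
Context {A B : comNzRingType} {mu : A -> R} {nu : B -> R}.
Hypotheses (muP : seminorm mu) (nuP : seminorm nu).
Variable rho : R.
Hypothesis rho0 : 0 <= rho.

(** Coefficients are sent to another ring before evaluation, so that one set of estimates covers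
    evaluation at real points and substitution of polynomials. *)
Definition hev (f : A -> B) (p : {poly A}) (x : B) : B := (map_poly f p).[x].

Lemma hevE (f : {additive A -> B}) p x :
  hev f p x = \sum_(i < size p) f p`_i * x ^+ i.
Proof.
rewrite /hev (@horner_coef_wide _ (size p)) ?size_poly //.
by apply: eq_bigr => i _; rewrite coef_map.
Qed.

Lemma hev_bound (f : {additive A -> B}) p x :
  (forall a, nu (f a) <= mu a) -> nu x <= rho -> nu (hev f p x) <= pnorm mu rho p.
Proof.
move=> fb xr; rewrite hevE; apply: le_trans (snorm_sum nuP _ _ _) _.
apply: ler_sum => i _; apply: le_trans (snormM nuP _ _) _.
apply: ler_pM; rewrite ?(snorm_ge0 nuP) //.
by apply: le_trans (snormX nuP _ _) _; rewrite lerXn2r // nnegrE (snorm_ge0 nuP).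
Qed.

(** The sharp constant is i times the power i - 1 of rho; bounding i by [2 ^+ i] and multiplying
    through by rho removes both the integer factor and the shifted exponent. *)
Lemma expr_lipschitz (x y : B) i : nu x <= rho -> nu y <= rho ->
  nu (x ^+ i - y ^+ i) * rho <= (2 * rho) ^+ i * nu (x - y).
Proof.
move=> xr yr; elim: i => [|i IH].
  by rewrite !expr0 subrr (snorm0 nuP) mul0r mul1r (snorm_ge0 nuP).
have -> : x ^+ i.+1 - y ^+ i.+1 = x * (x ^+ i - y ^+ i) + (x - y) * y ^+ i.
  by rewrite !exprS; ring.
set d := nu (x - y) in IH *; have d0 : 0 <= d by exact: snorm_ge0 nuP _.
have h1 : nu (x * (x ^+ i - y ^+ i)) <= rho * nu (x ^+ i - y ^+ i).
  by apply: le_trans (snormM nuP _ _) _; rewrite ler_wpM2r ?(snorm_ge0 nuP).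
have h2 : nu ((x - y) * y ^+ i) <= d * rho ^+ i.
  apply: le_trans (snormM nuP _ _) _; rewrite ler_wpM2l //.
  by apply: le_trans (snormX nuP _ _) _; rewrite lerXn2r // nnegrE (snorm_ge0 nuP).
have h3 : rho ^+ i <= (2 * rho) ^+ i.
  by rewrite lerXn2r ?nnegrE ?mulr_ge0 // ler_double.
apply: (@le_trans _ _ ((rho * nu (x ^+ i - y ^+ i) + d * rho ^+ i) * rho)).
  by rewrite ler_wpM2r //; apply: le_trans (snormD nuP _ _) (lerD h1 h2).
have -> : (rho * nu (x ^+ i - y ^+ i) + d * rho ^+ i) * rho
    = rho * (nu (x ^+ i - y ^+ i) * rho) + rho * d * rho ^+ i by ring.
have -> : (2 * rho) ^+ i.+1 * d = rho * ((2 * rho) ^+ i * d) + rho * d * (2 * rho) ^+ i.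
  by rewrite exprS; ring.
by apply: lerD; rewrite ler_wpM2l // mulr_ge0.
Qed.

Lemma hev_lipschitz (f : {additive A -> B}) p x y :
  (forall a, nu (f a) <= mu a) -> nu x <= rho -> nu y <= rho ->
  nu (hev f p x - hev f p y) * rho <= pnorm mu (2 * rho) p * nu (x - y).
Proof.
move=> fb xr yr; rewrite !hevE -sumrB.
apply: (@le_trans _ _ ((\sum_(i < size p) nu (f p`_i * x ^+ i - f p`_i * y ^+ i)) * rho)).
  by rewrite ler_wpM2r // (snorm_sum nuP).
rewrite /pnorm !mulr_suml; apply: ler_sum => i _.
rewrite -mulrBr; apply: (@le_trans _ _ (mu p`_i * (nu (x ^+ i - y ^+ i) * rho))).
  rewrite mulrA ler_wpM2r //; apply: le_trans (snormM nuP _ _) _.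
  by rewrite ler_wpM2r ?(snorm_ge0 nuP).
by rewrite -mulrA ler_wpM2l ?(snorm_ge0 muP) // expr_lipschitz.
Qed.

(** Here the point is fixed and the coefficient map varies. For a polynomial in two variables this
    is the effect of moving the inner variable. *)
Lemma hev_perturb (f g : {additive A -> B}) (mu' : A -> R) K p x :
  (forall a, nu (f a - g a) <= mu' a * K) -> nu x <= rho -> 0 <= K ->
  nu (hev f p x - hev g p x) <= pnorm mu' rho p * K.
Proof.
move=> fg xr K0; rewrite !hevE -sumrB; apply: le_trans (snorm_sum nuP _ _ _) _.
rewrite /pnorm mulr_suml; apply: ler_sum => i _; rewrite -mulrBl mulrAC.
apply: le_trans (snormM nuP _ _) _; apply: ler_pM; rewrite ?(snorm_ge0 nuP) //.
by apply: le_trans (snormX nuP _ _) _; rewrite lerXn2r // nnegrE (snorm_ge0 nuP).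
Qed.

End Evaluation.

Section HevMorph.
Context {A B : comNzRingType}.

Lemma hev_is_additive (f : {additive A -> B}) x : zmod_morphism (fun p => hev f p x).
Proof.
move=> p q; rewrite /hev; have -> : map_poly f (p - q) = map_poly f p - map_poly f q.
  by apply/polyP => i; rewrite coefB !coef_map coefB raddfB.
by rewrite hornerD hornerN.
Qed.

Lemma hev_is_multiplicative (f : {rmorphism A -> B}) x :
  monoid_morphism (fun p => hev f p x).
Proof.
split; first by rewrite /hev rmorph1 hornerC.
by move=> p q; rewrite /hev rmorphM hornerM.
Qed.

Lemma hevC (f : {additive A -> B}) c x : hev f c%:P x = f c.
Proof. by rewrite /hev map_polyC hornerC. Qed.

Lemma hevX (f : {rmorphism A -> B}) x : hev f 'X x = x.
Proof. by rewrite /hev map_polyX hornerX. Qed.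

End HevMorph.
End PolyNorm.

(** * Polynomials in two variables *)

Section Bivariate.
Context {R : realFieldType}.
Notation poly2 := {poly {poly R}}.

Lemma normr_seminorm : seminorm (fun x : R => `|x|).
Proof.
split=> [|x|x y|x|x y|]; rewrite ?normr0 ?normrN ?normrM ?normr1 //.
exact: ler_normD.
Qed.

Definition N1 (rho : R) : {poly R} -> R := pnorm (fun x : R => `|x|) rho.
Definition N2 (rho : R) : poly2 -> R := pnorm (N1 rho) rho.

Lemma N1_seminorm rho : 0 <= rho -> seminorm (N1 rho).
Proof. exact: pnorm_seminorm normr_seminorm _. Qed.

Lemma N2_seminorm rho : 0 <= rho -> seminorm (N2 rho).
Proof. by move=> r0; exact: pnorm_seminorm (N1_seminorm r0) _ r0. Qed.

Lemma N2_le_radius rho sigma p : 0 <= rho -> rho <= sigma -> N2 rho p <= N2 sigma p.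
Proof.
move=> r0 rs; apply: le_trans (pnorm_le_radius (N1_seminorm r0) r0 _ rs) _.
apply: pnorm_mono; first exact: le_trans r0 rs.
by move=> a; exact: pnorm_le_radius normr_seminorm _ r0 _ _ rs.
Qed.

(** The outer indeterminate stands for the first coordinate s and the inner one for the second
    coordinate t. *)
Definition pX : poly2 := 'X.
Definition pY : poly2 := 'X%:P.

Lemma N2_pX rho : 0 <= rho -> N2 rho pX <= rho.
Proof. by move=> r0; exact: pnorm_polyX (N1_seminorm r0) _ r0. Qed.

Lemma N2_pY rho : 0 <= rho -> N2 rho pY <= rho.
Proof.
move=> r0; rewrite /N2 pnormC; last exact: N1_seminorm.
exact: pnorm_polyX normr_seminorm _ r0.
Qed.

Definition pC (c : R) : poly2 := c%:P%:P.

Lemma pC_is_additive : zmod_morphism pC.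
Proof. by move=> x y; rewrite /pC !polyCB. Qed.
Lemma pC_is_multiplicative : monoid_morphism pC.
Proof. by split=> [|x y]; rewrite /pC ?polyC1 // !polyCM. Qed.
HB.instance Definition _ := GRing.isZmodMorphism.Build R poly2 pC pC_is_additive.
HB.instance Definition _ := GRing.isMonoidMorphism.Build R poly2 pC pC_is_multiplicative.

Lemma N2_pC rho c : 0 <= rho -> N2 rho (pC c) = `|c|.
Proof.
move=> r0; rewrite /N2 pnormC; last exact: N1_seminorm.
by rewrite /N1 pnormC //; exact: normr_seminorm.
Qed.

Definition coef2 (p : poly2) i j : R := p`_i`_j.

Definition deg2 (p : poly2) : nat := maxn (size p) (\max_(i < size p) size (nth 0%R p i)).

Lemma size_coef_deg2 (p : poly2) i : (size (p`_i)%R <= deg2 p)%N.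
Proof.
case: (ltnP i (size p)) => h; last by rewrite nth_default // size_poly0.
by rewrite leq_max (leq_bigmax_cond (Ordinal h)) ?orbT.
Qed.

Lemma N2E rho n p : 0 <= rho -> (deg2 p <= n)%N ->
  N2 rho p = \sum_(i < n) \sum_(j < n) `|coef2 p i j| * rho ^+ (i + j).
Proof.
move=> r0 dn; rewrite /N2 (pnormE (N1_seminorm r0) _ (n := n)); last first.
  by apply: leq_trans dn; rewrite leq_maxl.
apply: eq_bigr => i _; rewrite /N1 (pnormE normr_seminorm _ (n := n)); last first.
  by apply: leq_trans dn; exact: size_coef_deg2.
by rewrite mulr_suml; apply: eq_bigr => j _; rewrite -mulrA exprD (mulrC (rho ^+ j)).
Qed.

Lemma N2_square_le rho n p : 0 <= rho ->
  \sum_(i < n) \sum_(j < n) `|coef2 p i j| * rho ^+ (i + j) <= N2 rho p.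
Proof.
move=> r0; set m := maxn n (deg2 p).
have nm : (n <= m)%N by rewrite leq_maxl.
rewrite (@N2E _ m) ?leq_maxr //.
rewrite (big_ord_widen m (fun i => \sum_(j < n) `|coef2 p i j| * rho ^+ (i + j)) nm).
rewrite big_mkcond /=; apply: ler_sum => i _.
have nn k l : 0 <= `|coef2 p k l| * rho ^+ (k + l) by rewrite mulr_ge0 ?exprn_ge0.
case: ifP => _; last by apply: sumr_ge0.
rewrite (big_ord_widen m (fun j => `|coef2 p i j| * rho ^+ (i + j)) nm).
by rewrite big_mkcond /=; apply: ler_sum => j _; case: ifP.
Qed.

Lemma coef2_le_N2 rho p i j : 0 <= rho -> `|coef2 p i j| * rho ^+ (i + j) <= N2 rho p.
Proof.
move=> r0; set n := (maxn i j).+1; apply: le_trans (N2_square_le n p r0).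
have hi : (i < n)%N by rewrite ltnS leq_maxl.
have hj : (j < n)%N by rewrite ltnS leq_maxr.
have nn k l : 0 <= `|coef2 p k l| * rho ^+ (k + l) by rewrite mulr_ge0 ?exprn_ge0.
rewrite (bigD1 (Ordinal hi)) //= (bigD1 (Ordinal hj)) //= -addrA lerDl.
by apply: addr_ge0; apply: sumr_ge0 => // k _; apply: sumr_ge0.
Qed.

Lemma N2_dominated rho p q : 0 <= rho ->
  (forall i j, `|coef2 p i j| <= `|coef2 q i j|) -> N2 rho p <= N2 rho q.
Proof.
move=> r0 pq; rewrite (N2E r0 (leqnn _)); apply: le_trans (N2_square_le _ q r0).
by do 2 (apply: ler_sum => ? _); rewrite ler_wpM2r ?exprn_ge0.
Qed.

Lemma coef2D p q i j : coef2 (p + q) i j = coef2 p i j + coef2 q i j.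
Proof. by rewrite /coef2 !coefD. Qed.
Lemma coef2N p i j : coef2 (- p) i j = - coef2 p i j.
Proof. by rewrite /coef2 !coefN. Qed.
Lemma coef2B p q i j : coef2 (p - q) i j = coef2 p i j - coef2 q i j.
Proof. by rewrite coef2D coef2N. Qed.
Lemma coef2C c i j : coef2 (pC c) i j = (c *+ (i == 0%N)) *+ (j == 0%N).
Proof. by rewrite /coef2 coefC; case: (i == 0%N); rewrite /= ?coefC ?coef0 ?mul0rn //; case: (j == 0%N). Qed.

Lemma coef2M p q i j : coef2 (p * q) i j =
  \sum_(k < i.+1) \sum_(l < j.+1) coef2 p k l * coef2 q (i - k) (j - l).
Proof.
by rewrite /coef2 coefM coef_sum; apply: eq_bigr => k _; rewrite coefM.
Qed.

(** The second-order Taylor remainder at the origin. Its quadratic decay under shrinking of the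
    radius gives both differentiability and the contraction in the inverse function theorem. *)
Definition hi (p : poly2) : poly2 :=
  p - (pC (coef2 p 0 0) + pC (coef2 p 1 0) * pX + pC (coef2 p 0 1) * pY).

Lemma coef2_hi p i j : coef2 (hi p) i j = if (i + j < 2)%N then 0 else coef2 p i j.
Proof.
rewrite /hi coef2B !coef2D coef2C /pC /pX /pY.
rewrite [coef2 (_ * 'X) _ _]/coef2 coefMX coefC.
rewrite [coef2 (_ * _%:P) _ _]/coef2 -polyCM coefC.
by case: i => [|[|i]]; case: j => [|[|j]];
  rewrite /= ?coefMX ?coefC ?coef0 /= ?mulr1n ?mulr0n ?addr0 ?add0r ?subrr ?subr0.
Qed.

Lemma hiB p q : hi (p - q) = hi p - hi q.
Proof.
rewrite /hi !coef2B !raddfB /=; ring.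
Qed.

Lemma N2_hi rho p : 0 <= rho -> N2 rho (hi p) <= N2 rho p.
Proof.
by move=> r0; apply: N2_dominated => // i j; rewrite coef2_hi; case: ifP; rewrite ?normr0.
Qed.

(** Only monomials of degree at least 2 remain, and for these the ratio sigma/rho occurs at least
    squared. The product form avoids dividing by a radius that may be zero. *)
Lemma N2_hi_scale rho sigma p : 0 <= sigma -> sigma <= rho ->
  N2 sigma (hi p) * rho ^+ 2 <= sigma ^+ 2 * N2 rho p.
Proof.
move=> s0 sr; have r0 := le_trans s0 sr.
apply: le_trans (_ : sigma ^+ 2 * N2 rho (hi p) <= _); last first.
  by rewrite ler_wpM2l ?exprn_ge0 // N2_hi.
rewrite !(N2E _ (leqnn (deg2 (hi p)))) // mulr_suml mulr_sumr.
apply: ler_sum => i _; rewrite mulr_suml mulr_sumr; apply: ler_sum => j _.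
rewrite coef2_hi; case: ltnP => ij; first by rewrite normr0 !mul0r mulr0.
rewrite -mulrA [leRHS]mulrCA; apply: ler_wpM2l => //.
rewrite -(subnKC ij); set k := (_ - _)%N.
rewrite (exprD sigma 2 k) (exprD rho 2 k) -mulrA ler_wpM2l ?exprn_ge0 //.
by rewrite [leRHS]mulrC ler_wpM2r ?exprn_ge0 // lerXn2r // nnegrE.
Qed.

Definition dX (p : poly2) : poly2 := p^`().
Definition dY (p : poly2) : poly2 := map_poly (@deriv R) p.

Lemma coef2_dX p i j : coef2 (dX p) i j = coef2 p i.+1 j *+ i.+1.
Proof. by rewrite /coef2 /dX coef_deriv coefMn. Qed.
Lemma coef2_dY p i j : coef2 (dY p) i j = coef2 p i j.+1 *+ j.+1.
Proof. by rewrite /coef2 /dY coef_map_id0 ?deriv0 // coef_deriv. Qed.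

Lemma poly2P p q : (forall i j, coef2 p i j = coef2 q i j) -> p = q.
Proof. by move=> h; apply/polyP => i; apply/polyP => j; exact: h. Qed.

Lemma dX_dY p : dX (dY p) = dY (dX p).
Proof. by apply: poly2P => i j; rewrite coef2_dX !coef2_dY coef2_dX -!mulrnA mulnC. Qed.

Lemma dXB p q : dX (p - q) = dX p - dX q.
Proof. exact: derivB. Qed.
Lemma dYB p q : dY (p - q) = dY p - dY q.
Proof.
by apply: poly2P => i j; rewrite coef2B !coef2_dY coef2B mulrnBl.
Qed.

Lemma dYD p q : dY (p + q) = dY p + dY q.
Proof.
by apply: poly2P => i j; rewrite coef2D !coef2_dY coef2D mulrnDl.
Qed.

Lemma N2_dX rho p : 0 <= rho -> N2 rho (dX p) * rho <= N2 (2 * rho) p.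
Proof.
move=> r0; apply: le_trans (pnorm_deriv (N1_seminorm r0) r0 p) _.
apply: pnorm_mono; first by lra.
by move=> a; exact: pnorm_le_radius normr_seminorm _ r0 _ _ (ler_double r0).
Qed.

Lemma N2_dY rho p : 0 <= rho -> N2 rho (dY p) * rho <= N2 (2 * rho) p.
Proof.
move=> r0; have r2 : 0 <= 2 * rho by lra.
set n := maxn (deg2 p) (deg2 (dY p)).
rewrite (@N2E _ n (dY p)) ?leq_maxr // mulr_suml.
rewrite (@N2E _ n.+1 p) // ?leqW ?leq_maxl // big_ord_recr /= ler_wpDr //.
  by apply: sumr_ge0 => j _; rewrite mulr_ge0 ?exprn_ge0.
apply: ler_sum => i _; rewrite mulr_suml big_ord_recl ler_wpDl ?mulr_ge0 ?exprn_ge0 //.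
apply: ler_sum => j _; rewrite coef2_dY /= /bump /= add1n normrMn exprMn addnS.
rewrite (exprSr rho) -[_ *+ j.+1]mulr_natr -!mulrA ler_wpM2l //.
rewrite ler_wpM2r ?mulr_ge0 ?exprn_ge0 //; apply: le_trans (natr_le_exp2 _) _.
by rewrite -addnS ler_weXn2l ?leq_addl // ler1n.
Qed.

Section Eval2.
Context {B : comNzRingType} {nu : B -> R}.
Hypothesis nuP : seminorm nu.
Variable f : {rmorphism R -> B}.
Hypothesis f_bound : forall a, nu (f a) <= `|a|.

Definition ev1 (y : B) (q : {poly R}) : B := hev f q y.
HB.instance Definition _ y :=
  GRing.isZmodMorphism.Build {poly R} B (ev1 y) (hev_is_additive f y).
HB.instance Definition _ y :=
  GRing.isMonoidMorphism.Build {poly R} B (ev1 y) (hev_is_multiplicative f y).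

Definition ev (x y : B) (p : poly2) : B := hev (ev1 y) p x.
HB.instance Definition _ x y :=
  GRing.isZmodMorphism.Build poly2 B (ev x y) (hev_is_additive (ev1 y) x).
HB.instance Definition _ x y :=
  GRing.isMonoidMorphism.Build poly2 B (ev x y) (hev_is_multiplicative (ev1 y) x).

Lemma ev_pX x y : ev x y pX = x.
Proof. exact: hevX. Qed.
Lemma ev_pY x y : ev x y pY = y.
Proof. by rewrite /ev hevC; exact: hevX. Qed.
Lemma ev_pC x y c : ev x y (pC c) = f c.
Proof. by rewrite /ev hevC; exact: hevC. Qed.

Lemma evE x y n p : (deg2 p <= n)%N ->
  ev x y p = \sum_(i < n) \sum_(j < n) f (coef2 p i j) * x ^+ i * y ^+ j.
Proof.
move=> dn; rewrite /ev /hev (@horner_coef_wide _ n); last first.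
  by apply: leq_trans (size_poly _ _) _; apply: leq_trans dn; rewrite leq_maxl.
apply: eq_bigr => i _; rewrite coef_map /=.
have -> : ev1 y p`_i = (map_poly f p`_i).[y] by [].
rewrite (@horner_coef_wide _ n); last first.
  by apply: leq_trans (size_poly _ _) _; apply: leq_trans dn; exact: size_coef_deg2.
by rewrite mulr_suml; apply: eq_bigr => j _; rewrite coef_map mulrAC.
Qed.

Lemma ev_bound rho x y p : nu x <= rho -> nu y <= rho -> nu (ev x y p) <= N2 rho p.
Proof.
move=> xr yr; have r0 := le_trans (snorm_ge0 nuP x) xr.
apply: (@hev_bound _ _ _ (N1 rho) nu nuP rho r0 (ev1 y)) => // q.
exact: hev_bound.
Qed.

(** The arguments are moved one at a time: moving x is a Lipschitz estimate with fixed coefficients,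
    while moving y changes the coefficient morphism [ev1 y] and is a case of [hev_perturb]. *)
Lemma ev_lipschitz rho x y x' y' p :
  nu x <= rho -> nu y <= rho -> nu x' <= rho -> nu y' <= rho ->
  nu (ev x y p - ev x' y' p) * rho
    <= N2 (2 * rho) p * (nu (x - x') + nu (y - y')).
Proof.
move=> xr yr xr' yr'; have r0 := le_trans (snorm_ge0 nuP x) xr.
have r2 : 0 <= 2 * rho by lra.
have -> : ev x y p - ev x' y' p = (ev x y p - ev x' y p) + (ev x' y p - ev x' y' p).
  by ring.
apply: le_trans (_ : nu (ev x y p - ev x' y p) * rho + nu (ev x' y p - ev x' y' p) * rho <= _).
  by rewrite -mulrDl ler_wpM2r // (snormD nuP).
rewrite mulrDr; apply: lerD.
  apply: le_trans (_ : pnorm (N1 rho) (2 * rho) p * nu (x - x') <= _).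
    apply: (@hev_lipschitz _ _ _ (N1 rho) nu (N1_seminorm r0) nuP rho r0 (ev1 y)) => // q.
    exact: hev_bound.
  rewrite ler_wpM2r ?(snorm_ge0 nuP) //; apply: pnorm_mono => // a.
  exact: pnorm_le_radius normr_seminorm _ r0 _ _ (ler_double r0).
have [rz|rp] := eqVneq rho 0.
  by rewrite rz mulr0 mulr_ge0 ?(snorm_ge0 nuP) ?(snorm_ge0 (N2_seminorm _)) //; lra.
have rho_gt0 : 0 < rho by rewrite lt_def rp.
rewrite -ler_pdivlMr // -mulrA.
apply: le_trans (_ : pnorm (N1 (2 * rho)) rho p * (nu (y - y') / rho) <= _).
  apply: (@hev_perturb _ _ _ nu nuP rho r0 (ev1 y) (ev1 y')) => //; last first.
    by rewrite divr_ge0 ?(snorm_ge0 nuP).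
  move=> q; rewrite mulrA ler_pdivlMr //.
  exact: (@hev_lipschitz _ _ _ _ nu normr_seminorm nuP rho r0 f).
rewrite ler_wpM2r ?divr_ge0 ?(snorm_ge0 nuP) //.
by apply: pnorm_le_radius; [exact: N1_seminorm | exact: r0 | exact: ler_double].
Qed.

End Eval2.

Lemma pC_bound rho : 0 <= rho -> forall a, N2 rho (pC a) <= `|a|.
Proof. by move=> r0 a; rewrite N2_pC. Qed.

(** Evaluation and substitution are the two instances of [ev]; [pev_psub] relates them, so
    composition of functions can be carried out on the approximating polynomials. *)
Definition pev (p : poly2) (h : 'rV[R]_2) : R := ev idfun (h 0 0) (h 0 1) p.
Definition psub (q1 q2 p : poly2) : poly2 := ev pC q1 q2 p.

Lemma psubB q1 q2 p q : psub q1 q2 (p - q) = psub q1 q2 p - psub q1 q2 q.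
Proof. exact: raddfB. Qed.

Lemma pev_psub q1 q2 p h :
  pev (psub q1 q2 p) h = ev idfun (pev q1 h) (pev q2 h) p.
Proof.
rewrite /psub (evE _ _ _ (leqnn (deg2 p))) (evE _ _ _ (leqnn (deg2 p))) /pev.
rewrite raddf_sum; apply: eq_bigr => i _; rewrite raddf_sum; apply: eq_bigr => j _.
by rewrite /= !rmorphM !rmorphXn /= ev_pC.
Qed.

End Bivariate.
Notation poly2 R := {poly {poly R}}.

(** * Analytic functions of two variables *)

Section Approximation.
Context {R : realType}.
Implicit Types (rho sigma C M : R) (f g : 'rV[R]_2 -> R) (x h : 'rV[R]_2) (P Q : nat -> poly2 R).

Lemma rV2_norm_le h (r : R) : `|h| <= r <-> `|h 0 0| <= r /\ `|h 0 1| <= r.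
Proof.
split=> [hr|[h0 h1]].
  by split; apply: le_trans hr; rewrite {2}/Num.norm /= mx_normrE;
    apply/bigmax_geP; right; [exists (0, 0)|exists (0, 1)].
have r0 : 0 <= r by apply: le_trans h0.
rewrite /Num.norm /= mx_normrE; apply/bigmax_leP; split=> // -[i j] _ /=.
rewrite (ord1 i).
by case: j => -[|[|]] // hj; [move: h0|move: h1]; congr (`|h 0 _| <= r); apply/val_inj.
Qed.

Lemma cvgn_le (u : nat -> R) (l K : R) :
  u @ \oo --> l -> (forall n, u n <= K) -> l <= K.
Proof. by move=> ul uK; apply: (cvgr_to_le ul); exact: nearW. Qed.

Lemma cvgn_shift n (u : nat -> R) (l : R) :
  u @ \oo --> l -> u (n + k)%N @[k --> \oo] --> l.
Proof.
move=> ul; have -> : (fun k => u (n + k)%N) = [sequence u (k + n)%N]_k.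
  by apply/funext => k; rewrite addnC.
by rewrite cvg_shiftn.
Qed.

Lemma geo_cvg (u : nat -> R) (C : R) :
  (forall n, `|u n.+1 - u n| <= C / 2 ^+ n) -> cvgn u.
Proof.
move=> hu; have -> : u = (fun n => u 0%N + series (telescope u) n).
  by apply/funext => n; rewrite -eq_sum_telescope.
apply: is_cvgD; first exact: is_cvg_cst.
apply: normed_cvg; apply: (@series_le_cvg _ _ (geometric C (2^-1))).
- by move=> n; rewrite normr_ge0.
- move=> n; rewrite /geometric /= exprVn.
  by apply: le_trans (hu n); rewrite normr_ge0.
- by move=> n /=; rewrite /telescope /geometric /= exprVn.
- by apply: is_cvg_geometric_series; rewrite ger0_norm ?invr_ge0 // invf_lt1 // ltr1n.
Qed.

(** The working form of analyticity. It is equivalent to a power series expansion, up to the radius,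
    but products, compositions and derivatives act directly on the polynomials, so no double series
    is ever rearranged. The fixed rate 1/2 costs nothing, since halving the radius produces it. *)
Definition apx f x (rho : R) P : Prop :=
  [/\ 0 < rho, exists C : R, forall n, N2 rho (P n.+1 - P n) <= C / 2 ^+ n
    & forall h, `|h| <= rho -> pev (P n) h @[n --> \oo] --> f (x + h)].

(** Absolute convergence on the closed ball, stated through bounded square partial sums. This form
    gives access to the coefficients, for the recurrence of the Beltrami equation and for
    uniqueness. *)
Definition ser f x (rho : R) (a : nat -> nat -> R) : Prop :=
  [/\ 0 < rho,
      exists M : R, forall n, \sum_(i < n) \sum_(j < n) `|a i j| * rho ^+ (i + j) <= M
    & forall h, `|h| <= rho ->
        (fun n => \sum_(i < n) \sum_(j < n) a i j * h 0 0 ^+ i * h 0 1 ^+ j)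
          @ \oo --> f (x + h)].

Lemma pev_bound rho p h : `|h| <= rho -> `|pev p h| <= N2 rho p.
Proof.
by move=> /rV2_norm_le [h0 h1]; exact: (ev_bound normr_seminorm (f := idfun)).
Qed.

Lemma pevB p q h : pev (p - q) h = pev p h - pev q h.
Proof. by rewrite /pev raddfB. Qed.

Lemma N2_termwise rho sigma K (p q : poly2 R) : 0 <= rho -> 0 <= sigma -> 0 <= K ->
  (forall i j, `|coef2 p i j| * rho ^+ (i + j) <= K * (`|coef2 q i j| * sigma ^+ (i + j))) ->
  N2 rho p <= K * N2 sigma q.
Proof.
move=> r0 s0 K0 pq; rewrite (N2E r0 (leqnn (deg2 p))).
apply: (@le_trans _ _ (K * \sum_(i < deg2 p) \sum_(j < deg2 p)
    `|coef2 q i j| * sigma ^+ (i + j))); last by rewrite ler_wpM2l // N2_square_le.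
rewrite mulr_sumr; apply: ler_sum => i _; rewrite mulr_sumr.
by apply: ler_sum => j _.
Qed.

Definition trunc (a : nat -> nat -> R) n : poly2 R := \poly_(i < n) \poly_(j < n) a i j.

Lemma coef2_trunc a n i j : coef2 (trunc a n) i j = if (i < n)%N && (j < n)%N then a i j else 0.
Proof.
by rewrite /coef2 coef_poly; case: ltnP => _ /=; rewrite ?coef0 // coef_poly.
Qed.

Lemma deg2_trunc a n : (deg2 (trunc a n) <= n)%N.
Proof.
rewrite geq_max size_poly /=; apply/bigmax_leqP => i _; rewrite coef_poly.
by case: ifP => _; rewrite ?size_poly ?size_poly0.
Qed.

Lemma N2_trunc rho a n : 0 <= rho ->
  N2 rho (trunc a n) = \sum_(i < n) \sum_(j < n) `|a i j| * rho ^+ (i + j).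
Proof.
move=> r0; rewrite (N2E r0 (deg2_trunc a n)).
by apply: eq_bigr => i _; apply: eq_bigr => j _; rewrite coef2_trunc !ltn_ord.
Qed.

Lemma pev_trunc a n h :
  pev (trunc a n) h = \sum_(i < n) \sum_(j < n) a i j * h 0 0 ^+ i * h 0 1 ^+ j.
Proof.
rewrite /pev (evE _ _ _ (deg2_trunc a n)).
by apply: eq_bigr => i _; apply: eq_bigr => j _; rewrite coef2_trunc !ltn_ord.
Qed.

(* Halving the radius turns plain boundedness into geometric decay. *)
Lemma trunc_rate rho (a : nat -> nat -> R) M : 0 < rho ->
  (forall n, \sum_(i < n) \sum_(j < n) `|a i j| * rho ^+ (i + j) <= M) ->
  forall n, N2 (rho / 2) (trunc a n.+1 - trunc a n) <= M / 2 ^+ n.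
Proof.
move=> r0 hM n; have r20 : 0 < rho / 2 by lra.
apply: (@le_trans _ _ ((2 ^+ n)^-1 * N2 rho (trunc a n.+1))); last first.
  rewrite mulrC ler_wpM2r ?invr_ge0 ?exprn_ge0 // N2_trunc ?(ltW r0) //; exact: hM.
apply: N2_termwise; rewrite ?invr_ge0 ?exprn_ge0 ?ltW // => i j.
rewrite coef2B !coef2_trunc.
case: (boolP ((i < n.+1)%N && (j < n.+1)%N)) => [/andP[hi hj]|h]; last first.
  case: (boolP ((i < n)%N && (j < n)%N)) => [/andP[hi hj]|_].
    by case/negP: h; rewrite !ltnS (ltnW hi) (ltnW hj).
  by rewrite subr0 normr0 !mul0r mulr0.
case: (boolP ((i < n)%N && (j < n)%N)) => [_|h].
  by rewrite subrr normr0 mul0r !mulr_ge0 ?invr_ge0 ?exprn_ge0 ?normr_ge0 // ltW.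
rewrite subr0 mulrCA ler_wpM2l // exprMn mulrC ler_wpM2r ?exprn_ge0 ?(ltW r0) //.
rewrite exprVn lef_pV2 ?posrE ?exprn_gt0 // ler_weXn2l ?ler1n //.
move: h; rewrite negb_and -!leqNgt => /orP[] h.
  by apply: leq_trans h _; rewrite leq_addr.
by apply: leq_trans h _; rewrite leq_addl.
Qed.

Lemma ser_apx f x rho a : ser f x rho a -> apx f x (rho / 2) (trunc a).
Proof.
move=> [r0 [M hM] hc]; have r20 : 0 < rho / 2 by lra.
split=> // [|h hr]; last first.
  rewrite (_ : (fun n => _) = (fun n => \sum_(i < n) \sum_(j < n) a i j * h 0 0 ^+ i * h 0 1 ^+ j)).
    by apply: hc; apply: le_trans hr _; lra.
  by apply/funext => n; rewrite pev_trunc.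
by exists M; exact: trunc_rate.
Qed.

(** This turns a Cauchy sequence of polynomials into an analytic function. Outside the ball the
    limit may be a default value, but only the ball matters. *)
Lemma apx_exists x rho P : 0 < rho ->
  (exists C : R, forall n, N2 rho (P n.+1 - P n) <= C / 2 ^+ n) ->
  apx (fun z => limn (fun n => pev (P n) (z - x))) x rho P.
Proof.
move=> r0 hP; split=> // h hr; rewrite addrC addKr.
have [C hC] := hP; apply: (@geo_cvg _ C) => n.
by rewrite -pevB; apply: le_trans (pev_bound _ hr) (hC n).
Qed.

Lemma apx_tail rho P (C : R) : 0 <= rho ->
  (forall n, N2 rho (P n.+1 - P n) <= C / 2 ^+ n) ->
  forall n k, N2 rho (P (n + k)%N - P n) <= 2 * C / 2 ^+ n.
Proof.
move=> r0 hC n k; have nP := N2_seminorm r0.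
have C0 : 0 <= C by have := hC 0%N; rewrite expr0 divr1; apply: le_trans (snorm_ge0 nP _).
have e0 m : 0 <= (2 ^+ m)^-1 :> R by rewrite invr_ge0 exprn_ge0.
(* Keeping the remaining geometric tail on the right makes the bound stable under induction on k. *)
suff : N2 rho (P (n + k)%N - P n) <= 2 * C / 2 ^+ n - 2 * C / 2 ^+ (n + k).
  by move=> h; apply: le_trans h _; rewrite gerBl !mulr_ge0.
elim: k => [|k IH]; first by rewrite addn0 !subrr (snorm0 nP).
have -> : P (n + k.+1)%N - P n = (P (n + k).+1 - P (n + k)%N) + (P (n + k)%N - P n).
  by rewrite addnS; ring.
apply: le_trans (snormD nP _ _) _; apply: le_trans (lerD (hC _) IH) _.
rewrite addnS exprS invfM; have := e0 (n + k)%N; have := e0 n.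
set a := (2 ^+ (n + k))^-1; set b := (2 ^+ n)^-1 => b0 a0.
have -> : 2 * C * b - 2 * C * (2^-1 * a) = C * a + (2 * C * b - 2 * C * a) by field.
exact: lexx.
Qed.

Lemma apx_bound rho P : 0 <= rho ->
  (exists C : R, forall n, N2 rho (P n.+1 - P n) <= C / 2 ^+ n) ->
  exists2 M : R, 0 < M & forall n, N2 rho (P n) <= M.
Proof.
move=> r0 [C hC]; have nP := N2_seminorm r0.
have C0 : 0 <= C by have := hC 0%N; rewrite expr0 divr1; apply: le_trans (snorm_ge0 nP _).
have q0 : 0 <= N2 rho (P 0%N) by exact: snorm_ge0 nP _.
exists (N2 rho (P 0%N) + 2 * C + 1) => [|n]; first by lra.
have := apx_tail r0 hC 0 n; rewrite expr0 divr1 add0n => h.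
rewrite -(subrK (P 0%N) (P n)); apply: le_trans (snormD nP _ _) _; lra.
Qed.

Lemma apx_coef f x rho P i j : apx f x rho P -> cvgn (fun n => coef2 (P n) i j).
Proof.
move=> [r0 [C hC] _]; apply: (@geo_cvg _ (C / rho ^+ (i + j))) => n.
rewrite -coef2B mulrAC ler_pdivlMr ?exprn_gt0 //.
by apply: le_trans (hC n); apply: coef2_le_N2; exact: ltW.
Qed.

(** Each coefficient of the approximants converges. Both the square partial sums, uniformly in their
    size m, and the values at h are within 2C/2^n of their limits, so a single polynomial [P n]
    connects the series with f. *)
Lemma apx_ser f x rho P : apx f x rho P ->
  ser f x rho (fun i j => limn (fun n => coef2 (P n) i j)).
Proof.
move=> fP; have [r0 hC hf] := fP; set a := fun i j => _.
have r0' := ltW r0.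
have aP i j : coef2 (P n) i j @[n --> \oo] --> a i j by exact: apx_coef fP.
have [M M0 hM] := apx_bound r0' hC; have [C hC'] := hC.
split=> //.
  exists M => n; apply: (@cvgn_le (fun m => \sum_(i < n) \sum_(j < n)
      `|coef2 (P m) i j| * rho ^+ (i + j))).
    apply: cvg_big => [|i _]; first exact: add_continuous.
    apply: cvg_big => [|j _]; first exact: add_continuous.
    by apply: cvgMr_tmp; apply: cvg_norm.
  by move=> m; apply: le_trans (N2_square_le _ _ r0') (hM m).
move=> h hr; have [h0 h1] := (rV2_norm_le h rho).1 hr.
pose S (b : nat -> nat -> R) m := \sum_(i < m) \sum_(j < m) b i j * h 0 0 ^+ i * h 0 1 ^+ j.
have nC := N2_seminorm r0'.
have C0 : 0 <= C by have := hC' 0%N; rewrite expr0 divr1; apply: le_trans (snorm_ge0 nC _).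
have S_le p m : `|S (coef2 p) m| <= N2 rho p.
  apply: le_trans (ler_norm_sum _ _ _) _; apply: le_trans (N2_square_le m p r0').
  apply: ler_sum => i _; apply: le_trans (ler_norm_sum _ _ _) _.
  apply: ler_sum => j _; rewrite -mulrA normrM ler_wpM2l // normrM exprD !normrX.
  by apply: ler_pM; rewrite ?exprn_ge0 // lerXn2r // nnegrE.
have SB p q m : S (coef2 p) m - S (coef2 q) m = S (coef2 (p - q)) m.
  rewrite /S -sumrB; apply: eq_bigr => i _; rewrite -sumrB; apply: eq_bigr => j _.
  by rewrite coef2B !mulrBl.
have S_tail n m : `|S a m - S (coef2 (P n)) m| <= 2 * C / 2 ^+ n.
  apply: (@cvgn_le (fun k => `|S (coef2 (P (n + k)%N)) m - S (coef2 (P n)) m|)).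
    apply: cvg_norm; apply: cvgB; last exact: cvg_cst.
    rewrite /S; apply: cvg_big => [|i _]; first exact: add_continuous.
    apply: cvg_big => [|j _]; first exact: add_continuous.
    do 2 apply: cvgMr_tmp; exact: (@cvgn_shift n (fun k => coef2 (P k) i j)).
  by move=> k; rewrite SB; apply: le_trans (S_le _ _) (apx_tail r0' hC' n k).
have f_tail n : `|pev (P n) h - f (x + h)| <= 2 * C / 2 ^+ n.
  rewrite distrC; apply: (@cvgn_le (fun k => `|pev (P (n + k)%N) h - pev (P n) h|)).
    apply: cvg_norm; apply: cvgB; last exact: cvg_cst.
    by apply: (@cvgn_shift n (fun k => pev (P k) h)); exact: hf.
  by move=> k; rewrite -pevB; apply: le_trans (pev_bound _ hr) (apx_tail r0' hC' n k).
apply/cvgrPdist_le => e e0.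
have [n hn] : exists n, 2 * C / 2 ^+ n <= e / 2.
  have : (2 * C) * (2^-1) ^+ n @[n --> \oo] --> (2 * C) * 0.
    apply: cvgMl_tmp; apply: cvg_expr.
    by rewrite ger0_norm ?invr_ge0 // invf_lt1 // ltr1n.
  rewrite mulr0 => /cvgrPdist_le /(_ (e / 2)) []; first by lra.
  move=> n _ /(_ n (leqnn n)) /=; rewrite sub0r normrN exprVn => hn; exists n.
  by apply: le_trans hn; exact: ler_norm.
(* From this size on, the square partial sum of [P n] is its full value, so the two tail estimates
   can be added. *)
exists (deg2 (P n)) => // m /= dm.
have := S_tail n m; have := f_tail n.
have -> : S (coef2 (P n)) m = pev (P n) h by rewrite /pev (evE _ _ _ dm).
rewrite -/(S a m) => f1 f2.
have -> : f (x + h) - S a m = - (pev (P n) h - f (x + h)) - (S a m - pev (P n) h) by ring.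
apply: le_trans (ler_normB _ _) _; rewrite normrN; lra.
Qed.

Lemma ser_analytic f x rho a : ser f x rho a -> analytic_at f x.
Proof.
move=> [r0 [M hM] hc]; exists a, rho; split=> // h hr.
split; last exact: hc (ltW hr).
have [h0 h1] := (rV2_norm_le h rho).1 (ltW hr).
rewrite /summable; apply: (@le_lt_trans _ _ M%:E); last exact: ltry.
apply: ge_ereal_sup => _ /= [X [finX _]] <-.
rewrite fsbig_finite //=; under eq_bigr do rewrite -?EFin_normr /=.
rewrite sumEFin lee_fin; set s := fset_set X.
(* A finite set of index pairs fits in a square of side n, and sums over squares are bounded by
   M. *)
pose n := (\max_(k <- finmap.enum_fset s) (maxn k.1 k.2)).+1.
have sn k : k \in finmap.enum_fset s -> (k.1 < n)%N && (k.2 < n)%N.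
  move=> ks; rewrite !ltnS -geq_max.
  exact: (@leq_bigmax_seq _ (finmap.enum_fset s) predT (fun k => maxn k.1 k.2)).
apply: le_trans (hM n); rewrite pair_bigA /=.
pose F (k : nat * nat) := `|a k.1 k.2| * rho ^+ (k.1 + k.2).
apply: (@le_trans _ _ (\sum_(k <- finmap.enum_fset s) F k)).
  apply: ler_sum => k _; rewrite /F -mulrA normrM ler_wpM2l // normrM exprD !normrX.
  by apply: ler_pM; rewrite ?exprn_ge0 // lerXn2r // nnegrE // ltW.
pose t : seq (nat * nat) := [seq (val i.1, val i.2) | i <- enum {: 'I_n * 'I_n}].
rewrite -big_enum /= -(big_map (fun i : 'I_n * 'I_n => (val i.1, val i.2)) predT F) -/t.
have ut : uniq t.
  by rewrite map_inj_uniq ?enum_uniq // => -[i j] [i' j'] /= [/val_inj -> /val_inj ->].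
have st : {subset finmap.enum_fset s <= t}.
  move=> [i j] /sn /= /andP[hi hj]; apply/mapP.
  by exists (Ordinal hi, Ordinal hj); rewrite ?mem_enum.
have us : uniq (finmap.enum_fset s) by exact: finmap.fset_uniq.
rewrite -(perm_big _ (_ : perm_eq (finmap.enum_fset s ++ [seq k <- t | k \notin finmap.enum_fset s]) t)) /=.
  rewrite big_cat /= lerDl; apply: sumr_ge0 => k _.
  by rewrite /F mulr_ge0 ?exprn_ge0 ?(ltW r0).
apply: uniq_perm => //.
  rewrite cat_uniq us filter_uniq // andbT /=; apply/hasPn => k.
  by rewrite mem_filter => /andP[].
move=> k; rewrite mem_cat mem_filter.
by case: (boolP (k \in finmap.enum_fset s)) => [/st ->|].
Qed.

Lemma analytic_ser f x : analytic_at f x -> exists rho a, ser f x rho a.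
Proof.
move=> [a [rho0 [r0 H]]]; have r20 : 0 < rho0 / 2 by lra.
exists (rho0 / 2), a; split=> //; last first.
  by move=> h hr; apply: (H h _).2; lra.
set r := rho0 / 2 in r20 *.
(* At the corner (r, r) every monomial attains its largest absolute value on the closed ball, so
   summability there bounds all the weighted partial sums. *)
pose h : 'rV[R]_2 := const_mx r.
have hr : `|h| < rho0.
  apply: (@le_lt_trans _ _ r); last by rewrite /r; lra.
  by apply/rV2_norm_le; rewrite !mxE ger0_norm ?(ltW r20).
have [sm _] := H h hr.
exists (fine (\esum_(k in [set: nat * nat]) `|(a k.1 k.2 * h 0 0 ^+ k.1 * h 0 1 ^+ k.2)%:E|)%E) => n.
rewrite -lee_fin fineK; last by rewrite -summableE.
apply: esum_ge.
exists [set k : nat * nat | (k.1 < n)%N && (k.2 < n)%N].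
  split=> //.
  apply: (@sub_finite_set _ _ (`I_n `*` `I_n)); last exact: finite_setX.
  by move=> k /= /andP[].
pose t : seq (nat * nat) := [seq (val i.1, val i.2) | i <- enum {: 'I_n * 'I_n}].
have ut : uniq t.
  by rewrite map_inj_uniq ?enum_uniq // => -[i j] [i' j'] /= [/val_inj -> /val_inj ->].
rewrite (fsbig_fwiden t) //=; last 2 first.
- move=> [i j] /= /andP[hi hj]; apply/mapP.
  by exists (Ordinal hi, Ordinal hj); rewrite ?mem_enum.
- move=> [i j]; rewrite /= => -[/mapP[[k l] _ [-> ->]]] /=.
  by rewrite !ltn_ord.
rewrite big_map big_enum /= sumEFin lee_fin pair_bigA /=.
apply: ler_sum => -[i j] _ /=; rewrite !mxE -mulrA -exprD normrM ler_wpM2l //.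
by rewrite ger0_norm // exprn_ge0 // ltW.
Qed.

Lemma analytic_apx f x : analytic_at f x -> exists rho P, apx f x rho P.
Proof.
move=> /analytic_ser [rho [a /ser_apx fP]]; by exists (rho / 2), (trunc a).
Qed.

Lemma apx_analytic f x rho P : apx f x rho P -> analytic_at f x.
Proof. by move=> /apx_ser; exact: ser_analytic. Qed.

End Approximation.

(** * Algebra, composition, derivatives and uniqueness for analytic functions *)

Section Operations.
Context {R : realType}.
Implicit Types (rho sigma C M : R) (f g : 'rV[R]_2 -> R) (x y h k : 'rV[R]_2).
Implicit Types (P Q : nat -> poly2 R) (p q : poly2 R).

Definition pt (a b : R) : 'rV[R]_2 := \row_i (if i == 0 then a else b).

Lemma pt0 a b : pt a b 0 0 = a. Proof. by rewrite mxE. Qed.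
Lemma pt1 a b : pt a b 0 1 = b. Proof. by rewrite mxE. Qed.

Lemma rV2P (y z : 'rV[R]_2) : y 0 0 = z 0 0 -> y 0 1 = z 0 1 -> y = z.
Proof.
move=> e0 e1; apply/rowP => i; case: i => -[|[|]] // hi.
  by move: e0; congr (y 0 _ = z 0 _); apply/val_inj.
by move: e1; congr (y 0 _ = z 0 _); apply/val_inj.
Qed.

Lemma ptE (y : 'rV[R]_2) : pt (y 0 0) (y 0 1) = y.
Proof. by apply: rV2P; rewrite ?pt0 ?pt1. Qed.

Lemma apx_le f x rho sigma P : apx f x rho P -> 0 < sigma <= rho -> apx f x sigma P.
Proof.
move=> [r0 [C hC] hf] /andP[s0 sr]; split=> // [|h hs].
  exists C => n; apply: le_trans (hC n).
  by apply: N2_le_radius => //; exact: ltW.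
by apply: hf; exact: le_trans hs sr.
Qed.

Lemma nbhs_shift_ball (A : set 'rV[R]_2) x : nbhs x A ->
  exists2 r : R, 0 < r & forall h, `|h| <= r -> A (x + h).
Proof.
move=> /nbhs_ballP[e /= e0 eA]; exists (e / 2); first by lra.
move=> h hr; apply: eA; rewrite -ball_normE /= opprD addrA subrr add0r normrN.
by apply: le_lt_trans hr _; lra.
Qed.

Lemma shift_ball_nbhs (A : set 'rV[R]_2) x (r : R) : 0 < r ->
  (forall h, `|h| <= r -> A (x + h)) -> nbhs x A.
Proof.
move=> r0 rA; apply/nbhs_ballP; exists r => //= y; rewrite -ball_normE /= distrC => yr.
by rewrite -(subrK x y) addrC; apply: rA; exact: ltW.
Qed.

Lemma apx_near f g x rho P : apx f x rho P -> (\forall y \near x, f y = g y) ->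
  exists2 sigma, 0 < sigma <= rho & apx g x sigma P.
Proof.
move=> fP /nbhs_shift_ball[r r0 fg]; have [rho0 _ _] := fP.
have m0 : 0 < Num.min r rho by rewrite lt_min r0 rho0.
have mr : Num.min r rho <= rho by rewrite ge_min lexx orbT.
exists (Num.min r rho); first by rewrite m0 mr.
have [_ hC hf] := apx_le fP (introT andP (conj m0 mr)).
split=> // h hm; rewrite -fg; first exact: hf.
by apply: le_trans hm _; rewrite ge_min lexx.
Qed.

Lemma analytic_near_eq f g x : (\forall y \near x, f y = g y) ->
  analytic_at f x -> analytic_at g x.
Proof.
move=> fg /analytic_apx[rho [P fP]].
by have [sigma _ /apx_analytic] := apx_near fP fg.
Qed.

Lemma analytic_eq f g x : f =1 g -> analytic_at f x -> analytic_at g x.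
Proof. by move=> /funext ->. Qed.

Lemma apx_stationary f x rho p : 0 < rho -> (forall h, `|h| <= rho -> pev p h = f (x + h)) ->
  apx f x rho (fun=> p).
Proof.
move=> r0 pf; split=> // [|h hr]; last by rewrite pf //; exact: cvg_cst.
by exists 0 => n; rewrite subrr mul0r (snorm0 (N2_seminorm (ltW r0))).
Qed.

Lemma apx_cst (c : R) x rho : 0 < rho -> apx (fun=> c) x rho (fun=> pC c).
Proof. by move=> r0; apply: apx_stationary => // h _; rewrite /pev ev_pC. Qed.

Lemma analytic_cst (c : R) x : analytic_at (fun=> c) x.
Proof. exact: apx_analytic (apx_cst c x (@ltr01 R)). Qed.

Lemma apx_coord0 x y rho : 0 < rho ->
  apx (fun z : 'rV[R]_2 => (z - y) 0 0) x rho (fun=> pX + pC ((x - y) 0 0)).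
Proof.
move=> r0; apply: apx_stationary => // h _.
by rewrite /pev raddfD /= ev_pX ev_pC /= !mxE; ring.
Qed.

Lemma apx_coord1 x y rho : 0 < rho ->
  apx (fun z : 'rV[R]_2 => (z - y) 0 1) x rho (fun=> pY + pC ((x - y) 0 1)).
Proof.
move=> r0; apply: apx_stationary => // h _.
by rewrite /pev raddfD /= ev_pY ev_pC /= !mxE; ring.
Qed.

Lemma analytic_coord (i : 'I_2) x : analytic_at (fun z : 'rV[R]_2 => z 0 i) x.
Proof.
have [->|->] : i = 0 \/ i = 1.
- by case: i => -[|[|]] // ?; [left|right]; apply/val_inj.
- apply: (@analytic_eq (fun z => (z - 0) 0 0)); first by move=> z; rewrite subr0.
  exact: apx_analytic (apx_coord0 x 0 (@ltr01 R)).
- apply: (@analytic_eq (fun z => (z - 0) 0 1)); first by move=> z; rewrite subr0.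
  exact: apx_analytic (apx_coord1 x 0 (@ltr01 R)).
Qed.

Lemma apxD f g x rho P Q : apx f x rho P -> apx g x rho Q ->
  apx (fun z => f z + g z) x rho (fun n => P n + Q n).
Proof.
move=> [r0 [C hC] hf] [_ [D hD] hg]; split=> // [|h hr].
  exists (C + D) => n; rewrite (_ : _ - _ = (P n.+1 - P n) + (Q n.+1 - Q n)); last by ring.
  by rewrite [leRHS]mulrDl; apply: le_trans (snormD (N2_seminorm (ltW r0)) _ _) (lerD _ _).
rewrite (_ : (fun n => _) = (fun n => pev (P n) h + pev (Q n) h)).
  by apply: cvgD; [exact: hf|exact: hg].
by apply/funext => n; rewrite /pev raddfD.
Qed.

Lemma apxM f g x rho P Q : apx f x rho P -> apx g x rho Q ->
  apx (fun z => f z * g z) x rho (fun n => P n * Q n).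
Proof.
move=> [r0 hP hf] [_ hQ hg]; have nP := N2_seminorm (ltW r0); split=> // [|h hr].
  have [M M0 hM] := apx_bound (ltW r0) hP; have [N N0 hN] := apx_bound (ltW r0) hQ.
  have [[C hC] [D hD]] := (hP, hQ); exists (C * N + M * D) => n.
  rewrite (_ : _ - _ = (P n.+1 - P n) * Q n.+1 + P n * (Q n.+1 - Q n)); last by ring.
  apply: le_trans (snormD nP _ _) _; rewrite [leRHS]mulrDl; apply: lerD.
    apply: le_trans (snormM nP _ _) _; rewrite mulrAC.
    by apply: ler_pM => //; exact: snorm_ge0 nP _.
  apply: le_trans (snormM nP _ _) _; rewrite -mulrA.
  by apply: ler_pM => //; exact: snorm_ge0 nP _.
rewrite (_ : (fun n => _) = (fun n => pev (P n) h * pev (Q n) h)).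
  by apply: cvgM; [exact: hf|exact: hg].
by apply/funext => n; rewrite /pev rmorphM.
Qed.

Lemma apx_common f g x rho sigma P Q : apx f x rho P -> apx g x sigma Q ->
  exists2 tau, 0 < tau & apx f x tau P /\ apx g x tau Q.
Proof.
move=> fP gQ; have [[r0 _ _] [s0 _ _]] := (fP, gQ).
have m0 : 0 < Num.min rho sigma by rewrite lt_min r0 s0.
exists (Num.min rho sigma) => //; split; [apply: apx_le fP _|apply: apx_le gQ _];
  by rewrite m0 ge_min lexx ?orbT.
Qed.

Lemma analyticD f g x : analytic_at f x -> analytic_at g x ->
  analytic_at (fun z => f z + g z) x.
Proof.
move=> /analytic_apx[rho [P fP]] /analytic_apx[sigma [Q gQ]].
have [tau t0 [fP' gQ']] := apx_common fP gQ.
exact: apx_analytic (apxD fP' gQ').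
Qed.

Lemma analyticM f g x : analytic_at f x -> analytic_at g x ->
  analytic_at (fun z => f z * g z) x.
Proof.
move=> /analytic_apx[rho [P fP]] /analytic_apx[sigma [Q gQ]].
have [tau t0 [fP' gQ']] := apx_common fP gQ.
exact: apx_analytic (apxM fP' gQ').
Qed.

Lemma analyticN f x : analytic_at f x -> analytic_at (fun z => - f z) x.
Proof.
move=> fx; apply: (@analytic_eq (fun z => -1 * f z)).
  by move=> z; rewrite mulN1r.
exact: analyticM (analytic_cst _ _) fx.
Qed.

Lemma analyticB f g x : analytic_at f x -> analytic_at g x ->
  analytic_at (fun z => f z - g z) x.
Proof. by move=> fx gx; apply: analyticD fx (analyticN gx). Qed.

Lemma analytic_sum n (F : 'I_n -> 'rV[R]_2 -> R) x :
  (forall i, analytic_at (F i) x) -> analytic_at (fun z => \sum_(i < n) F i z) x.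
Proof.
elim: n F => [|n IH] F hF.
  apply: (@analytic_eq (fun=> 0)); last exact: analytic_cst.
  by move=> z; rewrite big_ord0.
apply: (@analytic_eq (fun z => \sum_(i < n) F (widen_ord (leqnSn n) i) z + F ord_max z)).
  by move=> z; rewrite big_ord_recr.
by apply: analyticD => //; exact: IH.
Qed.

Lemma pev_lipschitz rho h k p : `|h| <= rho -> `|k| <= rho ->
  `|pev p h - pev p k| * rho
    <= N2 (2 * rho) p * (`|h 0 0 - k 0 0| + `|h 0 1 - k 0 1|).
Proof.
move=> /rV2_norm_le[h0 h1] /rV2_norm_le[k0 k1].
exact: (ev_lipschitz normr_seminorm (f := idfun)).
Qed.

(** An increment of the substituted polynomials splits into a change of P at fixed arguments and a
    change of the arguments in a fixed P. The second part uses [ev_lipschitz], which is why F must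
    be approximated on twice the radius that the inner functions can reach. *)
Lemma apx_comp F y rho P g1 g2 x sigma Q1 Q2 :
  apx F y (2 * rho) P -> apx g1 x sigma Q1 -> apx g2 x sigma Q2 ->
  (forall n, N2 sigma (Q1 n) <= rho) -> (forall n, N2 sigma (Q2 n) <= rho) ->
  apx (fun z => F (y + pt (g1 z) (g2 z))) x sigma (fun n => psub (Q1 n) (Q2 n) (P n)).
Proof.
move=> FP g1Q g2Q b1 b2.
have [r2 hP hF] := FP; have [s0 [C1 hC1] hg1] := g1Q; have [_ [C2 hC2] hg2] := g2Q.
have r0 : 0 < rho by move: r2; rewrite pmulr_rgt0.
have nS := N2_seminorm (ltW s0).
have [M M0 hM] := apx_bound (ltW r2) hP; have [C hC] := hP.
split=> // [|h hs].
  exists (C + M / rho * (C1 + C2)) => n.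
  have -> : psub (Q1 n.+1) (Q2 n.+1) (P n.+1) - psub (Q1 n) (Q2 n) (P n)
    = psub (Q1 n.+1) (Q2 n.+1) (P n.+1 - P n)
      + (psub (Q1 n.+1) (Q2 n.+1) (P n) - psub (Q1 n) (Q2 n) (P n)).
    by rewrite psubB addrA subrK.
  apply: le_trans (snormD nS _ _) _; rewrite [leRHS]mulrDl; apply: lerD.
    apply: le_trans (hC n); apply: (@le_trans _ _ (N2 rho (P n.+1 - P n))).
      by apply: (ev_bound nS) => //; exact: pC_bound (ltW s0).
    by apply: N2_le_radius; [exact: ltW|exact: ler_double (ltW r0)].
  rewrite -(ler_pM2r r0).
  apply: le_trans (ev_lipschitz nS (pC_bound (ltW s0)) _ (b1 _) (b2 _) (b1 _) (b2 _)) _.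
  have -> : M / rho * (C1 + C2) / 2 ^+ n * rho = M * (C1 / 2 ^+ n + C2 / 2 ^+ n).
    by field; rewrite expf_neq0 ?pnatr_eq0 //= gt_eqF.
  apply: ler_pM => //; first exact: snorm_ge0 (N2_seminorm (ltW r2)) _.
    by rewrite addr_ge0 // (snorm_ge0 nS).
  exact: lerD.
pose k n := pt (pev (Q1 n) h) (pev (Q2 n) h); pose l := pt (g1 (x + h)) (g2 (x + h)).
have kE n : pev (psub (Q1 n) (Q2 n) (P n)) h = pev (P n) (k n).
  by rewrite pev_psub /k [in RHS]/pev pt0 pt1.
have kr n : `|k n| <= rho.
  by apply/rV2_norm_le; rewrite pt0 pt1; split;
    [apply: le_trans (b1 n)|apply: le_trans (b2 n)]; exact: pev_bound.
have lr : `|l| <= rho.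
  apply/rV2_norm_le; rewrite pt0 pt1; split.
    by apply: (@cvgn_le _ (fun n => `|pev (Q1 n) h|)) => [|n];
      [apply: cvg_norm; exact: hg1|apply: le_trans (b1 n); exact: pev_bound].
  by apply: (@cvgn_le _ (fun n => `|pev (Q2 n) h|)) => [|n];
    [apply: cvg_norm; exact: hg2|apply: le_trans (b2 n); exact: pev_bound].
have -> : (fun n => pev (psub (Q1 n) (Q2 n) (P n)) h)
        = (fun n => pev (P n) l + (pev (P n) (k n) - pev (P n) l)).
  by apply/funext => n; rewrite kE; ring.
rewrite -[X in _ --> X]addr0; apply: cvgD.
  by apply: hF; apply: le_trans lr (ler_double (ltW r0)).
apply/norm_cvg0P; apply: (@squeeze_cvgr _ _ _ _ (fun=> 0)
  (fun n => M / rho * (`|pev (Q1 n) h - g1 (x + h)| + `|pev (Q2 n) h - g2 (x + h)|))).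
- apply: nearW => n; rewrite normr_ge0 /= mulrAC ler_pdivlMr //.
  apply: le_trans (pev_lipschitz _ (kr n) lr) _; rewrite /k /l !pt0 !pt1.
  by rewrite ler_wpM2r // addr_ge0.
- exact: cvg_cst.
- rewrite -[X in _ --> X](mulr0 (M / rho)); apply: cvgMl_tmp.
  rewrite -(addr0 0); apply: cvgD; apply/norm_cvg0P; apply/subr_cvg0.
    exact: hg1.
  exact: hg2.
Qed.

Lemma pev0 p : pev p 0 = coef2 p 0 0.
Proof.
have d1 : (0 < (deg2 p).+1)%N by [].
rewrite /pev (evE _ _ _ (leqnSn (deg2 p))) !mxE big_ord_recl big_ord_recl /=.
rewrite !expr0 !mulr1 big1 ?addr0 => [|i _]; last by rewrite /= expr0n mulr0.
by rewrite big1 ?addr0 // => i _; apply: big1 => j _; rewrite /= expr0n mulr0 mul0r.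
Qed.

Lemma apx_value f x rho P : apx f x rho P -> coef2 (P n) 0 0 @[n --> \oo] --> f x.
Proof.
move=> [r0 _ hf]; rewrite (_ : (fun n => _) = (fun n => pev (P n) 0)).
  by rewrite -[x in f x]addr0; apply: hf; rewrite normr0 ltW.
by apply/funext => n; rewrite pev0.
Qed.

(** Supplies the size bounds required by [apx_comp]. Without constant terms every monomial gains at
    least one factor sigma/rho, so sigma is chosen with sigma/rho times M at most eps. *)
Lemma apx_small f x rho P (eps : R) : apx f x rho P -> 0 < eps ->
  exists sigma Q, [/\ sigma <= rho, apx (fun z => f z - f x) x sigma Q &
    forall n, N2 sigma (Q n) <= eps].
Proof.
move=> fP e0; have [r0 hP hf] := fP; have [M M0 hM] := apx_bound (ltW r0) hP.
pose Q n := P n - pC (coef2 (P n) 0 0).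
have QE n i j : coef2 (Q n) i j = if (i + j == 0)%N then 0 else coef2 (P n) i j.
  by rewrite /Q coef2B coef2C; case: i => [|i]; case: j => [|j];
    rewrite /= ?mulr1n ?mulr0n ?mul0rn ?subrr ?subr0.
pose sigma := Num.min rho (rho * eps / M).
have s0 : 0 < sigma by rewrite lt_min r0 /= divr_gt0 ?mulr_gt0.
have sr : sigma <= rho by rewrite ge_min lexx.
exists sigma, Q; split=> //; last first.
  move=> n; apply: (@le_trans _ _ (sigma / rho * N2 rho (P n))).
    apply: N2_termwise; rewrite ?(ltW s0) ?(ltW r0) ?divr_ge0 ?(ltW s0) ?(ltW r0) // => i j.
    rewrite QE; case: ifPn => [_|ij].
      by rewrite normr0 mul0r !mulr_ge0 ?invr_ge0 ?exprn_ge0 ?normr_ge0 ?(ltW s0) ?(ltW r0).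
    rewrite mulrCA ler_wpM2l //; case: (i + j)%N ij => // m _.
    rewrite !exprS mulrA divfK ?gt_eqF // ler_wpM2l ?(ltW s0) //.
    by rewrite lerXn2r // nnegrE ltW.
  apply: (@le_trans _ _ (sigma / rho * M)).
    by rewrite ler_wpM2l // divr_ge0 // ltW.
  by rewrite mulrAC ler_pdivrMr // -ler_pdivlMr // (mulrC eps) ge_min lexx orbT.
split=> // [|h hs].
  have [C hC] := hP; exists C => n; apply: le_trans (hC n).
  apply: le_trans (_ : N2 rho (Q n.+1 - Q n) <= _).
    by apply: N2_le_radius => //; exact: ltW.
  apply: N2_dominated; first exact: ltW.
  by move=> i j; rewrite [coef2 (Q n.+1 - Q n) i j]coef2B !QE [coef2 (P n.+1 - P n) i j]coef2B; case: ifP => _;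
    [rewrite subrr normr0|exact: lexx].
rewrite (_ : (fun n => _) = (fun n => pev (P n) h - coef2 (P n) 0 0)).
  by apply: cvgB; [apply: hf; exact: le_trans hs sr|exact: apx_value fP].
by apply/funext => n; rewrite /Q pevB [pev (pC _) _]/pev ev_pC.
Qed.

Lemma analytic_comp F g1 g2 x : analytic_at F (pt (g1 x) (g2 x)) ->
  analytic_at g1 x -> analytic_at g2 x -> analytic_at (fun z => F (pt (g1 z) (g2 z))) x.
Proof.
move=> /analytic_apx[rho [P FP]] /analytic_apx[s1 [Q1 g1Q]] /analytic_apx[s2 [Q2 g2Q]].
have [r0 _ _] := FP; have r20 : 0 < rho / 2 by lra.
have [t1 [Q1' [_ g1Q' b1]]] := apx_small g1Q r20.
have [t2 [Q2' [_ g2Q' b2]]] := apx_small g2Q r20.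
have [tau t0 [h1 h2]] := apx_common g1Q' g2Q'.
have FP' : apx F (pt (g1 x) (g2 x)) (2 * (rho / 2)) P by rewrite mulrC divfK ?pnatr_eq0.
pose m := Num.min tau (Num.min t1 t2).
have [[t10 _ _] [t20 _ _]] := (g1Q', g2Q').
have m0 : 0 < m by rewrite !lt_min t0 t10 t20.
have mt : 0 < m <= tau by rewrite m0 ge_min lexx.
apply: (@analytic_eq (fun z => F (pt (g1 x) (g2 x) + pt (g1 z - g1 x) (g2 z - g2 x)))).
  move=> z; congr (F _); apply: rV2P; rewrite mxE ?pt0 ?pt1; ring.
apply: apx_analytic (apx_comp FP' (apx_le h1 mt) (apx_le h2 mt) _ _) => n.
  by apply: le_trans (b1 n); apply: N2_le_radius; rewrite ?(ltW m0) // !ge_min lexx ?orbT.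
by apply: le_trans (b2 n); apply: N2_le_radius; rewrite ?(ltW m0) // !ge_min lexx ?orbT.
Qed.

Lemma analytic_vcomp F (G : 'rV[R]_2 -> 'rV[R]_2) x :
  analytic_at F (G x) -> vanalytic_at G x -> analytic_at (F \o G) x.
Proof.
move=> Fx Gx; apply: (@analytic_eq (fun z => F (pt (G z 0 0) (G z 0 1)))).
  by move=> z /=; rewrite ptE.
by apply: analytic_comp; rewrite ?ptE //; exact: Gx.
Qed.

Definition shift2 (k : 'rV[R]_2) p : poly2 R := psub (pX + pC (k 0 0)) (pY + pC (k 0 1)) p.

(** Recentring is composition with a translation. A shift and a new radius of rho/4 each keep the
    arguments within rho/2, half of the radius on which f is approximated. *)
Lemma apx_recentre f x rho P k : apx f x rho P -> `|k| <= rho / 4 ->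
  apx f (x + k) (rho / 4) (fun n => shift2 k (P n)).
Proof.
move=> fP kr; have [r0 _ _] := fP; have r40 : 0 < rho / 4 by lra.
have fP' : apx f x (2 * (rho / 2)) P by rewrite mulrC divfK ?pnatr_eq0.
have xk : x + k - x = k by rewrite addrC addKr.
have c0 := apx_coord0 (x + k) x r40; have c1 := apx_coord1 (x + k) x r40.
rewrite xk in c0 c1; have nS := N2_seminorm (ltW r40).
have [k0 k1] := (rV2_norm_le k _).1 kr.
have b0 : N2 (rho / 4) (pX + pC (k 0 0)) <= rho / 2.
  apply: le_trans (snormD nS _ _) _; rewrite N2_pC ?(ltW r40) //.
  have := N2_pX (ltW r40); lra.
have b1 : N2 (rho / 4) (pY + pC (k 0 1)) <= rho / 2.
  apply: le_trans (snormD nS _ _) _; rewrite N2_pC ?(ltW r40) //.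
  have := N2_pY (ltW r40); lra.
have [_ hC hf] := apx_comp fP' c0 c1 (fun=> b0) (fun=> b1).
split=> // h hr; have := hf h hr.
rewrite (_ : x + pt _ _ = x + k + h) //.
by apply: rV2P; rewrite !mxE /=; ring.
Qed.

Lemma analytic_at_near f x : analytic_at f x -> \forall y \near x, analytic_at f y.
Proof.
move=> /analytic_apx[rho [P fP]]; have [r0 _ _] := fP.
apply: (@shift_ball_nbhs _ _ (rho / 4)); first by lra.
by move=> k kr; exact: apx_analytic (apx_recentre fP kr).
Qed.

(** The geometric series of 1/(c + h); at radius |c|/2 its ratio is exactly the rate 1/2 demanded by
    [apx]. *)
Lemma analytic_inv_coord (c : R) y : c != 0 -> y 0 0 = c ->
  analytic_at (fun z => (z 0 0)^-1) y.
Proof.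
move=> c0 yc; pose rho := `|c| / 2.
have nc : 0 < `|c| by rewrite normr_gt0.
have r0 : 0 < rho by rewrite /rho; lra.
have nP := N2_seminorm (ltW r0).
pose P n := \sum_(k < n) pC ((-1) ^+ k / c ^+ k.+1) * pX ^+ k : poly2 R.
apply: (@apx_analytic _ _ _ rho P); split=> // [|h hr].
  exists `|c|^-1 => n; rewrite (_ : P n.+1 - P n = pC ((-1) ^+ n / c ^+ n.+1) * pX ^+ n); last first.
    by rewrite /P big_ord_recr /= addrAC subrr add0r.
  apply: le_trans (snormM nP _ _) _; rewrite N2_pC ?(ltW r0) //.
  rewrite normrM normrX normrN1 expr1n mul1r normfV normrX exprS invfM -mulrA.
  rewrite ler_wpM2l ?invr_ge0 //.
  apply: (@le_trans _ _ ((`|c| ^+ n)^-1 * rho ^+ n)).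
    rewrite ler_wpM2l ?invr_ge0 ?exprn_ge0 //; apply: le_trans (snormX nP _ _) _.
    by rewrite lerXn2r ?nnegrE ?(snorm_ge0 nP) ?(ltW r0) // N2_pX // ltW.
  by rewrite /rho exprMn mulrA mulVf ?expf_neq0 ?gt_eqF // mul1r exprVn.
have [h0 _] := (rV2_norm_le h rho).1 hr.
have hc : c + h 0 0 != 0.
  apply/eqP => e; have e' : h 0 0 = - c by lra.
  by move: h0; rewrite e' normrN /rho; lra.
pose q := - h 0 0 / c.
have q1 : `|q| < 1.
  rewrite /q normrM normrN normfV ltr_pdivrMr // mul1r; apply: le_lt_trans h0 _.
  by rewrite /rho; lra.
rewrite (_ : (fun n => _) = (fun n => (c + h 0 0)^-1 * (1 - q ^+ n))).
  rewrite mxE yc -[X in _ --> X]mulr1; apply: cvgMl_tmp.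
  rewrite -[X in _ --> X]subr0; apply: cvgB; first exact: cvg_cst.
  exact: cvg_expr.
apply/funext => n; rewrite /pev /P raddf_sum /=.
apply: (mulfI hc); rewrite mulrA mulfV // mul1r.
elim: n => [|n IH]; first by rewrite big_ord0 expr0 mulr0 subrr.
rewrite big_ord_recr /= mulrDr IH rmorphM rmorphXn /= ev_pX ev_pC /= /q.
rewrite [(- h 0 0 / c) ^+ n.+1]exprS (exprS c).
have -> : (- h 0 0 / c) ^+ n = (-1) ^+ n * h 0 0 ^+ n / c ^+ n.
  by rewrite exprMn exprVn -[- h 0 0]mulN1r exprMn.
by field; rewrite expf_neq0 // c0.
Qed.

Lemma analyticV f x : f x != 0 -> analytic_at f x -> analytic_at (fun z => (f z)^-1) x.
Proof.
move=> fx0 fx; apply: (@analytic_eq (fun z => (fun w : 'rV[R]_2 => (w 0 0)^-1) (pt (f z) 0))).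
  by move=> z; rewrite pt0.
apply: (@analytic_comp (fun w => (w 0 0)^-1) f (fun=> 0)) => //.
  by apply: (analytic_inv_coord fx0); rewrite pt0.
exact: analytic_cst.
Qed.

(** The remainder of [P n] at h is the value of [hi (P n)]. Taking its norm at radius |h| and
    comparing with radius rho gives a factor |h|^2 with a constant independent of n. *)
Lemma apx_taylor1 f x rho P : apx f x rho P -> exists2 K : R, 0 <= K &
  forall h, `|h| <= rho ->
    `|f (x + h) - (f x + (limn (fun n => coef2 (P n) 1 0) * h 0 0
                          + limn (fun n => coef2 (P n) 0 1) * h 0 1))| <= K * `|h| ^+ 2.
Proof.
move=> fP; have [r0 hP hf] := fP; have [M M0 hM] := apx_bound (ltW r0) hP.
exists (M / rho ^+ 2); first by rewrite divr_ge0 ?exprn_ge0 ?ltW.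
move=> h hr; apply: (@cvgn_le _ (fun n => `|pev (P n) h - (coef2 (P n) 0 0
    + (coef2 (P n) 1 0 * h 0 0 + coef2 (P n) 0 1 * h 0 1))|)).
  apply: cvg_norm; apply: cvgB; first exact: hf.
  apply: cvgD; first exact: apx_value fP.
  by apply: cvgD; apply: cvgMr_tmp; exact: apx_coef fP.
move=> n; rewrite (_ : _ - _ = pev (hi (P n)) h); last first.
  by rewrite /hi pevB /pev !raddfD /= !rmorphM /= ev_pX ev_pY !ev_pC /=; ring.
apply: le_trans (pev_bound _ (lexx _)) _.
rewrite mulrAC ler_pdivlMr ?exprn_gt0 //.
apply: le_trans (N2_hi_scale _ (normr_ge0 _) hr) _.
by rewrite mulrC ler_wpM2r ?exprn_ge0.
Qed.

Lemma diff_of_bound (V W : normedModType R) (f : V -> W) (df : {linear V -> W}) (x : V) :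
  continuous df ->
  (forall e : R, 0 < e -> \forall h \near 0, `|f (x + h) - (f x + df h)| <= e * `|h|) ->
  differentiable f x /\ forall v, 'd f x v = df v.
Proof.
move=> dfc H; have E : f \o shift x = cst (f x) + df +o_ 0 id.
  apply/eqaddoP => e e0; have := H e e0; apply: filterS => h.
  by rewrite -![(_ + _ : _ -> _) _]/(_ + _) /= (addrC h x).
have D : 'd f x = df :> (_ -> _) by rewrite (diff_unique dfc E).
split; last by move=> v; rewrite D.
by apply/diff_locallyP; rewrite D.
Qed.

Definition linform (a b : R) (h : 'rV[R]_2) : R := a * h 0 0 + b * h 0 1.

Lemma linform_is_linear a b : linear (linform a b).
Proof. by move=> k u v; rewrite /linform !mxE /GRing.scale /=; ring. Qed.
HB.instance Definition _ a b :=
  GRing.isLinear.Build R 'rV[R]_2 R *:%R (linform a b) (linform_is_linear a b).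

Lemma linform_continuous a b : continuous (linform a b).
Proof.
move=> h; apply: (@continuousD _ _ _ (fun h => a * h 0 0) (fun h => b * h 0 1));
  by apply: continuousM; [exact: cst_continuous|exact: coord_continuous].
Qed.

Lemma apx_diff f x rho P : apx f x rho P ->
  differentiable f x /\
  forall v, 'd f x v = limn (fun n => coef2 (P n) 1 0) * v 0 0
                      + limn (fun n => coef2 (P n) 0 1) * v 0 1.
Proof.
move=> fP; have [r0 _ _] := fP; have [K K0 hK] := apx_taylor1 fP.
set a := limn _ in hK *; set b := limn _ in hK *.
apply: (@diff_of_bound _ _ _ (linform a b)) => [|e e0]; first exact: linform_continuous.
apply: (@shift_ball_nbhs _ 0 (Num.min rho (e / (K + 1)))).
  by rewrite lt_min r0 divr_gt0 //; lra.
move=> h; rewrite le_min add0r => /andP[hr he] /=.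
apply: le_trans (hK h hr) _.
rewrite expr2 mulrA ler_wpM2r //; apply: (@le_trans _ _ (K * (e / (K + 1)))).
  by rewrite ler_wpM2l.
by rewrite mulrCA ger_pMr // ler_pdivrMr; lra.
Qed.

Lemma analytic_differentiable f x : analytic_at f x -> differentiable f x.
Proof. by move=> /analytic_apx[rho [P /apx_diff[]]]. Qed.

Lemma analytic_continuous f x : analytic_at f x -> {for x, continuous f}.
Proof. by move=> /analytic_differentiable; exact: differentiable_continuous. Qed.

Lemma vanalytic_differentiable m (F : 'rV[R]_2 -> 'rV[R]_m) x :
  vanalytic_at F x -> differentiable F x.
Proof.
move=> Fx; have -> : F = \sum_(k < m) (fun z => F z 0 k *: (delta_mx 0 k : 'rV[R]_m)).
  apply/funext => z; rewrite fct_sumE {1}(row_sum_delta (F z)).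
  by [].
apply: differentiable_sum => k; apply: differentiableZl.
exact: analytic_differentiable (Fx k).
Qed.

Lemma vanalytic_continuous m (F : 'rV[R]_2 -> 'rV[R]_m) x :
  vanalytic_at F x -> {for x, continuous F}.
Proof. by move=> /vanalytic_differentiable; exact: differentiable_continuous. Qed.

Lemma dYM p q : dY (p * q) = dY p * q + p * dY q.
Proof.
apply: poly2P => i j; rewrite coef2D /coef2 /dY coef_map_id0 ?deriv0 //.
rewrite !coefM raddf_sum !coef_sum -big_split /=; apply: eq_bigr => k _.
by rewrite derivM coefD !coef_map_id0 ?deriv0.
Qed.

(* Two derivations over the same point agree as soon as they agree on the generators. *)
Lemma derivation_ext (D E : poly2 R -> R) (k : 'rV[R]_2) :
  (forall p q, D (p + q) = D p + D q) -> (forall p q, E (p + q) = E p + E q) ->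
  (forall p q, D (p * q) = D p * pev q k + pev p k * D q) ->
  (forall p q, E (p * q) = E p * pev q k + pev p k * E q) ->
  (forall c, D (pC c) = E (pC c)) -> D pX = E pX -> D pY = E pY -> D =1 E.
Proof.
move=> DD ED DM EM eC eX eY; elim/poly_ind => [|p c IH].
  by have := eC 0; rewrite /pC !polyC0.
rewrite DD ED DM EM IH eX; congr (_ + _).
elim/poly_ind: c => [|c a IHc]; first by have := eC 0; rewrite /pC !polyC0.
by rewrite polyCD polyCM DD ED DM EM IHc eY (eC a).
Qed.

Lemma coef2M_10 p q :
  coef2 (p * q) 1 0 = coef2 p 1 0 * coef2 q 0 0 + coef2 p 0 0 * coef2 q 1 0.
Proof. by rewrite coef2M !(big_ord_recl, big_ord0) /= !addr0 addrC. Qed.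
Lemma coef2M_01 p q :
  coef2 (p * q) 0 1 = coef2 p 0 1 * coef2 q 0 0 + coef2 p 0 0 * coef2 q 0 1.
Proof. by rewrite coef2M !(big_ord_recl, big_ord0) /= !addr0 addrC. Qed.

Lemma coef2_shift2_00 k p : coef2 (shift2 k p) 0 0 = pev p k.
Proof.
by rewrite -pev0 /shift2 pev_psub /pev !raddfD /= !ev_pX !ev_pY !ev_pC !mxE !add0r.
Qed.

Lemma shift2D k p q : shift2 k (p + q) = shift2 k p + shift2 k q.
Proof. exact: raddfD. Qed.
Lemma shift2M k p q : shift2 k (p * q) = shift2 k p * shift2 k q.
Proof. exact: rmorphM. Qed.

Lemma coef2X i j : coef2 pX i j = ((i == 1%N) && (j == 0%N))%:R :> R.
Proof. by rewrite /coef2 /pX coefX; case: (i == 1%N); rewrite ?coef0 // coef1. Qed.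
Lemma coef2Y i j : coef2 pY i j = ((i == 0%N) && (j == 1%N))%:R :> R.
Proof. by rewrite /coef2 /pY coefC; case: (i == 0%N); rewrite ?coef0 // coefX. Qed.

(** Both sides are derivations over evaluation at k, so checking constants and the two
    indeterminates is enough. *)
Lemma coef2_shift2_10 k p : coef2 (shift2 k p) 1 0 = pev (dX p) k.
Proof.
apply: (@derivation_ext (fun p => coef2 (shift2 k p) 1 0) (fun p => pev (dX p) k) k)
  => [u v|u v|u v|u v|c||].
- by rewrite shift2D coef2D.
- by rewrite /dX derivD /pev raddfD.
- by rewrite shift2M coef2M_10 !coef2_shift2_00.
- by rewrite /dX derivM /pev raddfD /= !rmorphM.
- by rewrite /shift2 /psub ev_pC coef2C /= mulr0n /dX derivC /pev raddf0.
- by rewrite /shift2 /psub ev_pX /dX derivX coef2D coef2X coef2C /= ?mulr0n ?mulr1n addr0 /pev rmorph1.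
- by rewrite /shift2 /psub ev_pY /dX derivC coef2D coef2Y coef2C /= ?mulr0n ?mulr1n addr0 /pev raddf0.
Qed.

Lemma coef2_shift2_01 k p : coef2 (shift2 k p) 0 1 = pev (dY p) k.
Proof.
apply: (@derivation_ext (fun p => coef2 (shift2 k p) 0 1) (fun p => pev (dY p) k) k)
  => [u v|u v|u v|u v|c||].
- by rewrite shift2D coef2D.
- by rewrite dYD /pev raddfD.
- by rewrite shift2M coef2M_01 !coef2_shift2_00.
- by rewrite dYM /pev raddfD /= !rmorphM.
- by rewrite /shift2 /psub ev_pC coef2C /= ?mulr0n /dY map_polyC /= derivC polyC0 /pev raddf0.
- rewrite /shift2 /psub ev_pX /dY coef2D coef2X coef2C /= ?mulr0n ?mulr1n addr0.
  rewrite (_ : map_poly _ _ = 0) ?/pev ?raddf0 //; apply: poly2P => i j.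
  by rewrite -/(dY pX) coef2_dY coef2X /= andbF mul0rn /coef2 !coef0.
- by rewrite /shift2 /psub ev_pY /dY map_polyC /= derivX coef2D coef2Y coef2C /= ?mulr0n ?mulr1n addr0 /pev rmorph1.
Qed.

Definition pd (i : 'I_2) f (z : 'rV[R]_2) : R := 'D_(delta_mx 0 i) f z.
Definition dXY (i : 'I_2) p : poly2 R := if i == 0 then dX p else dY p.

Lemma ord2_cases (i : 'I_2) : i = 0 \/ i = 1.
Proof. by case: i => -[|[|]] // ?; [left|right]; apply/val_inj. Qed.

Lemma pd_diff i f x : differentiable f x -> pd i f x = 'd f x (delta_mx 0 i).
Proof. exact: deriveE. Qed.

Lemma coef2_shift2_dXY i k p :
  coef2 (shift2 k p) 1 0 * (i == 0)%:R + coef2 (shift2 k p) 0 1 * (i == 1)%:R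
    = pev (dXY i p) k.
Proof.
rewrite coef2_shift2_10 coef2_shift2_01 /dXY.
by case: (ord2_cases i) => -> /=; rewrite mulr1 mulr0 ?addr0 ?add0r.
Qed.

Lemma dXYB i p q : dXY i (p - q) = dXY i p - dXY i q.
Proof. by rewrite /dXY; case: ifP => _; rewrite ?dXB ?dYB. Qed.

Lemma N2_dXY i rho p : 0 <= rho -> N2 rho (dXY i p) * rho <= N2 (2 * rho) p.
Proof. by move=> r0; rewrite /dXY; case: ifP => _; rewrite ?N2_dX ?N2_dY. Qed.

(** The derivative at x + k is the linear coefficient of the approximants recentred at k, and this
    coefficient is the value at k of the differentiated polynomial. Hence termwise differentiation
    converges to the true derivative. *)
Lemma apx_pd i f x rho P : apx f x rho P ->
  apx (pd i f) x (rho / 8) (fun n => dXY i (P n)).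
Proof.
move=> fP; have [r0 [C hC] _] := fP; have r80 : 0 < rho / 8 by lra.
split=> // [|k kr].
  exists (C / (rho / 8)) => n; rewrite -dXYB mulrAC ler_pdivlMr //.
  apply: le_trans (N2_dXY _ _ (ltW r80)) _; apply: le_trans (hC n).
  by apply: N2_le_radius; lra.
have kr4 : `|k| <= rho / 4 by apply: le_trans kr _; lra.
have rP := apx_recentre fP kr4; have [df dE] := apx_diff rP.
rewrite (pd_diff _ df) dE !mxE eqxx /= (eq_sym 0) (eq_sym 1).
have -> : (fun n => pev (dXY i (P n)) k) = (fun n =>
   coef2 (shift2 k (P n)) 1 0 * (i == 0)%:R + coef2 (shift2 k (P n)) 0 1 * (i == 1)%:R).
  by apply/funext => n; rewrite coef2_shift2_dXY.
by apply: cvgD; apply: cvgMr_tmp; exact: apx_coef rP.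
Qed.

Lemma analytic_pd i f x : analytic_at f x -> analytic_at (pd i f) x.
Proof. by move=> /analytic_apx[rho [P fP]]; exact: apx_analytic (apx_pd i fP). Qed.

Lemma apx_pd_value i f x rho P : apx f x rho P ->
  coef2 (dXY i (P n)) 0 0 @[n --> \oo] --> pd i f x.
Proof. by move=> fP; exact: apx_value (apx_pd i fP). Qed.

(** Both sides are limits of one and the same sequence, since partial derivatives of polynomials
    commute. *)
Lemma pdC f x : analytic_at f x -> pd 0 (pd 1 f) x = pd 1 (pd 0 f) x.
Proof.
move=> /analytic_apx[rho [P fP]].
have A := apx_pd_value (i := 0) (apx_pd 1 fP).
have B := apx_pd_value (i := 1) (apx_pd 0 fP).
apply: cvg_unique A _ => //; move: B; rewrite /dXY /=.
by under eq_fun do rewrite -dX_dY.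
Qed.

Lemma near_eq_pd i f g x : (\forall y \near x, f y = g y) -> pd i f x = pd i g x.
Proof. exact: near_eq_derive. Qed.

Lemma near_near f g x : (\forall y \near x, f y = g y) ->
  \forall z \near x, \forall y \near z, f y = g y.
Proof. by move=> /nbhs_interior. Qed.

Lemma near_eq_pd_near i f g x : (\forall y \near x, f y = g y) ->
  \forall y \near x, pd i f y = pd i g y.
Proof. by move=> /near_near; apply: filterS => y; exact: near_eq_pd. Qed.

Lemma derivable_analytic v f x : analytic_at f x -> derivable f x v.
Proof. by move=> /analytic_differentiable; exact: diff_derivable. Qed.

Lemma pd_cst i (c : R) x : pd i (fun=> c) x = 0.
Proof. by rewrite /pd derive_cst. Qed.

Lemma pdD i f g x : analytic_at f x -> analytic_at g x ->
  pd i (fun z => f z + g z) x = pd i f x + pd i g x.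
Proof.
by move=> fx gx; rewrite /pd -deriveD //; exact: derivable_analytic.
Qed.

Lemma pdM i f g x : analytic_at f x -> analytic_at g x ->
  pd i (fun z => f z * g z) x = pd i f x * g x + f x * pd i g x.
Proof.
move=> fx gx; have df := derivable_analytic (v := delta_mx 0 i) fx.
have dg := derivable_analytic (v := delta_mx 0 i) gx.
transitivity (f x * pd i g x + g x * pd i f x); first exact: deriveM df dg.
by rewrite addrC (mulrC (g x)).
Qed.

Lemma pdN i f x : analytic_at f x -> pd i (fun z => - f z) x = - pd i f x.
Proof. by move=> fx; rewrite /pd (@deriveN _ _ _ f) //; exact: derivable_analytic. Qed.

Lemma pdB i f g x : analytic_at f x -> analytic_at g x ->
  pd i (fun z => f z - g z) x = pd i f x - pd i g x.
Proof. by move=> fx gx; rewrite (pdD i fx (analyticN gx)) pdN. Qed.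

Lemma pd_sum i n (F : 'I_n -> 'rV[R]_2 -> R) x : (forall j, analytic_at (F j) x) ->
  pd i (fun z => \sum_(j < n) F j z) x = \sum_(j < n) pd i (F j) x.
Proof.
elim: n F => [|n IH] F hF.
  rewrite big_ord0 -[RHS](pd_cst i 0 x); congr (pd i _ x); apply/funext => z.
  by rewrite big_ord0.
rewrite big_ord_recr /= -IH // -pdD //; last exact: analytic_sum.
by congr (pd i _ x); apply/funext => z; rewrite big_ord_recr.
Qed.

Lemma apx_ser_lim f x rho P a : apx f x rho P ->
  (forall i j, coef2 (P n) i j @[n --> \oo] --> a i j) -> ser f x rho a.
Proof.
move=> /apx_ser fS aP; move: fS; congr (ser f x rho _).
by apply/funext => i; apply/funext => j; apply: cvg_lim.
Qed.

Lemma trunc_cvg (a : nat -> nat -> R) i j : coef2 (trunc a n) i j @[n --> \oo] --> a i j.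
Proof.
apply: cvg_near_cst; exists (maxn i j).+1 => // n /=; rewrite ltnNge => h.
rewrite coef2_trunc ifT //; apply/andP; split; rewrite ltnNge; apply: contra h => h.
  by rewrite leq_max h.
by rewrite leq_max h orbT.
Qed.

Lemma ser_pd0 f x rho a : ser f x rho a ->
  ser (pd 0 f) x (rho / 2 / 8) (fun i j => a i.+1 j *+ i.+1).
Proof.
move=> /ser_apx /(apx_pd 0) fP; apply: apx_ser_lim fP _ => i j; rewrite /dXY /=.
under eq_fun do rewrite coef2_dX.
by apply: cvgMn; exact: trunc_cvg.
Qed.

Lemma ser_pd1 f x rho a : ser f x rho a ->
  ser (pd 1 f) x (rho / 2 / 8) (fun i j => a i j.+1 *+ j.+1).
Proof.
move=> /ser_apx /(apx_pd 1) fP; apply: apx_ser_lim fP _ => i j; rewrite /dXY /=.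
under eq_fun do rewrite coef2_dY.
by apply: cvgMn; exact: trunc_cvg.
Qed.

Definition cauchy (a b : nat -> nat -> R) i j : R :=
  \sum_(k < i.+1) \sum_(l < j.+1) a k l * b (i - k)%N (j - l)%N.

Lemma ser_le f x rho sigma a : ser f x rho a -> 0 < sigma <= rho -> ser f x sigma a.
Proof.
move=> [r0 [M hM] hf] /andP[s0 sr]; split=> // [|h hs].
  exists M => n; apply: le_trans (hM n).
  do 2 (apply: ler_sum => ? _); rewrite ler_wpM2l // lerXn2r // nnegrE ltW //.
by apply: hf; exact: le_trans hs sr.
Qed.

Lemma serM f g x rho a b : ser f x rho a -> ser g x rho b ->
  ser (fun z => f z * g z) x (rho / 2) (cauchy a b).
Proof.
move=> /ser_apx fP /ser_apx gP; apply: apx_ser_lim (apxM fP gP) _ => i j.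
under eq_fun do rewrite coef2M.
apply: cvg_big => [|k _]; first exact: add_continuous.
apply: cvg_big => [|l _]; first exact: add_continuous.
by apply: cvgM; exact: trunc_cvg.
Qed.

Lemma serD f g x rho a b : ser f x rho a -> ser g x rho b ->
  ser (fun z => f z + g z) x (rho / 2) (fun i j => a i j + b i j).
Proof.
move=> /ser_apx fP /ser_apx gP; apply: apx_ser_lim (apxD fP gP) _ => i j.
under eq_fun do rewrite coef2D.
by apply: cvgD; exact: trunc_cvg.
Qed.

Lemma ser_near_eq f g x rho sigma a : ser f x rho a -> ser g x sigma a ->
  \forall y \near x, f y = g y.
Proof.
move=> [r0 _ hf] [s0 _ hg]; apply: (@shift_ball_nbhs _ _ (Num.min rho sigma)).
  by rewrite lt_min r0 s0.
move=> h; rewrite le_min => /andP[hr hs].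
by apply: cvg_unique (hf h hr) (hg h hs).
Qed.

Lemma ser_value f x rho a : ser f x rho a -> a 0%N 0%N = f x.
Proof.
move=> fa; have <- : limn (fun n => coef2 (trunc a n) 0 0) = f x.
  by apply: cvg_lim => //; exact: apx_value (ser_apx fa).
by symmetry; apply: cvg_lim => //; exact: trunc_cvg.
Qed.

Definition near0 f x := \forall y \near x, f y = 0.

Lemma near0_pd i f x : near0 f x -> near0 (pd i f) x.
Proof.
by move=> /(near_eq_pd_near i); apply: filterS => y ->; exact: pd_cst.
Qed.

(** A coefficient is, up to a nonzero integer, the value at x of an iterated derivative.
    Differentiation preserves vanishing near a point, so the hypothesis passes to derivatives (first
    in s for i, then in t for j), and continuity settles the value itself. *)
Lemma ser_eq0_of_closure f x rho a : ser f x rho a -> closure (near0 f) x ->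
  forall i j, a i j = 0.
Proof.
move=> fa fx i; elim: i f x rho a fa fx => [|i IHi] f x rho a fa fx; last first.
  move=> j; have /IHi/(_ j) : closure (near0 (pd 0 f)) x.
    by move: fx; apply: closure_subset => y; exact: near0_pd.
  move=> /(_ _ _ (ser_pd0 fa)) /eqP; rewrite mulrn_eq0 /= => /eqP; exact.
move=> j; elim: j f x rho a fa fx => [|j IHj] f x rho a fa fx; last first.
  have /IHj : closure (near0 (pd 1 f)) x.
    by move: fx; apply: closure_subset => y; exact: near0_pd.
  by move=> /(_ _ _ (ser_pd1 fa)) /eqP; rewrite mulrn_eq0 /= => /eqP.
rewrite (ser_value fa); apply/eqP/negPn/negP => f0.
have fc := analytic_continuous (ser_analytic fa).
have nb : nbhs x [set y | f y != 0].
  by have := fc _ (open_nbhs_nbhs (conj (@open_neq _ _) f0)).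
have [y [y1 y2]] := fx _ nb.
by move: y2; rewrite /= (nbhs_singleton y1) eqxx.
Qed.

Lemma analytic_near0_closure f x : analytic_at f x -> closure (near0 f) x -> near0 f x.
Proof.
move=> /analytic_ser[rho [a fa]] fx; have a0 := ser_eq0_of_closure fa fx.
apply: (@ser_near_eq f (fun=> 0) x rho 1 a) => //; split=> //.
  by exists 0 => n; rewrite big1 // => i _; rewrite big1 // => j _; rewrite a0 normr0 mul0r.
move=> h _; rewrite (_ : (fun n => _) = cst 0); first exact: cvg_cst.
by apply/funext => n; rewrite big1 // => i _; rewrite big1 // => j _; rewrite a0 !mul0r.
Qed.

Lemma analytic_pd0_cst f x : analytic_at f x ->
  (\forall y \near x, pd 0 f y = 0) -> (\forall y \near x, pd 1 f y = 0) ->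
  \forall y \near x, f y = f x.
Proof.
move=> /analytic_ser[rho [a fa]] d0 d1.
have z0 := ser_eq0_of_closure (ser_pd0 fa) (subset_closure d0).
have z1 := ser_eq0_of_closure (ser_pd1 fa) (subset_closure d1).
have a0 i j : a i j = if (i == 0%N) && (j == 0%N) then f x else 0.
  case: i => [|i]; first case: j => [|j] /=.
  - exact: ser_value fa.
  - by have /eqP := z1 0%N j; rewrite mulrn_eq0 /= => /eqP.
  - by have /eqP := z0 i j; rewrite mulrn_eq0 /= => /eqP.
apply: (@ser_near_eq f (fun=> f x) x rho 1 a) => //.
apply: apx_ser_lim (apx_cst _ _ ltr01) _ => i j.
rewrite a0 coef2C; case: eqP => _; case: eqP => _; rewrite ?mulr1n ?mulr0n ?mul0rn; exact: cvg_cst.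
Qed.

End Operations.

(** * The Beltrami equation *)

Section CauchyKovalevskaya.
Context {R : realType}.
Implicit Types (x h : 'rV[R]_2).
Variables X Y : nat -> nat -> R.

(* Coefficients [(w_ij.1, w_ij.2)] of the power series solution of
   [w_t = (X + iY) w_s], [w(s, 0) = s]; [n] is fuel. *)
Fixpoint ck (n j i : nat) {struct n} : R * R :=
  if j is j'.+1 then
    if n is n'.+1 then
      (j'.+1%:R^-1 * \sum_(k < i.+1) \sum_(l < j'.+1)
         (X k l * ((ck n' (j' - l)%N (i - k).+1).1 *+ (i - k).+1)
          - Y k l * ((ck n' (j' - l)%N (i - k).+1).2 *+ (i - k).+1)),
       j'.+1%:R^-1 * \sum_(k < i.+1) \sum_(l < j'.+1)
         (Y k l * ((ck n' (j' - l)%N (i - k).+1).1 *+ (i - k).+1)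
          + X k l * ((ck n' (j' - l)%N (i - k).+1).2 *+ (i - k).+1)))
    else (0, 0)
  else ((i == 1%N)%:R, 0).

Lemma ck_fuel n j i : (j <= n)%N -> ck n j i = ck j j i.
Proof.
elim/ltn_ind: j n i => -[|j] IH [|n] i //= jn.
have E k l : ck n (j - l)%N k = ck j (j - l)%N k.
  rewrite IH ?ltnS ?leq_subr // ?(leq_trans (leq_subr _ _)) //.
  by rewrite [RHS]IH ?ltnS ?leq_subr.
by congr (_ * _, _ * _); apply: eq_bigr => k _; apply: eq_bigr => l _; rewrite E.
Qed.

Definition ck1 i j : R := (ck j j i).1.
Definition ck2 i j : R := (ck j j i).2.

Lemma ck1S i j : ck1 i j.+1 *+ j.+1 = cauchy X (fun i j => ck1 i.+1 j *+ i.+1) i j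
  - cauchy Y (fun i j => ck2 i.+1 j *+ i.+1) i j.
Proof.
rewrite /ck1 /cauchy -mulr_natl [ck _ _ _]/= [X in _ * X]/= mulrA mulfV ?pnatr_eq0 // mul1r.
rewrite -sumrB; apply: eq_bigr => k _; rewrite -sumrB; apply: eq_bigr => l _.
by rewrite ck_fuel // leq_subr.
Qed.

Lemma ck2S i j : ck2 i j.+1 *+ j.+1 = cauchy Y (fun i j => ck1 i.+1 j *+ i.+1) i j
  + cauchy X (fun i j => ck2 i.+1 j *+ i.+1) i j.
Proof.
rewrite /ck2 /cauchy -mulr_natl [ck _ _ _]/= [X in _ * X]/= mulrA mulfV ?pnatr_eq0 // mul1r.
rewrite -big_split; apply: eq_bigr => k _; rewrite -big_split; apply: eq_bigr => l _.
by rewrite /= ck_fuel // leq_subr.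
Qed.

Lemma bin_mono a b a' b' : (a <= a')%N -> (b <= b')%N ->
  ('C(a + b, a) <= 'C(a' + b', a'))%N.
Proof.
move=> aa bb; apply: (@leq_trans 'C(a' + b, a')).
  rewrite -[leqLHS]bin_sub ?leq_addr // -[leqRHS]bin_sub ?leq_addr //.
  by rewrite !(addKn) leq_bin2l // leq_add2r.
by rewrite leq_bin2l // leq_add2l.
Qed.

(** The combinatorial inequality behind the majorant: an s-derivative of a lower term is dominated
    by a t-derivative of the term sought. Equality holds at k = l = 0, and the other terms follow by
    monotonicity. *)
Lemma bin_step i j k l : (k <= i)%N -> (l <= j)%N ->
  ((i - k).+1 * 'C((i - k).+1 + (j - l), (i - k).+1) <= j.+1 * 'C(i + j.+1, i))%N.
Proof.
move=> ki lj; have E : (j.+1 * 'C(i + j.+1, i) = (i + j).+1 * 'C(i + j, i))%N.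
  rewrite -(bin_sub (leq_addr _ _)) addKn -(bin_sub (leq_addr _ _)) addKn addnS.
  by rewrite mul_bin_diag.
rewrite E addSn -mul_bin_diag /=; apply: leq_mul.
  by rewrite ltnS leq_add // leq_subr.
by apply: bin_mono; rewrite leq_subr.
Qed.

(** The bounds are the Taylor coefficients of the majorant 1/(1 - s/rho - (M/rho) t). One step in t
    costs a factor M from the coefficients X, Y and a factor 1/rho from the s-derivative. The
    initial value s is dominated because rho is at most 1. *)
Lemma ck_bound (rho M : R) : 0 < rho -> rho <= 1 -> 1 <= M ->
  (forall n, \sum_(i < n) \sum_(j < n) (`|X i j| + `|Y i j|) * rho ^+ (i + j) <= M) ->
  forall j i, `|ck1 i j| <= 'C(i + j, i)%:R * rho^-1 ^+ i * (M / rho) ^+ j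
           /\ `|ck2 i j| <= 'C(i + j, i)%:R * rho^-1 ^+ i * (M / rho) ^+ j.
Proof.
move=> r0 r1 M1 hM; elim/ltn_ind => -[|j] IH i.
  rewrite /ck1 /ck2 /= addn0 binn expr0 mulr1 mul1r normr0.
  have h : 0 <= rho^-1 ^+ i by rewrite exprn_ge0 // invr_ge0 ltW.
  split=> //; case: eqP => [->|_]; last by rewrite normr0.
  by rewrite normr1 expr1 invf_ge1.
have M0 : 0 < M by lra.
set B := M / rho; have B0 : 0 < B by rewrite divr_gt0.
(* Normalized weights: by hypothesis |a| + |b| summed against [W] is at most 1, so it suffices to
   bound each shifted derivative by the target times [W k l]. *)
pose W k l : R := rho ^+ (k + l) / M.
have key (a b c d : nat -> nat -> R) :
    (forall k l, (l <= j)%N -> `|c k (j - l)%N| <= 'C(k + (j - l), k)%:R * rho^-1 ^+ k * B ^+ (j - l)) ->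
    (forall k l, (l <= j)%N -> `|d k (j - l)%N| <= 'C(k + (j - l), k)%:R * rho^-1 ^+ k * B ^+ (j - l)) ->
    (forall n, \sum_(i < n) \sum_(j < n) (`|a i j| + `|b i j|) * rho ^+ (i + j) <= M) ->
    `|cauchy a (fun i j => c i.+1 j *+ i.+1) i j| + `|cauchy b (fun i j => d i.+1 j *+ i.+1) i j|
    <= j.+1%:R * ('C(i + j.+1, i)%:R * rho^-1 ^+ i * B ^+ j.+1).
  move=> hc hd hab.
  pose T : R := j.+1%:R * ('C(i + j.+1, i)%:R * rho^-1 ^+ i * B ^+ j.+1).
  have T0 : 0 <= T by rewrite !mulr_ge0 ?exprn_ge0 ?invr_ge0 ?(ltW r0) ?(ltW B0).
  have term (e : nat -> nat -> R) k l : (k <= i)%N -> (l <= j)%N ->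
      (forall k l, (l <= j)%N -> `|e k (j - l)%N| <= 'C(k + (j - l), k)%:R * rho^-1 ^+ k * B ^+ (j - l)) ->
      `|e (i - k).+1 (j - l)%N *+ (i - k).+1| <= T * W k l.
    move=> ki lj he; rewrite normrMn -mulr_natl.
    apply: le_trans (ler_wpM2l _ (he _ _ lj)) _ => //.
    rewrite [leLHS](_ : _ = ((i - k).+1 * 'C((i - k).+1 + (j - l), (i - k).+1))%:R
      * (rho^-1 ^+ (i - k).+1 * B ^+ (j - l))); last by rewrite natrM !mulrA.
    have -> : T * W k l = (j.+1 * 'C(i + j.+1, i))%:R * (rho^-1 ^+ i * B ^+ j.+1 * W k l).
      by rewrite /T natrM !mulrA.
    apply: ler_pM => //.
    - by rewrite mulr_ge0 ?exprn_ge0 ?invr_ge0 ?(ltW r0) ?(ltW B0).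
    - by rewrite ler_nat bin_step.
    rewrite /W exprD.
    have -> : rho^-1 ^+ (i - k).+1 = rho^-1 ^+ i * rho^-1 * rho ^+ k.
      rewrite -[in RHS](subnK ki) exprD exprS -!mulrA [X in _ = _ * X]mulrCA -exprMn.
      by rewrite mulVf ?gt_eqF // expr1n mulr1 mulrC.
    have -> : B ^+ j.+1 = B ^+ (j - l) * B ^+ l * B by rewrite -exprD subnK // exprSr.
    (* Here B rho = M, so the surplus powers of t only help because M is at least 1. *)
    have Bl : 1 <= B ^+ l * rho ^+ l.
      by rewrite -exprMn /B divfK ?gt_eqF // exprn_ege1.
    rewrite {2}/B.
    have -> : rho^-1 ^+ i * (B ^+ (j - l) * B ^+ l * (M / rho)) * (rho ^+ k * rho ^+ l / M)
      = (rho^-1 ^+ i / rho * rho ^+ k * B ^+ (j - l)) * (B ^+ l * rho ^+ l).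
      by field; rewrite !gt_eqF.
    apply: ler_peMr => //.
    by rewrite !mulr_ge0 ?exprn_ge0 ?invr_ge0 ?(ltW r0) ?(ltW B0).
  have W0 k l : 0 <= W k l by rewrite divr_ge0 ?exprn_ge0 ?(ltW r0) ?(ltW M0).
  have cau (a' e : nat -> nat -> R) :
      (forall k l, (l <= j)%N -> `|e k (j - l)%N| <= 'C(k + (j - l), k)%:R * rho^-1 ^+ k * B ^+ (j - l)) ->
      `|cauchy a' (fun i j => e i.+1 j *+ i.+1) i j|
      <= \sum_(k < (i + j).+1) \sum_(l < (i + j).+1) T / M * (`|a' k l| * rho ^+ (k + l)).
    move=> he; apply: le_trans (ler_norm_sum _ _ _) _.
    pose F k l : R := T / M * (`|a' k l| * rho ^+ (k + l)).
    have F0 k l : 0 <= F k l.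
      apply: mulr_ge0; first by rewrite divr_ge0 // ltW.
      by rewrite mulr_ge0 // exprn_ge0 // ltW.
    have h1 : (i.+1 <= (i + j).+1)%N by rewrite ltnS leq_addr.
    have h2 : (j.+1 <= (i + j).+1)%N by rewrite ltnS leq_addl.
    apply: (@le_trans _ _ (\sum_(k < i.+1) \sum_(l < (i + j).+1) F k l)); last first.
      rewrite (big_ord_widen _ (fun k => \sum_(l < (i + j).+1) F k l) h1).
      rewrite big_mkcond /=; apply: ler_sum => k _; case: ifP => // _.
      by apply: sumr_ge0 => l _; exact: F0.
    apply: ler_sum => k _; apply: le_trans (ler_norm_sum _ _ _) _.
    apply: (@le_trans _ _ (\sum_(l < j.+1) F k l)); last first.
      rewrite (big_ord_widen _ (fun l => F k l) h2).
      by rewrite big_mkcond /=; apply: ler_sum => l _; case: ifP.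
    apply: ler_sum => l _; rewrite normrM.
    apply: le_trans (ler_wpM2l (normr_ge0 _) (term e k l _ _ he)) _.
    - by rewrite -ltnS ltn_ord.
    - by rewrite -ltnS ltn_ord.
    by rewrite /F /W le_eqVlt; apply/orP; left; apply/eqP; ring.
  apply: le_trans (lerD (cau a c hc) (cau b d hd)) _.
  rewrite -big_split /=; under eq_bigr do rewrite -big_split /=.
  under eq_bigr do under eq_bigr do rewrite -mulrDr -mulrDl.
  under eq_bigr do rewrite -mulr_sumr.
  rewrite -mulr_sumr mulrAC ler_pdivrMr // ler_wpM2l //.
  exact: hab.
have b1 k l : (l <= j)%N -> `|ck1 k (j - l)%N| <= 'C(k + (j - l), k)%:R * rho^-1 ^+ k * B ^+ (j - l).
  by move=> lj; have [] := IH (j - l)%N _ k; rewrite ?ltnS ?leq_subr.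
have b2 k l : (l <= j)%N -> `|ck2 k (j - l)%N| <= 'C(k + (j - l), k)%:R * rho^-1 ^+ k * B ^+ (j - l).
  by move=> lj; have [] := IH (j - l)%N _ k; rewrite ?ltnS ?leq_subr.
have j0 : 0 < j.+1%:R :> R by rewrite ltr0n.
have hM' n : \sum_(i < n) \sum_(j < n) (`|Y i j| + `|X i j|) * rho ^+ (i + j) <= M.
  by under eq_bigr do under eq_bigr do rewrite addrC; exact: hM.
split; rewrite -(ler_pM2l j0).
  rewrite -[X in X * `|_|](@ger0_norm _ j.+1%:R) // -normrM mulr_natl ck1S.
  by apply: le_trans (ler_normB _ _) _; exact: key.
rewrite -[X in X * `|_|](@ger0_norm _ j.+1%:R) // -normrM mulr_natl ck2S.
by apply: le_trans (ler_normD _ _) _; exact: key.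
Qed.

Lemma geometric_square_bound (q : R) n : 0 <= q -> q <= 2^-1 ->
  \sum_(i < n) \sum_(j < n) q ^+ (i + j) <= 4.
Proof.
move=> q0 q1; have E : \sum_(i < n) q ^+ i <= 2.
  apply: (@le_trans _ _ (2 - 2 * 2^-1 ^+ n)); last first.
    by rewrite gerBl mulr_ge0 // exprn_ge0 // invr_ge0.
  elim: n => [|n IH]; first by rewrite big_ord0 expr0; lra.
  rewrite big_ord_recr /=; have : q ^+ n <= 2^-1 ^+ n by rewrite lerXn2r // nnegrE invr_ge0.
  rewrite exprS; lra.
have -> : \sum_(i < n) \sum_(j < n) q ^+ (i + j) = (\sum_(i < n) q ^+ i) ^+ 2.
  rewrite expr2 mulr_suml; apply: eq_bigr => i _; rewrite mulr_sumr.
  by apply: eq_bigr => j _; rewrite exprD.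
have S0 : 0 <= \sum_(i < n) q ^+ i by apply: sumr_ge0 => i _; exact: exprn_ge0.
have -> : 4 = 2 ^+ 2 :> R by rewrite expr2; ring.
by rewrite lerXn2r // nnegrE.
Qed.

End CauchyKovalevskaya.

(** In complex notation w = u + iv solves w_t = (X + iY) w_s with w = s on the line t = 0, in
    coordinates centred at x. The prescribed s-derivatives make the Jacobian of (u, v) at x equal to
    Y(x). *)
Lemma beltrami_solution (R : realType) (X Y : 'rV[R]_2 -> R) (x : 'rV[R]_2) :
  analytic_at X x -> analytic_at Y x ->
  exists u v : 'rV[R]_2 -> R,
    [/\ analytic_at u x, analytic_at v x, pd 0 u x = 1, pd 0 v x = 0 &
     (\forall y \near x, pd 1 u y = X y * pd 0 u y - Y y * pd 0 v y) /\
     (\forall y \near x, pd 1 v y = Y y * pd 0 u y + X y * pd 0 v y)].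
Proof.
move=> /analytic_ser[r1 [a Xa]] /analytic_ser[r2 [b Yb]].
have [[r10 _ _] [r20 _ _]] := (Xa, Yb).
pose rho := Num.min 1 (Num.min r1 r2).
have rho0 : 0 < rho by rewrite !lt_min ltr01 r10 r20.
have Xa' : ser X x rho a by apply: ser_le Xa _; rewrite rho0 !ge_min lexx ?orbT.
have Yb' : ser Y x rho b by apply: ser_le Yb _; rewrite rho0 !ge_min lexx ?orbT.
have rho1 : rho <= 1 by rewrite ge_min lexx.
have [_ [M1 hM1] _] := Xa'; have [_ [M2 hM2] _] := Yb'.
pose M := Num.max 1 (M1 + M2).
have M_ge1 : 1 <= M by rewrite le_max lexx.
have hM n : \sum_(i < n) \sum_(j < n) (`|a i j| + `|b i j|) * rho ^+ (i + j) <= M.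
  apply: (@le_trans _ _ (M1 + M2)); last by rewrite le_max lexx orbT.
  apply: le_trans (lerD (hM1 n) (hM2 n)); rewrite -big_split /=.
  apply: ler_sum => i _; rewrite -big_split /=; apply: ler_sum => j _.
  by rewrite mulrDl.
have bnd := ck_bound rho0 rho1 M_ge1 hM.
pose B := M / rho; have B0 : 0 < B by rewrite divr_gt0 //; lra.
have AB : rho^-1 <= B by rewrite /B ler_peMl ?invr_ge0 ?(ltW rho0).
(* A binomial coefficient is at most 2^(i+j) and 1/rho is at most B, so coefficients are bounded by
   (2B)^(i+j). At radius 1/(4B) the weighted sums are dominated by a double geometric series of
   ratio 1/2, whose sum is at most 4. *)
pose s := (4 * B)^-1; have s0 : 0 < s by rewrite invr_gt0 mulr_gt0.
have sum_bound (w : nat -> nat -> R) :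
    (forall j i, `|w i j| <= 'C(i + j, i)%:R * rho^-1 ^+ i * B ^+ j) ->
    forall n, \sum_(i < n) \sum_(j < n) `|w i j| * s ^+ (i + j) <= 4.
  move=> hw n; apply: le_trans (@geometric_square_bound _ (2^-1) n _ _); rewrite ?invr_ge0 //.
  apply: ler_sum => i _; apply: ler_sum => j _.
  apply: (@le_trans _ _ ((2 * B) ^+ (i + j) * s ^+ (i + j))); last first.
    by rewrite -exprMn /s (_ : 2 * B / (4 * B) = 2^-1) //; field; rewrite gt_eqF.
  rewrite ler_wpM2r ?exprn_ge0 ?(ltW s0) //; apply: le_trans (hw j i) _.
  rewrite [(2 * B) ^+ _]exprMn -mulrA; apply: ler_pM => //.
  - by rewrite mulr_ge0 ?exprn_ge0 ?invr_ge0 ?(ltW rho0) ?(ltW B0).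
  - rewrite -natrX ler_nat; apply: leq_trans (_ : \sum_(k < (i + j).+1) 'C(i + j, k) <= _)%N.
      have ij : (i < (i + j).+1)%N by rewrite ltnS leq_addr.
      by rewrite (bigD1 (Ordinal ij)) //= leq_addr.
    rewrite (_ : 2 = 1 + 1)%N // expnDn leq_sum // => k _.
    by rewrite !exp1n !muln1.
  - rewrite exprD ler_wpM2r ?exprn_ge0 ?(ltW B0) //.
    by rewrite lerXn2r // nnegrE ?invr_ge0 ltW.
have mk (w : nat -> nat -> R) :
    (forall j i, `|w i j| <= 'C(i + j, i)%:R * rho^-1 ^+ i * B ^+ j) ->
    exists f, ser f x (s / 2) w.
  move=> hw; eexists; apply: apx_ser_lim (apx_exists x _ (ex_intro _ 4 (trunc_rate s0 (sum_bound w hw)))) _.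
    by lra.
  by move=> i j; exact: trunc_cvg.
have [u hu] := mk (ck1 a b) (fun j i => (bnd j i).1).
have [v hv] := mk (ck2 a b) (fun j i => (bnd j i).2).
have [du dv] := (ser_pd0 hu, ser_pd0 hv).
exists u, v; split; [exact: ser_analytic hu|exact: ser_analytic hv| | |].
- by rewrite -(ser_value du) /ck1 /= mulr1n.
- by rewrite -(ser_value dv) /ck2 /= mulr1n.
pose t := Num.min rho (s / 2 / 2 / 8).
have t0 : 0 < t by rewrite lt_min rho0 /=; lra.
have tr : 0 < t <= rho by rewrite t0 ge_min lexx.
have ts : 0 < t <= s / 2 / 2 / 8 by rewrite t0 ge_min lexx orbT.
have [Xt Yt] := (ser_le Xa' tr, ser_le Yb' tr).
have [ut vt] := (ser_le du ts, ser_le dv ts).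
have nY : ser (fun y => - Y y) x t (fun i j => - b i j).
  have [_ [K hK] hY] := Yt; split=> //.
    by exists K => n; under eq_bigr do under eq_bigr do rewrite normrN; exact: hK.
  move=> h ht; rewrite (_ : (fun n => _) = (fun n => - \sum_(i < n) \sum_(j < n) b i j * h 0 0 ^+ i * h 0 1 ^+ j)).
    by apply: cvgN; exact: hY.
  apply/funext => n; rewrite -sumrN; apply: eq_bigr => i _.
  by rewrite -sumrN; apply: eq_bigr => j _; rewrite !mulNr.
split.
  have := serD (serM Xt ut) (serM nY vt).
  rewrite (_ : (fun i j => _ + _) = (fun i j => ck1 a b i j.+1 *+ j.+1)) => [S|].
    have := ser_near_eq (ser_pd1 hu) S; apply: filterS => y ->.
    by rewrite mulNr.
  apply/funext => i; apply/funext => j; rewrite ck1S; congr (_ + _).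
  rewrite /cauchy -sumrN; apply: eq_bigr => k _; rewrite -sumrN.
  by apply: eq_bigr => l _; rewrite mulNr.
have := serD (serM Yt ut) (serM Xt vt).
rewrite (_ : (fun i j => _ + _) = (fun i j => ck2 a b i j.+1 *+ j.+1)) => [S|].
  by have := ser_near_eq (ser_pd1 hv) S; apply: filterS => y ->.
by apply/funext => i; apply/funext => j; rewrite ck2S.
Qed.

(** * The analytic inverse function theorem *)

Section InverseFunction.
Context {R : realType}.
Implicit Types (x y h k : 'rV[R]_2) (p q : poly2 R).

Lemma subr_exchange (a b c d : R) : a - b = c - d -> b - d = a - c.
Proof. by lra. Qed.

Lemma contraction_eq0 (p q : R) : 0 <= p -> 0 <= q ->
  p <= (p + q) / 8 -> q <= (p + q) / 8 -> p = 0 /\ q = 0.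
Proof. by move=> p0 q0 pq qp; split; lra. Qed.

(** When the differential is the identity, H(x + k) = H(x) + h is the fixed point equation k = h +
    n(x + k), where n is minus the second-order remainder. This approximates n. *)
Lemma apx_hi (f : 'rV[R]_2 -> R) x rho P : apx f x rho P ->
  apx (fun z => - (f z - f x - (pd 0 f x * (z - x) 0 0 + pd 1 f x * (z - x) 0 1)))
    x rho (fun n => - hi (P n)).
Proof.
move=> fP; have [r0 [C hC] hf] := fP; split=> // [|h hr].
  exists C => n; apply: le_trans (hC n).
  have E (a b : poly2 R) : - a - - b = - (a - b) by rewrite opprB opprK addrC.
  rewrite E -hiB.
  by rewrite (snormN (N2_seminorm (ltW r0))) N2_hi // ltW.
rewrite (_ : (fun n => _) = (fun n => - (pev (P n) h - coef2 (P n) 0 0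
    - (coef2 (P n) 1 0 * h 0 0 + coef2 (P n) 0 1 * h 0 1)))); last first.
  apply/funext => n; rewrite /pev raddfN /hi raddfB /= !raddfD /= !rmorphM /=.
  by rewrite ev_pX ev_pY !ev_pC /=; ring.
rewrite (_ : x + h - x = h); last by rewrite addrC addKr.
have c0 := apx_pd_value (i := 0) fP; have c1 := apx_pd_value (i := 1) fP.
apply: cvgN; apply: cvgB.
  by apply: cvgB; [exact: hf|exact: apx_value fP].
apply: cvgD; apply: cvgMr_tmp.
  by move: c0; rewrite /dXY /=; under eq_fun do rewrite coef2_dX mulr1n.
by move: c1; rewrite /dXY /=; under eq_fun do rewrite coef2_dY mulr1n.
Qed.

(** The remainder is quadratic in the radius while the target rho/8 is linear, so a small rho works;
    32 is 8 times the square of the factor 2 in the radius. The bound rho/8 keeps the iteration in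
    its ball and makes it a contraction. *)
Lemma N2_hi_small rho0 M : 0 < rho0 -> 0 < M ->
  exists2 rho : R, 0 < rho & 2 * rho <= rho0 /\
    forall p, N2 rho0 p <= M -> N2 (2 * rho) (- hi p) <= rho / 8.
Proof.
move=> r0 M0; pose rho := Num.min (rho0 / 2) (rho0 ^+ 2 / (32 * M)).
have rho_gt0 : 0 < rho by rewrite lt_min !divr_gt0 ?exprn_gt0 ?mulr_gt0.
have h1 : rho <= rho0 / 2 by rewrite ge_min lexx.
have h2 : rho * (32 * M) <= rho0 ^+ 2.
  by rewrite -ler_pdivlMr ?mulr_gt0 // ge_min lexx orbT.
exists rho => //; split; first by lra.
move=> p pM; have r2 : 0 <= 2 * rho by lra.
rewrite (snormN (N2_seminorm r2)) -(ler_pM2r (exprn_gt0 2 r0)).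
apply: le_trans (N2_hi_scale _ r2 _) _; first by lra.
apply: (@le_trans _ _ ((2 * rho) ^+ 2 * M)); first by rewrite ler_wpM2l ?exprn_ge0.
have -> : (2 * rho) ^+ 2 * M = rho / 8 * (rho * (32 * M)) by rewrite expr2; field.
by rewrite ler_wpM2l //; lra.
Qed.

Section Iteration.
Variables (N1' N2' : nat -> poly2 R).

(** Picard iteration for k = h + n(k), carried out on polynomials in h. Step m uses the m-th
    approximant of n, so that a single sequence handles both limits. *)
Fixpoint giter n : poly2 R * poly2 R :=
  if n is m.+1 then
    (pX + psub (giter m).1 (giter m).2 (N1' m), pY + psub (giter m).1 (giter m).2 (N2' m))
  else (0, 0).

Variables (rho C : R).
Hypotheses (rho0 : 0 < rho)
  (b1 : forall n, N2 (2 * rho) (N1' n) <= rho / 8)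
  (b2 : forall n, N2 (2 * rho) (N2' n) <= rho / 8)
  (c1 : forall n, N2 (2 * rho) (N1' n.+1 - N1' n) <= C / 2 ^+ n)
  (c2 : forall n, N2 (2 * rho) (N2' n.+1 - N2' n) <= C / 2 ^+ n).

Let sigma := rho / 2.
Let sigma0 : 0 < sigma. Proof. by rewrite /sigma; move: rho0; lra. Qed.
Let nS := N2_seminorm (ltW sigma0).
Let pCb := pC_bound (ltW sigma0).
Let r2 : 0 <= 2 * rho. Proof. by move: rho0; lra. Qed.
Let le_r2 : rho <= 2 * rho. Proof. by move: rho0; lra. Qed.

Lemma giter_bound n : N2 sigma (giter n).1 <= rho /\ N2 sigma (giter n).2 <= rho.
Proof.
elim: n => [|n [IH1 IH2]] /=; first by rewrite (snorm0 nS) ltW.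
have E p : N2 (2 * rho) p <= rho / 8 ->
    N2 sigma (psub (giter n).1 (giter n).2 p) <= rho / 8.
  move=> pb; apply: le_trans pb; apply: le_trans (N2_le_radius _ (ltW rho0) le_r2).
  exact: ev_bound.
have := E _ (b1 n); have := E _ (b2 n).
have := N2_pX (ltW sigma0); have := N2_pY (ltW sigma0); rewrite {2 4}/sigma => hY hX h2 h1.
by split; apply: le_trans (snormD nS _ _) _; move: rho0; lra.
Qed.

Lemma giter_rate : exists D : R, forall n,
  N2 sigma ((giter n.+1).1 - (giter n).1) + N2 sigma ((giter n.+1).2 - (giter n).2)
    <= D / 2 ^+ n.
Proof.
have C0 : 0 <= C.
  by have := c1 0; rewrite expr0 divr1; apply: le_trans (snorm_ge0 (N2_seminorm r2) _).
(* Increments satisfy e(n+1) <= 2C/2^n + e(n)/4, and 2C + D/4 <= D/2 as soon as D is at least 8C;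
   the term 2 rho covers the first increment. *)
exists (8 * C + 2 * rho); elim=> [|n IH].
  have [h1 h2] := giter_bound 1.
  rewrite expr0 divr1 [giter 0]/= !subr0; lra.
set e := N2 _ _ + _ in IH.
have step (Q : nat -> poly2 R) : N2 (2 * rho) (Q n) <= rho / 8 ->
    N2 (2 * rho) (Q n.+1 - Q n) <= C / 2 ^+ n ->
    N2 sigma (psub (giter n.+1).1 (giter n.+1).2 (Q n.+1)
              - psub (giter n).1 (giter n).2 (Q n)) <= C / 2 ^+ n + e / 8.
  move=> hb hc; have [g1 g2] := giter_bound n; have [g1' g2'] := giter_bound n.+1.
  rewrite (_ : _ - _ = psub (giter n.+1).1 (giter n.+1).2 (Q n.+1 - Q n)
     + (psub (giter n.+1).1 (giter n.+1).2 (Q n) - psub (giter n).1 (giter n).2 (Q n))); last first.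
    by rewrite psubB addrA subrK.
  apply: le_trans (snormD nS _ _) _; apply: lerD.
    apply: le_trans hc; apply: le_trans (N2_le_radius _ (ltW rho0) le_r2).
    exact: ev_bound.
  rewrite -(ler_pM2r rho0).
  apply: le_trans (ev_lipschitz nS pCb (Q n) g1' g2' g1 g2) _.
  rewrite -/e (_ : e / 8 * rho = rho / 8 * e); last by ring.
  rewrite ler_wpM2r // /e addr_ge0 // ?(snorm_ge0 nS) //.
have s1 := step _ (b1 n) (c1 n); have s2 := step _ (b2 n) (c2 n).
have E (p q r : poly2 R) : p + q - (p + r) = q - r by rewrite opprD addrACA subrr add0r.
have -> : (giter n.+2).1 - (giter n.+1).1 = psub (giter n.+1).1 (giter n.+1).2 (N1' n.+1)
    - psub (giter n).1 (giter n).2 (N1' n) by exact: E.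
have -> : (giter n.+2).2 - (giter n.+1).2 = psub (giter n.+1).1 (giter n.+1).2 (N2' n.+1)
    - psub (giter n).1 (giter n).2 (N2' n) by exact: E.
apply: le_trans (lerD s1 s2) _; rewrite exprS invfM.
move: IH; set t := (2 ^+ n)^-1 => IH.
have p : 0 <= rho * t by rewrite mulr_ge0 ?invr_ge0 ?exprn_ge0 ?ltW.
lra.
Qed.

End Iteration.

(** The limit of the iteration is a right inverse. It is also a left inverse because H is injective
    on the ball: its nonlinear part is Lipschitz with a small constant. *)
Lemma inverse_function_normalized (H1 H2 : 'rV[R]_2 -> R) x :
  analytic_at H1 x -> analytic_at H2 x ->
  pd 0 H1 x = 1 -> pd 1 H1 x = 0 -> pd 0 H2 x = 0 -> pd 1 H2 x = 1 ->
  exists g1 g2 : 'rV[R]_2 -> R, let y := pt (H1 x) (H2 x) in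
    [/\ analytic_at g1 y, analytic_at g2 y,
      \forall z \near x, pt (g1 (pt (H1 z) (H2 z))) (g2 (pt (H1 z) (H2 z))) = z &
      \forall z \near y, pt (H1 (pt (g1 z) (g2 z))) (H2 (pt (g1 z) (g2 z))) = z].
Proof.
move=> /[dup] H1x /analytic_apx[s1 [P1 HP1]] /[dup] H2x /analytic_apx[s2 [P2 HP2]] d10 d11 d20 d21.
have [r0 r00 [{}HP1 {}HP2]] := apx_common HP1 HP2.
have [_ hC1 _] := HP1; have [_ hC2 _] := HP2.
have [M1 M10 hM1] := apx_bound (ltW r00) hC1; have [M2 M20 hM2] := apx_bound (ltW r00) hC2.
have [rho rho0 [r2 small]] := N2_hi_small r00 (ltr_pDl M10 M20).
have Q1 := apx_hi HP1; have Q2 := apx_hi HP2.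
rewrite d10 d11 in Q1; rewrite d20 d21 in Q2.
set n1 := (fun z => _) in Q1; set n2 := (fun z => _) in Q2.
have r20 : 0 < 2 * rho by lra.
have {}Q1 : apx n1 x (2 * rho) (fun n => - hi (P1 n)) by apply: apx_le Q1 _; rewrite r20.
have {}Q2 : apx n2 x (2 * rho) (fun n => - hi (P2 n)) by apply: apx_le Q2 _; rewrite r20.
set N1' := (fun n => _) in Q1; set N2' := (fun n => _) in Q2.
have b1 n : N2 (2 * rho) (N1' n) <= rho / 8 by apply: small; have := hM1 n; lra.
have b2 n : N2 (2 * rho) (N2' n) <= rho / 8 by apply: small; have := hM2 n; lra.
have [_ [C1 hN1] n1P] := Q1; have [_ [C2 hN2] n2P] := Q2.
have C10 : 0 <= C1.
  by have := hN1 0; rewrite expr0 divr1; apply: le_trans (snorm_ge0 (N2_seminorm (ltW r20)) _).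
have C20 : 0 <= C2.
  by have := hN2 0; rewrite expr0 divr1; apply: le_trans (snorm_ge0 (N2_seminorm (ltW r20)) _).
have e0 n : 0 <= (2 ^+ n)^-1 :> R by rewrite invr_ge0 exprn_ge0.
have c1 n : N2 (2 * rho) (N1' n.+1 - N1' n) <= (C1 + C2) / 2 ^+ n.
  by apply: le_trans (hN1 n) _; rewrite ler_wpM2r //; lra.
have c2 n : N2 (2 * rho) (N2' n.+1 - N2' n) <= (C1 + C2) / 2 ^+ n.
  by apply: le_trans (hN2 n) _; rewrite ler_wpM2r //; lra.
have gb := giter_bound rho0 b1 b2; have [D gr] := giter_rate rho0 b1 b2 c1 c2.
set G := giter N1' N2' in gb gr; pose sigma := rho / 2.
have s0 : 0 < sigma by rewrite /sigma; lra.
have nS := N2_seminorm (ltW s0).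
pose y := pt (H1 x) (H2 x).
have A1 : apx (fun z => limn (fun n => pev (G n).1 (z - y))) y sigma (fun n => (G n).1).
  apply: apx_exists => //; exists D => n; apply: le_trans (gr n).
  by rewrite lerDl (snorm_ge0 nS).
have A2 : apx (fun z => limn (fun n => pev (G n).2 (z - y))) y sigma (fun n => (G n).2).
  apply: apx_exists => //; exists D => n; apply: le_trans (gr n).
  by rewrite lerDr (snorm_ge0 nS).
set k1 := (fun z => _) in A1; set k2 := (fun z => _) in A2.
have [_ _ k1P] := A1; have [_ _ k2P] := A2.
have [_ _ E1] := apx_comp Q1 A1 A2 (fun n => (gb n).1) (fun n => (gb n).2).
have [_ _ E2] := apx_comp Q2 A1 A2 (fun n => (gb n).1) (fun n => (gb n).2).
pose K z := pt (k1 z) (k2 z).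
(* The recursion is passed to the limit: the shifted sequence has the same limit, while its
   right-hand side converges by [apx_comp]. *)
have fix1 h : `|h| <= sigma -> k1 (y + h) = h 0 0 + n1 (x + K (y + h)).
  move=> hs; have L := @cvgn_shift _ 1 _ _ (k1P h hs).
  have L' : pev (G (1 + n)%N).1 h @[n --> \oo] --> h 0 0 + n1 (x + K (y + h)).
    rewrite (_ : (fun n => _) = (fun n => h 0 0 + pev (psub (G n).1 (G n).2 (N1' n)) h)).
      by apply: cvgD; [exact: cvg_cst|exact: E1].
    by apply/funext => n; rewrite add1n /= /pev raddfD /= ev_pX.
  by rewrite -(cvg_lim _ L) // (cvg_lim _ L').
have fix2 h : `|h| <= sigma -> k2 (y + h) = h 0 1 + n2 (x + K (y + h)).
  move=> hs; have L := @cvgn_shift _ 1 _ _ (k2P h hs).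
  have L' : pev (G (1 + n)%N).2 h @[n --> \oo] --> h 0 1 + n2 (x + K (y + h)).
    rewrite (_ : (fun n => _) = (fun n => h 0 1 + pev (psub (G n).1 (G n).2 (N2' n)) h)).
      by apply: cvgD; [exact: cvg_cst|exact: E2].
    by apply/funext => n; rewrite add1n /= /pev raddfD /= ev_pY.
  by rewrite -(cvg_lim _ L) // (cvg_lim _ L').
have Kr h : `|h| <= sigma -> `|K (y + h)| <= rho.
  move=> hs; apply/rV2_norm_le; rewrite pt0 pt1; split.
    apply: (@cvgn_le _ (fun n => `|pev (G n).1 h|)); first by apply: cvg_norm; exact: k1P.
    by move=> n; apply: le_trans (gb n).1; exact: pev_bound.
  apply: (@cvgn_le _ (fun n => `|pev (G n).2 h|)); first by apply: cvg_norm; exact: k2P.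
  by move=> n; apply: le_trans (gb n).2; exact: pev_bound.
pose F z := pt (H1 z) (H2 z).
have Fn k : F (x + k) = y + (k - pt (n1 (x + k)) (n2 (x + k))).
  by apply: rV2P; rewrite !mxE /= /n1 /n2 !mxE; ring.
have FK h : `|h| <= sigma -> F (x + K (y + h)) = y + h.
  move=> hs; rewrite Fn; congr (_ + _).
  by apply: rV2P; rewrite !mxE /= ?fix1 ?fix2 // addrK.
have lip (n : 'rV[R]_2 -> R) (N : nat -> poly2 R) k k' :
    apx n x (2 * rho) N -> (forall n, N2 (2 * rho) (N n) <= rho / 8) ->
    `|k| <= rho -> `|k'| <= rho ->
    `|n (x + k) - n (x + k')| <= (`|k 0 0 - k' 0 0| + `|k 0 1 - k' 0 1|) / 8.
  move=> [_ _ nP] nb kr kr'.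
  apply: (@cvgn_le _ (fun m => `|pev (N m) k - pev (N m) k'|)).
    by apply: cvg_norm; apply: cvgB; apply: nP; apply: le_trans (ler_double (ltW rho0)).
  move=> m; rewrite -(ler_pM2r rho0); apply: le_trans (pev_lipschitz _ kr kr') _.
  rewrite mulrAC -mulrA mulrC; apply: ler_wpM2l; first exact: addr_ge0.
  exact: nb.
(* Equal images make the difference of the points equal to the difference of the nonlinear parts,
   and each coordinate of the latter is at most an eighth of the l1 distance. *)
have inj k k' : `|k| <= rho -> `|k'| <= rho -> F (x + k) = F (x + k') -> k = k'.
  move=> kr kr'; rewrite !Fn => /addrI e.
  have e00 : (k - pt (n1 (x + k)) (n2 (x + k))) 0 0
           = (k' - pt (n1 (x + k')) (n2 (x + k'))) 0 0 by rewrite e.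
  have e01 : (k - pt (n1 (x + k)) (n2 (x + k))) 0 1
           = (k' - pt (n1 (x + k')) (n2 (x + k'))) 0 1 by rewrite e.
  move: e00 e01; rewrite !mxE /= => e00 e01.
  have l1 := lip _ _ _ _ Q1 b1 kr kr'; have l2 := lip _ _ _ _ Q2 b2 kr kr'.
  have f1 := subr_exchange e00; have f2 := subr_exchange e01.
  rewrite f1 in l1; rewrite f2 in l2.
  have [z1 z2] := contraction_eq0 (normr_ge0 _) (normr_ge0 _) l1 l2.
  by apply: rV2P; apply/eqP; rewrite -subr_eq0 -normr_eq0 ?z1 ?z2.
exists (fun z => x 0 0 + k1 z), (fun z => x 0 1 + k2 z) => /=.
have GE z : pt (x 0 0 + k1 z) (x 0 1 + k2 z) = x + K z.
  by apply: rV2P; rewrite !mxE.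
split.
- by apply: analyticD; [exact: analytic_cst|exact: apx_analytic A1].
- by apply: analyticD; [exact: analytic_cst|exact: apx_analytic A2].
- have Fc : \forall z \near x, `|F z - y| <= sigma.
    have /cvgrPdist_le/(_ _ s0) c1' := analytic_continuous H1x.
    have /cvgrPdist_le/(_ _ s0) c2' := analytic_continuous H2x.
    near=> z; apply/rV2_norm_le; rewrite !mxE /= [`|H1 z - _|]distrC [`|H2 z - _|]distrC.
    by split; near: z.
  near=> z; rewrite GE -/(F z).
  have Fz : `|F z - y| <= sigma by near: z.
  have zr : `|z - x| <= rho.
    by near: z; apply: (@shift_ball_nbhs _ _ _ rho) => // h; rewrite addrC addKr.
  have := Kr _ Fz; have := FK _ Fz; rewrite (addrC y) subrK => e Kz.
  have <- := inj _ _ zr Kz; first by rewrite addrC subrK.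
  by rewrite e addrC subrK.
- apply: (@shift_ball_nbhs _ _ _ sigma) => // h hs.
  by rewrite GE -/(F _) FK.
Unshelve. all: by end_near. Qed.

Lemma inverse_function (F : 'rV[R]_2 -> 'rV[R]_2) x :
  vanalytic_at F x ->
  pd 0 (fun z => F z 0 0) x * pd 1 (fun z => F z 0 1) x
    - pd 1 (fun z => F z 0 0) x * pd 0 (fun z => F z 0 1) x != 0 ->
  exists G : 'rV[R]_2 -> 'rV[R]_2,
    [/\ vanalytic_at G (F x), \forall z \near x, G (F z) = z &
      \forall y \near F x, F (G y) = y].
Proof.
move=> Fx; have [F1x F2x] := (Fx 0, Fx 1).
set f1 := (fun z => F z 0 0) in F1x *; set f2 := (fun z => F z 0 1) in F2x *.
set a := pd 0 f1 x; set b := pd 1 f1 x; set c := pd 0 f2 x; set d := pd 1 f2 x.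
set D := a * d - b * c => D0.
(* L is the inverse of the differential at x, so L composed with F has identity differential and the
   normalized case applies. *)
pose L (y : 'rV[R]_2) := pt (d / D * y 0 0 - b / D * y 0 1) (a / D * y 0 1 - c / D * y 0 0).
have Linj y z : L y = L z -> y = z.
  move=> e; have e0 : L y 0 0 = L z 0 0 by rewrite e.
  have e1 : L y 0 1 = L z 0 1 by rewrite e.
  move: e0 e1; rewrite !pt0 !pt1 => e0 e1.
  have i0 (w : 'rV[R]_2) : w 0 0 = a * (d / D * w 0 0 - b / D * w 0 1)
      + b * (a / D * w 0 1 - c / D * w 0 0) by rewrite /D; field.
  have i1 (w : 'rV[R]_2) : w 0 1 = c * (d / D * w 0 0 - b / D * w 0 1)
      + d * (a / D * w 0 1 - c / D * w 0 0) by rewrite /D; field.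
  by apply: rV2P; [rewrite (i0 y) e0 e1 -(i0 z)|rewrite (i1 y) e0 e1 -(i1 z)].
pose H1 z := d / D * f1 z - b / D * f2 z; pose H2 z := a / D * f2 z - c / D * f1 z.
have cM (e : R) f : analytic_at f x -> analytic_at (fun z => e * f z) x.
  by move=> fx; apply: analyticM => //; exact: analytic_cst.
have cpd i (e : R) f : analytic_at f x -> pd i (fun z => e * f z) x = e * pd i f x.
  by move=> fx; rewrite pdM ?pd_cst ?mul0r ?add0r //; exact: analytic_cst.
have H1x : analytic_at H1 x by apply: analyticB; exact: cM.
have H2x : analytic_at H2 x by apply: analyticB; exact: cM.
have pH1 i : pd i H1 x = d / D * pd i f1 x - b / D * pd i f2 x.
  by rewrite /H1 pdB ?cpd //; exact: cM.
have pH2 i : pd i H2 x = a / D * pd i f2 x - c / D * pd i f1 x.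
  by rewrite /H2 pdB ?cpd //; exact: cM.
have [||||g1 [g2 [g1y g2y gF Fg]]] := inverse_function_normalized H1x H2x.
- by rewrite pH1 -/a -/c /D; field.
- by rewrite pH1 -/b -/d /D; field.
- by rewrite pH2 -/a -/c /D; field.
- by rewrite pH2 -/b -/d /D; field.
have LF z : L (F z) = pt (H1 z) (H2 z) by [].
exists (fun y => pt (g1 (L y)) (g2 (L y))).
have La : vanalytic_at L (F x).
  have cc (i : 'I_2) (e : R) : analytic_at (fun y : 'rV[R]_2 => e * y 0 i) (F x).
    by apply: analyticM; [exact: analytic_cst|exact: analytic_coord].
  move=> i; case: (ord2_cases i) => ->.
    apply: (@analytic_eq _ (fun y => d / D * y 0 0 - b / D * y 0 1)) => [y|]; first by rewrite pt0.
    exact: analyticB.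
  apply: (@analytic_eq _ (fun y => a / D * y 0 1 - c / D * y 0 0)) => [y|]; first by rewrite pt1.
  exact: analyticB.
split.
- move=> i; case: (ord2_cases i) => ->.
    apply: (@analytic_eq _ (g1 \o L)) => [y|]; first by rewrite pt0.
    exact: analytic_vcomp.
  apply: (@analytic_eq _ (g2 \o L)) => [y|]; first by rewrite pt1.
  exact: analytic_vcomp.
- by move: gF; apply: filterS => z; rewrite LF.
have Lc := vanalytic_continuous La.
have Q : \forall y \near F x, pt (H1 (pt (g1 (L y)) (g2 (L y)))) (H2 (pt (g1 (L y)) (g2 (L y)))) = L y.
  exact: Lc _ Fg.
apply: filterS Q => y /= e; apply: Linj; rewrite -[RHS]e.
by rewrite LF.
Qed.

End InverseFunction.

(** * Special Lagrangian planes and the triple cross product *)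

Section ComplexCoordinates.
Context {R : realType}.
Implicit Types (x y z w u v : 'rV[R]_8) (a b : R).

Lemma inner_pairs x y : inner x y = \sum_(j < 4) (x 0 (inord j.*2) * y 0 (inord j.*2)
  + x 0 (inord j.*2.+1) * y 0 (inord j.*2.+1)).
Proof.
rewrite /inner !(big_ord_recl, big_ord0) /= !addr0 !addrA.
by do !congr (_ + _); congr (x 0 _ * y 0 _); apply/val_inj; rewrite /= ?inordK.
Qed.

Lemma innerC x y : inner x y = inner y x.
Proof. by apply: eq_bigr => k _; rewrite mulrC. Qed.
Lemma innerDl x y z : inner (x + y) z = inner x z + inner y z.
Proof. by rewrite -big_split; apply: eq_bigr => k _; rewrite mxE mulrDl. Qed.
Lemma innerZl a x z : inner (a *: x) z = a * inner x z.
Proof. by rewrite mulr_sumr; apply: eq_bigr => k _; rewrite mxE mulrA. Qed.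
Lemma innerNl x z : inner (- x) z = - inner x z.
Proof. by rewrite -scaleN1r innerZl mulN1r. Qed.
Lemma innerDr x y z : inner x (y + z) = inner x y + inner x z.
Proof. by rewrite !(innerC x) innerDl. Qed.
Lemma innerZr a x z : inner x (a *: z) = a * inner x z.
Proof. by rewrite !(innerC x) innerZl. Qed.
Lemma innerNr x z : inner x (- z) = - inner x z.
Proof. by rewrite !(innerC x) innerNl. Qed.
Lemma inner0l x : inner 0 x = 0.
Proof. by rewrite -(scale0r 0) innerZl mul0r. Qed.
Lemma inner0r x : inner x 0 = 0.
Proof. by rewrite innerC inner0l. Qed.

Definition innerE := (innerDl, innerZl, innerNl, innerDr, innerZr, innerNr, inner0l, inner0r).

Lemma inner_ge0 x : 0 <= inner x x.
Proof. by apply: sumr_ge0 => k _; rewrite -expr2 sqr_ge0. Qed.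

Lemma inner_eq0 x : inner x x = 0 -> x = 0.
Proof.
move=> /eqP; rewrite psumr_eq0 => [|k _]; last by rewrite -expr2 sqr_ge0.
move=> /allP h; apply/rowP => k; rewrite mxE; apply/eqP.
by have := h k (mem_index_enum k); rewrite /= -expr2 sqrf_eq0.
Qed.

Lemma inner_gt0 x : x != 0 -> 0 < inner x x.
Proof. by move=> x0; rewrite lt_def inner_ge0 andbT; apply: contra x0 => /eqP/inner_eq0 ->. Qed.

(* multiplication by the imaginary unit of C^4 *)
Definition ci x : 'rV[R]_8 := \row_k (if odd k then x 0 (inord k.-1) else - x 0 (inord k.+1)).

Lemma omega_ci x y : omega x y = inner (ci x) y.
Proof.
rewrite omegaE inner_pairs; apply: eq_bigr => -[j j4] _.
have e1 : (j.*2 < 8)%N by have : (j.*2 < 4.*2)%N by rewrite ltn_double.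
have e2 : (j.*2.+1 < 8)%N by have : (j.*2.+1 < 4.*2)%N by rewrite ltn_Sdouble.
by rewrite !mxE !inordK //= odd_double /= mulNr addrC.
Qed.

Lemma zcoordD j x y : zcoord j (x + y) = zcoord j x + zcoord j y.
Proof. by rewrite /zcoord !mxE; simpc. Qed.
Lemma zcoordZ j a x : zcoord j (a *: x) = a%:C%C * zcoord j x.
Proof. by rewrite /zcoord !mxE; simpc. Qed.

Lemma zcoord_ci j x : zcoord j (ci x) = Complex 0 1 * zcoord j x.
Proof.
case: j => j j4.
have e1 : (j.*2 < 8)%N by have : (j.*2 < 4.*2)%N by rewrite ltn_double.
have e2 : (j.*2.+1 < 8)%N by have : (j.*2.+1 < 4.*2)%N by rewrite ltn_Sdouble.
by rewrite /zcoord !mxE !inordK //= odd_double /=; simpc.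
Qed.

Definition herm x y : R[i] := \sum_(j < 4) conjc (zcoord j x) * zcoord j y.

Lemma hermE x y : herm x y = Complex (inner x y) (omega x y).
Proof.
rewrite inner_pairs omegaE /herm.
elim/big_rec3: _ => [//|j p q r _ ->].
by rewrite /zcoord; simpc; congr Complex; ring.
Qed.

Local Notation i0 := (@Ordinal 4 0 isT).
Local Notation i1 := (@Ordinal 4 1 isT).
Local Notation i2 := (@Ordinal 4 2 isT).
Local Notation i3 := (@Ordinal 4 3 isT).

Lemma sum4 (V : zmodType) (F : 'I_4 -> V) : \sum_j F j = F i0 + F i1 + F i2 + F i3.
Proof.
rewrite !(big_ord_recl, big_ord0) addr0 !addrA.
by do !congr (_ + _); congr (F _); apply/val_inj.
Qed.

(** Arranged along the last row, so that the coefficients of the fourth vector are visibly the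
    signed minors of the first three. *)
Lemma det4 (K : comNzRingType) (F : 'I_4 -> 'I_4 -> K) :
  \det (\matrix_(i, j) F i j) =
    F i3 i0 * - (F i0 i1 * (F i1 i2 * F i2 i3 - F i1 i3 * F i2 i2)
       - F i0 i2 * (F i1 i1 * F i2 i3 - F i1 i3 * F i2 i1)
       + F i0 i3 * (F i1 i1 * F i2 i2 - F i1 i2 * F i2 i1))
  + F i3 i1 * (F i0 i0 * (F i1 i2 * F i2 i3 - F i1 i3 * F i2 i2)
       - F i0 i2 * (F i1 i0 * F i2 i3 - F i1 i3 * F i2 i0)
       + F i0 i3 * (F i1 i0 * F i2 i2 - F i1 i2 * F i2 i0))
  + F i3 i2 * - (F i0 i0 * (F i1 i1 * F i2 i3 - F i1 i3 * F i2 i1)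
       - F i0 i1 * (F i1 i0 * F i2 i3 - F i1 i3 * F i2 i0)
       + F i0 i3 * (F i1 i0 * F i2 i1 - F i1 i1 * F i2 i0))
  + F i3 i3 * (F i0 i0 * (F i1 i1 * F i2 i2 - F i1 i2 * F i2 i1)
       - F i0 i1 * (F i1 i0 * F i2 i2 - F i1 i2 * F i2 i0)
       + F i0 i2 * (F i1 i0 * F i2 i1 - F i1 i1 * F i2 i0)).
Proof.
pose G (i j : nat) := F (inord i) (inord j).
have GE i j : F i j = G i j by rewrite /G !inord_val.
rewrite (_ : \matrix_(i, j) F i j = \matrix_(i, j) G i j); last first.
  by apply/matrixP => i j; rewrite !mxE GE.
rewrite !GE /=.
rewrite (expand_det_row _ i3) sum4 /cofactor !mxE /=.
rewrite !(expand_det_row _ ord0) !(big_ord_recl, big_ord0) /cofactor !mxE /=.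
rewrite !(expand_det_row _ ord0) !(big_ord_recl, big_ord0) /cofactor !mxE /=.
rewrite !det_mx11 !mxE /= /bump /=.
by ring.
Qed.

(* signed 3x3 minors: the coefficients of [Omega x y z] as a complex linear form *)
Definition minor3 (p q r : 'I_4) x y z : R[i] :=
  zcoord p x * (zcoord q y * zcoord r z - zcoord r y * zcoord q z)
  - zcoord q x * (zcoord p y * zcoord r z - zcoord r y * zcoord p z)
  + zcoord r x * (zcoord p y * zcoord q z - zcoord q y * zcoord p z).

Definition minor (j : 'I_4) x y z : R[i] :=
  match val j with
  | 0 => - minor3 i1 i2 i3 x y z
  | 1 => minor3 i0 i2 i3 x y z
  | 2 => - minor3 i0 i1 i3 x y z
  | _ => minor3 i0 i1 i2 x y z
  end.

Lemma Omega_minor x y z w :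
  Omega (quad x y z w) = \sum_(j < 4) minor j x y z * zcoord j w.
Proof.
rewrite /Omega (det4 (fun i j => zcoord j (quad x y z w i))) sum4 /minor /minor3 /=.
rewrite /quad !(tnth_nth 0) /=; ring.
Qed.

Lemma Omega_linear1 a x x' y z w : Omega (quad (a *: x + x') y z w)
  = a%:C%C * Omega (quad x y z w) + Omega (quad x' y z w).
Proof. by rewrite !Omega_minor !sum4 /minor /= /minor3 !zcoordD !zcoordZ; ring. Qed.
Lemma Omega_linear2 a x y y' z w : Omega (quad x (a *: y + y') z w)
  = a%:C%C * Omega (quad x y z w) + Omega (quad x y' z w).
Proof. by rewrite !Omega_minor !sum4 /minor /= /minor3 !zcoordD !zcoordZ; ring. Qed.
Lemma Omega_linear3 a x y z z' w : Omega (quad x y (a *: z + z') w)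
  = a%:C%C * Omega (quad x y z w) + Omega (quad x y z' w).
Proof. by rewrite !Omega_minor !sum4 /minor /= /minor3 !zcoordD !zcoordZ; ring. Qed.

Lemma Omega_swap34 x y z w : Omega (quad x y w z) = - Omega (quad x y z w).
Proof. by rewrite !Omega_minor !sum4 /minor /= /minor3; ring. Qed.

Lemma Omega_swap14 x y z w : Omega (quad w y z x) = - Omega (quad x y z w).
Proof. by rewrite !Omega_minor !sum4 /minor /= /minor3; ring. Qed.
Lemma Omega_swap24 x y z w : Omega (quad x w z y) = - Omega (quad x y z w).
Proof. by rewrite !Omega_minor !sum4 /minor /= /minor3; ring. Qed.

Lemma Omega_ci4 x y z w : Omega (quad x y z (ci w)) = Complex 0 1 * Omega (quad x y z w).
Proof.
rewrite !Omega_minor mulr_sumr; apply: eq_bigr => j _; rewrite zcoord_ci; ring.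
Qed.

Lemma Re_realM a (c : R[i]) : complex.Re (a%:C%C * c) = a * complex.Re c.
Proof. by case: c => ? ?; simpc. Qed.
Lemma ReD (c d : R[i]) : complex.Re (c + d) = complex.Re c + complex.Re d.
Proof. by case: c => ? ?; case: d => ? ?. Qed.
Lemma ReN (c : R[i]) : complex.Re (- c) = - complex.Re c.
Proof. by case: c. Qed.

Lemma ReOmega_linear1 a x x' y z w :
  ReOmega (a *: x + x') y z w = a * ReOmega x y z w + ReOmega x' y z w.
Proof. by rewrite /ReOmega Omega_linear1 ReD Re_realM. Qed.
Lemma ReOmega_linear2 a x y y' z w :
  ReOmega x (a *: y + y') z w = a * ReOmega x y z w + ReOmega x y' z w.
Proof. by rewrite /ReOmega Omega_linear2 ReD Re_realM. Qed.
Lemma ReOmega_linear3 a x y z z' w :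
  ReOmega x y (a *: z + z') w = a * ReOmega x y z w + ReOmega x y z' w.
Proof. by rewrite /ReOmega Omega_linear3 ReD Re_realM. Qed.
Lemma ReOmega_swap34 x y z w : ReOmega x y w z = - ReOmega x y z w.
Proof. by rewrite /ReOmega Omega_swap34 ReN. Qed.

Lemma ReOmega_swap14 x y z w : ReOmega w y z x = - ReOmega x y z w.
Proof. by rewrite /ReOmega Omega_swap14 ReN. Qed.
Lemma ReOmega_swap24 x y z w : ReOmega x w z y = - ReOmega x y z w.
Proof. by rewrite /ReOmega Omega_swap24 ReN. Qed.

Lemma oppr_self0 (V : numDomainType) (c : V) : c = - c -> c = 0.
Proof. by move=> /eqP; rewrite -subr_eq0 opprK -mulr2n mulrn_eq0 /= => /eqP. Qed.

Lemma Omega_xxzw x z w : Omega (quad x x z w) = 0.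
Proof. by rewrite !Omega_minor !sum4 /minor /= /minor3; ring. Qed.
Lemma Omega_xyyw x y w : Omega (quad x y y w) = 0.
Proof. by rewrite !Omega_minor !sum4 /minor /= /minor3; ring. Qed.
Lemma Omega_xyzz x y z : Omega (quad x y z z) = 0.
Proof. by rewrite !Omega_minor !sum4 /minor /= /minor3; ring. Qed.
Lemma Omega_xyzy x y z : Omega (quad x y z y) = 0.
Proof. by rewrite !Omega_minor !sum4 /minor /= /minor3; ring. Qed.
Lemma Omega_xyzx x y z : Omega (quad x y z x) = 0.
Proof. by rewrite !Omega_minor !sum4 /minor /= /minor3; ring. Qed.
Lemma Omega_xyxw x y w : Omega (quad x y x w) = 0.
Proof. by rewrite !Omega_minor !sum4 /minor /= /minor3; ring. Qed.

Lemma row_eq_inner u v : (forall w, inner u w = inner v w) -> u = v.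
Proof.
move=> h; apply/eqP; rewrite -subr_eq0; apply/eqP; apply: inner_eq0.
by rewrite innerDl innerNl h subrr.
Qed.

Lemma cross_linear1 a x x' y z : cross (a *: x + x') y z = a *: cross x y z + cross x' y z.
Proof. by apply: row_eq_inner => w; rewrite !innerE !crossP ReOmega_linear1. Qed.
Lemma cross_linear2 a x y y' z : cross x (a *: y + y') z = a *: cross x y z + cross x y' z.
Proof. by apply: row_eq_inner => w; rewrite !innerE !crossP ReOmega_linear2. Qed.
Lemma cross_linear3 a x y z z' : cross x y (a *: z + z') = a *: cross x y z + cross x y z'.
Proof. by apply: row_eq_inner => w; rewrite !innerE !crossP ReOmega_linear3. Qed.
Lemma crossD3 x y z z' : cross x y (z + z') = cross x y z + cross x y z'.
Proof. by rewrite -[z in LHS]scale1r cross_linear3 scale1r. Qed.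
Lemma cross03 x y : cross x y 0 = 0.
Proof. by have := cross_linear3 (-1) x y 0 0; rewrite scaler0 addr0 scaleN1r addNr. Qed.
Lemma crossZ3 a x y z : cross x y (a *: z) = a *: cross x y z.
Proof. by rewrite -[a *: z]addr0 cross_linear3 cross03 addr0. Qed.
Lemma crossN3 x y z : cross x y (- z) = - cross x y z.
Proof. by rewrite -scaleN1r crossZ3 scaleN1r. Qed.
Lemma cross_xxz x z : cross x x z = 0.
Proof. by apply: row_eq_inner => w; rewrite crossP inner0l /ReOmega Omega_xxzw. Qed.
Lemma cross_xyy x y : cross x y y = 0.
Proof. by apply: row_eq_inner => w; rewrite crossP inner0l /ReOmega Omega_xyyw. Qed.
Lemma cross_xyx x y : cross x y x = 0.
Proof. by apply: row_eq_inner => w; rewrite crossP inner0l /ReOmega Omega_xyxw. Qed.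

Lemma zcoord_inner x y : inner x y = complex.Re (herm x y).
Proof. by rewrite hermE. Qed.

Definition of_zcoord (c : 'I_4 -> R[i]) : 'rV[R]_8 :=
  \row_k (if odd k then complex.Im (c (inord k./2)) else complex.Re (c (inord k./2))).

Lemma of_zcoordK c j : zcoord j (of_zcoord c) = c j.
Proof.
case: j => j j4.
have e1 : (j.*2 < 8)%N by have : (j.*2 < 4.*2)%N by rewrite ltn_double.
have e2 : (j.*2.+1 < 8)%N by have : (j.*2.+1 < 4.*2)%N by rewrite ltn_Sdouble.
rewrite /zcoord !mxE !inordK //= odd_double uphalf_double doubleK /=.
rewrite (_ : inord j = Ordinal j4); last by apply/val_inj; rewrite /= inordK.
by case: (c _).
Qed.

(** The real part of a complex linear form with coefficients m_j is dual, for the Euclidean metric,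
    to the vector with complex coordinates the conjugates of the m_j. *)
Lemma zcoord_cross j x y z : zcoord j (cross x y z) = conjc (minor j x y z).
Proof.
rewrite -(of_zcoordK (fun j => conjc (minor j x y z)) j); congr zcoord; symmetry.
apply: cross_unique => w; rewrite zcoord_inner /herm /ReOmega Omega_minor.
by congr complex.Re; apply: eq_bigr => k _; rewrite of_zcoordK conjcK.
Qed.

(* Cauchy-Binet for a 3 x 4 matrix and its conjugate *)
Lemma herm_cross x y z : herm (cross x y z) (cross x y z) =
  herm x x * (herm y y * herm z z - herm y z * herm z y)
  - herm x y * (herm y x * herm z z - herm y z * herm z x)
  + herm x z * (herm y x * herm z y - herm y y * herm z x).
Proof.
have cm p q r : conjc (minor3 p q r x y z) =
  conjc (zcoord p x) * (conjc (zcoord q y) * conjc (zcoord r z) - conjc (zcoord r y) * conjc (zcoord q z))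
  - conjc (zcoord q x) * (conjc (zcoord p y) * conjc (zcoord r z) - conjc (zcoord r y) * conjc (zcoord p z))
  + conjc (zcoord r x) * (conjc (zcoord p y) * conjc (zcoord q z) - conjc (zcoord q y) * conjc (zcoord p z)).
  by rewrite /minor3 !(rmorphB, rmorphD, rmorphM).
have cN (c : R[i]) : conjc (- c) = - conjc c by rewrite rmorphN.
rewrite /herm !sum4 !zcoord_cross !conjcK.
have -> : minor i0 x y z = - minor3 i1 i2 i3 x y z by [].
have -> : minor i1 x y z = minor3 i0 i2 i3 x y z by [].
have -> : minor i2 x y z = - minor3 i0 i1 i3 x y z by [].
have -> : minor i3 x y z = minor3 i0 i1 i2 x y z by [].
rewrite !cN !cm /minor3.
set a0 := zcoord i0 x; set a1 := zcoord i1 x; set a2 := zcoord i2 x; set a3 := zcoord i3 x.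
set b0 := zcoord i0 y; set b1 := zcoord i1 y; set b2 := zcoord i2 y; set b3 := zcoord i3 y.
set c0 := zcoord i0 z; set c1 := zcoord i1 z; set c2 := zcoord i2 z; set c3 := zcoord i3 z.
ring.
Qed.

(** For real orthogonal vectors the off-diagonal Hermitian products are purely imaginary, so the two
    triple products in the Gram determinant cancel. The negative squares left over are the defect
    that forces isotropy of special Lagrangian planes. *)
Lemma cross_norm x y z : inner x y = 0 -> inner x z = 0 -> inner y z = 0 ->
  inner (cross x y z) (cross x y z) =
    inner x x * inner y y * inner z z - inner x x * omega y z ^+ 2
    - inner y y * omega x z ^+ 2 - inner z z * omega x y ^+ 2.
Proof.
move=> xy xz yz; rewrite [LHS]zcoord_inner herm_cross !hermE.
have osw u v : omega v u = - omega u v.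
  by rewrite !omegaE -sumrN; apply: eq_bigr => k _; ring.
have o0 u : omega u u = 0 by apply: oppr_self0; exact: osw.
rewrite (innerC y x) (innerC z x) (innerC z y) xy xz yz.
rewrite (osw x y) (osw x z) (osw y z) !o0; simpc => /=; ring.
Qed.

End ComplexCoordinates.

Section Omega2.
Context {R : realType}.
Implicit Types (x y z w u v : 'rV[R]_8) (a b : R).

Lemma omega_antisym x y : omega y x = - omega x y.
Proof. by rewrite !omegaE -sumrN; apply: eq_bigr => k _; ring. Qed.
Lemma omega_xx x : omega x x = 0.
Proof. by apply: oppr_self0; exact: omega_antisym. Qed.
Lemma omegaDr x y z : omega x (y + z) = omega x y + omega x z.
Proof. by rewrite !omega_ci innerDr. Qed.
Lemma omegaZr a x z : omega x (a *: z) = a * omega x z.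
Proof. by rewrite !omega_ci innerZr. Qed.
Lemma omegaNr x z : omega x (- z) = - omega x z.
Proof. by rewrite !omega_ci innerNr. Qed.
Lemma omegaDl x y z : omega (y + z) x = omega y x + omega z x.
Proof. by rewrite !(omega_antisym x) omegaDr opprD. Qed.
Lemma omegaZl a x z : omega (a *: z) x = a * omega z x.
Proof. by rewrite !(omega_antisym x) omegaZr mulrN. Qed.
Lemma omegaNl x z : omega (- z) x = - omega z x.
Proof. by rewrite !(omega_antisym x) omegaNr. Qed.
Definition omegaLE := (omegaDr, omegaZr, omegaNr, omegaDl, omegaZl, omegaNl).

End Omega2.

(* [hor p q z]: z is orthogonal, for the Hermitian product, to p and q *)
Definition hor (R : realType) (p q z : 'rV[R]_8) : Prop :=
  [/\ inner p z = 0, inner q z = 0, omega p z = 0 & omega q z = 0].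

Section CrossStructure.
Context {R : realType}.
Implicit Types (x y z w u v : 'rV[R]_8) (a b : R).
Variables p q : 'rV[R]_8.
Hypotheses (pp : inner p p = 1) (qq : inner q q = 1) (pq : inner p q = 0).
Local Notation J := (cross p q).

Definition bar z : 'rV[R]_8 := z - inner p z *: p - inner q z *: q.

Lemma bar_def z : bar z = z - inner p z *: p - inner q z *: q.
Proof. by []. Qed.

Lemma inner_p_bar z : inner p (bar z) = 0.
Proof. by rewrite /bar !innerE pp pq; ring. Qed.
Lemma inner_q_bar z : inner q (bar z) = 0.
Proof. by rewrite /bar !innerE qq (innerC q p) pq; ring. Qed.
Lemma barD z w : bar (z + w) = bar z + bar w.
Proof. by rewrite /bar !innerE !scalerDl !opprD !addrA; apply/rowP => k; rewrite !mxE; ring. Qed.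
Lemma barZ a z : bar (a *: z) = a *: bar z.
Proof. by rewrite /bar !innerE; apply/rowP => k; rewrite !mxE; ring. Qed.
Lemma bar_p : bar p = 0.
Proof. by rewrite /bar pp (innerC q p) pq scale1r scale0r subr0 subrr. Qed.
Lemma bar_q : bar q = 0.
Proof. by rewrite /bar qq pq scale1r scale0r subr0 subrr. Qed.
Lemma barE z : z = bar z + inner p z *: p + inner q z *: q.
Proof. by rewrite /bar; apply/rowP => k; rewrite !mxE; ring. Qed.

Lemma cross_bar z : J (bar z) = J z.
Proof.
by rewrite /bar !crossD3 !crossN3 !crossZ3 cross_xyx cross_xyy !scaler0 oppr0 !addr0.
Qed.

Lemma cross_hor z : hor p q (J z).
Proof.
split; rewrite ?omega_ci innerC crossP /ReOmega ?Omega_ci4 ?Omega_xyzx ?Omega_xyzy ?mulr0 //.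
Qed.

Lemma bar_cross z : bar (J z) = J z.
Proof. by have [h1 h2 _ _] := cross_hor z; rewrite /bar h1 h2 !scale0r !subr0. Qed.

Lemma cross_skew z w : inner (J z) w = - inner z (J w).
Proof. by rewrite crossP (innerC z) crossP ReOmega_swap34. Qed.

Lemma cross_perp z : inner z (J z) = 0.
Proof. by apply: oppr_self0; rewrite -cross_skew innerC. Qed.

Lemma omega_cross_self z : omega z (J z) = 0.
Proof. by rewrite omega_ci innerC crossP /ReOmega Omega_ci4 Omega_xyzz mulr0. Qed.

Lemma horD z w : hor p q z -> hor p q w -> hor p q (z + w).
Proof. by move=> [a1 a2 a3 a4] [b1 b2 b3 b4]; split; rewrite !(innerE, omegaLE) ?a1 ?a2 ?a3 ?a4 ?b1 ?b2 ?b3 ?b4 addr0. Qed.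
Lemma horZ a z : hor p q z -> hor p q (a *: z).
Proof. by move=> [a1 a2 a3 a4]; split; rewrite !(innerE, omegaLE) ?a1 ?a2 ?a3 ?a4 mulr0. Qed.

Hypothesis wpq : omega p q = 0.

Lemma bar_hor z : omega p z = 0 -> omega q z = 0 -> hor p q (bar z).
Proof.
move=> wp wq; split; [exact: inner_p_bar|exact: inner_q_bar| |];
  rewrite /bar !omegaLE ?wp ?wq ?omega_xx ?wpq ?(omega_antisym p q) ?wpq; ring.
Qed.

Lemma cross_norm_hor z : hor p q z -> inner (J z) (J z) = inner z z.
Proof.
move=> [h1 h2 h3 h4]; rewrite cross_norm // pp qq wpq h3 h4; ring.
Qed.

(** Polarization of [cross_norm_hor]. *)
Lemma cross_isometry z w : hor p q z -> hor p q w -> inner (J z) (J w) = inner z w.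
Proof.
move=> hz hw; have := cross_norm_hor (horD hz hw).
rewrite crossD3 !innerE !cross_norm_hor // (innerC (J w)) (innerC w).
set A := inner _ _; set B := inner z w; set C := inner z z; set D := inner w w => h.
by lra.
Qed.

(** J is skew and isometric on the complex orthogonal of p and q, hence J (J z) + z is orthogonal to
    itself. *)
Lemma cross_cross z : hor p q z -> J (J z) = - z.
Proof.
move=> hz; have hJJ := cross_hor (J z).
have hs : hor p q (J (J z) + z) by exact: horD.
apply/eqP; rewrite -subr_eq0 opprK; apply/eqP; apply: inner_eq0.
rewrite innerDl cross_skew -[X in _ + X](cross_isometry hz hs).
by rewrite addrC subrr.
Qed.

(* Equality in Cauchy-Schwarz: both vectors have norm |v|^2. *)
Lemma cross_Jv_q v : hor p q v -> cross (J v) q v = - inner v v *: p.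
Proof.
move=> hv; have [h1 h2 h3 h4] := hv; have [k1 k2 k3 k4] := cross_hor v.
have N : inner (cross (J v) q v) (cross (J v) q v) = inner v v ^+ 2.
  rewrite cross_norm ?(innerC _ q) // 1?(innerC _ v) ?cross_perp //.
  rewrite (omega_antisym v (J v)) omega_cross_self (omega_antisym q (J v)) k4 h4 qq cross_norm_hor //; ring.
have I : inner (cross (J v) q v) p = - inner v v.
  by rewrite crossP ReOmega_swap14 -crossP cross_norm_hor.
apply/eqP; rewrite -subr_eq0; apply/eqP; apply: inner_eq0.
by rewrite scaleNr opprK !innerE N (innerC p) I pp; ring.
Qed.

Lemma cross_p_Jv v : hor p q v -> cross p (J v) v = - inner v v *: q.
Proof.
move=> hv; have [h1 h2 h3 h4] := hv; have [k1 k2 k3 k4] := cross_hor v.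
have N : inner (cross p (J v) v) (cross p (J v) v) = inner v v ^+ 2.
  rewrite cross_norm // 1?(innerC _ v) ?cross_perp //.
  rewrite (omega_antisym v (J v)) omega_cross_self k3 h3 pp cross_norm_hor //; ring.
have I : inner (cross p (J v) v) q = - inner v v.
  by rewrite crossP ReOmega_swap24 -crossP cross_norm_hor.
apply/eqP; rewrite -subr_eq0; apply/eqP; apply: inner_eq0.
by rewrite scaleNr opprK !innerE N (innerC q) I qq; ring.
Qed.

End CrossStructure.

(** * Special Lagrangian 4-planes spanned by four vectors *)

Section Planes.
Context {R : realType}.
Implicit Types (x y z w u v : 'rV[R]_8) (a b : R).

Definition rows4 x y z w : 'M[R]_(4, 8) := \matrix_i quad x y z w i.

Lemma row_rows4 x y z w i : row i (rows4 x y z w) = quad x y z w i.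
Proof. exact: rowK. Qed.

Lemma Omega_rows4 x y z w : Omega (fun i => row i (rows4 x y z w)) = Omega (quad x y z w).
Proof. by congr Omega; apply/funext => i; rewrite row_rows4. Qed.

Lemma mulmx_trE m n (A : 'M[R]_(m, 8)) (B : 'M[R]_(n, 8)) i j :
  (A *m B^T) i j = inner (row i A) (row j B).
Proof. by rewrite mxE; apply: eq_bigr => k _; rewrite !mxE. Qed.

Lemma quadE x y z w : [/\ quad x y z w (@Ordinal 4 0 isT) = x,
  quad x y z w (@Ordinal 4 1 isT) = y, quad x y z w (@Ordinal 4 2 isT) = z &
  quad x y z w (@Ordinal 4 3 isT) = w].
Proof. by rewrite /quad !(tnth_nth 0). Qed.

Lemma ord4_ind (P : 'I_4 -> Prop) : P (@Ordinal 4 0 isT) -> P (@Ordinal 4 1 isT) ->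
  P (@Ordinal 4 2 isT) -> P (@Ordinal 4 3 isT) -> forall i, P i.
Proof.
by move=> p0 p1 p2 p3 [[|[|[|[|]]]] hi] //;
  [move: p0|move: p1|move: p2|move: p3]; congr P; apply/val_inj.
Qed.

Lemma sub_rows4P v x y z w : reflect
  (exists c : 'rV[R]_4, v = c 0 (@Ordinal 4 0 isT) *: x + c 0 (@Ordinal 4 1 isT) *: y
    + c 0 (@Ordinal 4 2 isT) *: z + c 0 (@Ordinal 4 3 isT) *: w)
  (v <= rows4 x y z w)%MS.
Proof.
have [q0 q1 q2 q3] := quadE x y z w.
have E (c : 'rV[R]_4) : c *m rows4 x y z w = c 0 (@Ordinal 4 0 isT) *: x + c 0 (@Ordinal 4 1 isT) *: y
    + c 0 (@Ordinal 4 2 isT) *: z + c 0 (@Ordinal 4 3 isT) *: w.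
  by rewrite mulmx_sum_row sum4 !row_rows4 q0 q1 q2 q3.
apply: (iffP submxP) => [[c ->]|[c ->]]; exists c; by rewrite E.
Qed.

Lemma sub_rows4 (a b c d : R) x y z w :
  ((a *: x + b *: y + c *: z + d *: w)%R <= rows4 x y z w)%MS.
Proof.
by apply/sub_rows4P; exists (\row_i nth 0 [:: a; b; c; d] i); rewrite !mxE /=.
Qed.

Lemma rows4_subP x y z w m (E : 'M[R]_(m, 8)) :
  (rows4 x y z w <= E)%MS = [&& (x <= E)%MS, (y <= E)%MS, (z <= E)%MS & (w <= E)%MS].
Proof.
have [q0 q1 q2 q3] := quadE x y z w.
apply/row_subP/and4P => [h|[h0 h1 h2 h3]].
  by split; [rewrite -q0|rewrite -q1|rewrite -q2|rewrite -q3]; rewrite -row_rows4.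
by apply: ord4_ind; rewrite row_rows4 ?q0 ?q1 ?q2 ?q3.
Qed.

Lemma mem_rows4 x y z w : [&& (x <= rows4 x y z w)%MS, (y <= rows4 x y z w)%MS,
  (z <= rows4 x y z w)%MS & (w <= rows4 x y z w)%MS].
Proof. by rewrite -rows4_subP submx_refl. Qed.

Lemma gram4 x y z w : rows4 x y z w *m (rows4 x y z w)^T
  = \matrix_(i, j) inner (quad x y z w i) (quad x y z w j).
Proof. by apply/matrixP => i j; rewrite mulmx_trE !row_rows4 mxE. Qed.

Lemma det_gram4 x y z w : inner x y = 0 -> inner x z = 0 -> inner y z = 0 ->
  inner x w = 0 -> inner y w = 0 -> inner z w = 0 ->
  \det (rows4 x y z w *m (rows4 x y z w)^T)
    = inner x x * inner y y * inner z z * inner w w.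
Proof.
move=> xy xz yz xw yw zw; have [q0 q1 q2 q3] := quadE x y z w.
rewrite gram4 (det4 (fun i j => inner (quad x y z w i) (quad x y z w j))).
rewrite q0 q1 q2 q3 (innerC y x) (innerC z x) (innerC w x) (innerC z y) (innerC w y) (innerC w z).
by rewrite xy xz yz xw yw zw; ring.
Qed.

Lemma rows4_free x y z w : inner x y = 0 -> inner x z = 0 -> inner y z = 0 ->
  inner x w = 0 -> inner y w = 0 -> inner z w = 0 ->
  x != 0 -> y != 0 -> z != 0 -> w != 0 -> row_free (rows4 x y z w).
Proof.
move=> xy xz yz xw yw zw x0 y0 z0 w0.
have D : \det (rows4 x y z w *m (rows4 x y z w)^T) != 0.
  by rewrite det_gram4 // !mulf_neq0 // gt_eqF // inner_gt0.
rewrite /row_free eqn_leq rank_leq_row /=.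
have : row_free (rows4 x y z w *m (rows4 x y z w)^T).
  by rewrite row_free_unit unitmxE unitfE.
by rewrite /row_free => /eqP r; apply: leq_trans (mxrankM_maxl _ (rows4 x y z w)^T); rewrite r.
Qed.

Lemma Omega_mul (B : 'M[R]_4) (v : 'M[R]_(4, 8)) :
  Omega (fun i => row i (B *m v)) = (\det B)%:C%C * Omega (fun i => row i v).
Proof.
rewrite /Omega.
have -> : \matrix_(i < 4, j < 4) zcoord j (row i (B *m v))
  = map_mx (real_complex R) B *m \matrix_(i < 4, j < 4) zcoord j (row i v).
  apply/matrixP => i j; rewrite !mxE.
  transitivity (\sum_k zcoord j (B i k *: row k v)); last first.
    by apply: eq_bigr => k _; rewrite !mxE zcoordZ.
  rewrite row_mul mulmx_sum_row.
  elim/big_rec2: _ => [|k s t _ <-]; last by rewrite zcoordD mxE.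
  by rewrite /zcoord !mxE.
by rewrite det_mulmx det_map_mx.
Qed.

(* A 4-form on a 4-plane is determined by its value on one orthonormal basis. *)
Lemma calibrated (E : 'M[R]_(4, 8)) : E *m E^T = 1%:M ->
  complex.Re (Omega (fun i => row i E)) = 1 ->
  forall v : 'M[R]_(4, 8), (v <= E)%MS ->
    complex.Re (Omega (fun i => row i v)) = \det (v *m E^T).
Proof.
move=> EE E1 v /submxP[B ->].
by rewrite Omega_mul Re_realM E1 mulr1 -mulmxA EE mulmx1.
Qed.

Lemma sub_orthonormal_proj (E : 'M[R]_(4, 8)) m (v : 'M[R]_(m, 8)) :
  E *m E^T = 1%:M -> (v <= E)%MS -> v *m E^T *m E = v.
Proof. by move=> EE /submxP[B ->]; rewrite -(mulmxA B) EE mulmx1. Qed.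

Lemma innerM x y : inner x y = (x *m y^T) 0 0.
Proof. by rewrite mulmx_trE !row_id. Qed.

Lemma inner_proj (E : 'M[R]_(4, 8)) c w : E *m E^T = 1%:M -> (w <= E)%MS ->
  inner (c *m E^T *m E) w = inner c w.
Proof.
move=> EE wE; rewrite !innerM -[in RHS](sub_orthonormal_proj EE wE).
by rewrite !trmx_mul trmxK !mulmxA.
Qed.

Section SLPlane.
Variables (E : 'M[R]_(4, 8)) (p q : 'rV[R]_8).
Hypotheses (EE : E *m E^T = 1%:M).
Hypothesis cal : forall v : 'M[R]_(4, 8), (v <= E)%MS ->
  complex.Re (Omega (fun i => row i v)) = \det (v *m E^T).
Hypotheses (pp : inner p p = 1) (qq : inner q q = 1) (pq : inner p q = 0).

(** Let c = J a' and let c' be its projection to E. Calibration gives |c'| = |a'|, whereas |c'| <=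
    |c| <= |a'| in general. Equality throughout kills the omega terms in [cross_norm] and puts c in
    E. *)
Lemma sl_plane_half (a b : 'rV[R]_8) : (rows4 p q a b :=: E)%MS ->
  [/\ omega p q = 0, omega p a = 0, omega q a = 0, bar p q a != 0 &
      (cross p q a <= E)%MS].
Proof.
move=> TE; have : (rows4 p q a b <= E)%MS by rewrite TE.
rewrite rows4_subP => /and4P[pE qE aE bE].
set a' := bar p q a; set c := cross p q a'.
have a'E : (a' <= E)%MS.
  by rewrite /a' /bar -!scaleNr !addmx_sub // scalemx_sub.
have rkE : row_free E by apply/row_freeP; exists E^T.
pose c' := c *m E^T *m E.
have c'E : (c' <= E)%MS by rewrite submxMl.
have pa' : inner p a' = 0 by exact: inner_p_bar.
have qa' : inner q a' = 0 by exact: inner_q_bar.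
have cO w : inner c w = ReOmega p q a' w by exact: crossP.
have c'O w : (w <= E)%MS -> inner c' w = ReOmega p q a' w.
  by move=> wE; rewrite inner_proj // cO.
have pc' : inner p c' = 0 by rewrite innerC c'O // /ReOmega Omega_xyzx.
have qc' : inner q c' = 0 by rewrite innerC c'O // /ReOmega Omega_xyzy.
have ac' : inner a' c' = 0 by rewrite innerC c'O // /ReOmega Omega_xyzz.
have calr w : (w <= E)%MS -> ReOmega p q a' w = \det (rows4 p q a' w *m E^T).
  by move=> wE; rewrite -cal ?Omega_rows4 // rows4_subP pE qE a'E wE.
(* The vectors p, q, a', c' are orthogonal and lie in E. Re Omega takes the value |c'|^2 on them,
   and its square is their Gram determinant. *)
have sq : inner c' c' ^+ 2 = inner a' a' * inner c' c'.
  have AE : (rows4 p q a' c' <= E)%MS by rewrite rows4_subP pE qE a'E c'E.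
  rewrite (c'O _ c'E) [in LHS]calr // expr2 -{2}det_tr -det_mulmx trmx_mul trmxK mulmxA.
  by rewrite (sub_orthonormal_proj EE AE) det_gram4 // pp qq !mul1r -(c'O _ c'E).
(* Re Omega is a volume form on E and p, q, a, b is a basis of E; this rules out c' = 0. *)
have c'b : ReOmega p q a' b != 0.
  have -> : ReOmega p q a' b = ReOmega p q a b.
    by rewrite -!crossP /a' cross_bar.
  rewrite /ReOmega -Omega_rows4 cal ?TE //.
  rewrite -unitfE -unitmxE -row_free_unit /row_free.
  have e : rows4 p q a b *m E^T *m E = rows4 p q a b by apply: sub_orthonormal_proj; rewrite ?TE.
  rewrite eqn_leq rank_leq_row /=; apply: (@leq_trans (\rank (rows4 p q a b))).
    by rewrite TE (eqP rkE).
  by rewrite -{1}e mxrankM_maxl.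
have c'0 : c' != 0.
  by apply: contra c'b => /eqP z; rewrite -c'O // z inner0l.
have nc' : inner c' c' = inner a' a'.
  have n0 : inner c' c' != 0 by rewrite gt_eqF // inner_gt0.
  by apply: (mulIf n0); rewrite -sq expr2.
have a'0 : a' != 0.
  by apply: contra c'0 => /eqP z; apply/eqP; apply: inner_eq0; rewrite nc' z inner0l.
have := cross_norm pq pa' qa'; rewrite -/c pp qq !mul1r => nc.
have pyth : inner c c = inner c' c' + inner (c - c') (c - c').
  rewrite !innerE (innerC c c'); have -> : inner c' c = inner c' c'.
    by rewrite innerC -(inner_proj c EE c'E).
  ring.
have d0 := inner_ge0 (c - c'); have na0 := inner_gt0 a'0.
have s1 := sqr_ge0 (omega q a'); have s2 := sqr_ge0 (omega p a').
have s3 : 0 <= inner a' a' * omega p q ^+ 2 by rewrite mulr_ge0 ?sqr_ge0 ?inner_ge0.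
have z1 : omega q a' ^+ 2 = 0 by lra.
have z2 : omega p a' ^+ 2 = 0 by lra.
have z3 : inner a' a' * omega p q ^+ 2 = 0 by lra.
have z4 : inner (c - c') (c - c') = 0 by lra.
have wpq : omega p q = 0.
  by move/eqP: z3; rewrite mulf_eq0 gt_eqF //= sqrf_eq0 => /eqP.
have wpa' : omega p a' = 0 by apply/eqP; rewrite -sqrf_eq0 z2.
have wqa' : omega q a' = 0 by apply/eqP; rewrite -sqrf_eq0 z1.
have cE : c = c' by apply/eqP; rewrite -subr_eq0; apply/eqP; exact: inner_eq0.
split=> //.
- by rewrite (barE p q a) (omegaDr _ (bar p q a + _)) (omegaDr _ (bar p q a)) !omegaZr -/a' wpa' omega_xx wpq !mulr0 !addr0.
- by rewrite (barE p q a) (omegaDr _ (bar p q a + _)) (omegaDr _ (bar p q a)) !omegaZr -/a' wqa' omega_xx (omega_antisym p q) wpq oppr0 !mulr0 !addr0.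
- by rewrite -cross_bar -/a' -/c cE.
Qed.

Lemma rows4_swap34 x y z w : (rows4 x y w z :=: rows4 x y z w)%MS.
Proof.
apply/eqmxP; have /and4P[m0 m1 m2 m3] := mem_rows4 x y z w.
by have /and4P[n0 n1 n2 n3] := mem_rows4 x y w z; rewrite !rows4_subP m0 m1 m2 m3 n0 n1 n2 n3.
Qed.

(** The half statement is used for (a, b) and for (b, a). By dimension E is spanned by p, q, a' and
    J a', so b' is a combination of the last two. Multiplying by |a'|^2 keeps the relation
    polynomial, so that it can later be extended across singular points. *)
Lemma sl_plane (a b : 'rV[R]_8) : (rows4 p q a b :=: E)%MS ->
  [/\ omega p q = 0, omega p a = 0 /\ omega q a = 0, omega p b = 0 /\ omega q b = 0,
      bar p q a != 0 &
      inner (bar p q a) (bar p q a) *: bar p q b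
      = inner (bar p q b) (bar p q a) *: bar p q a
      + inner (bar p q b) (cross p q (bar p q a)) *: cross p q (bar p q a)].
Proof.
move=> TE; have [wpq wpa wqa a0 cE] := sl_plane_half TE.
have [_ wpb wqb _ _] := sl_plane_half (eqmx_trans (rows4_swap34 p q a b) TE).
split=> //; set a' := bar p q a; set b' := bar p q b; set c := cross p q a'.
have : (rows4 p q a b <= E)%MS by rewrite TE.
rewrite rows4_subP => /and4P[pE qE aE bE].
have ha : hor p q a' by exact: bar_hor.
have [h1 h2 _ _] : hor p q c := cross_hor p q a'; have [k1 k2 _ _] := ha.
have nc : inner c c = inner a' a' by exact: cross_norm_hor.
have p0 : p != 0 by apply/eqP => z; move: pp; rewrite z inner0l => /eqP; rewrite eq_sym oner_eq0.
have q0 : q != 0 by apply/eqP => z; move: qq; rewrite z inner0l => /eqP; rewrite eq_sym oner_eq0.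
have c0 : c != 0.
  apply: contra a0 => /eqP z; apply/eqP; apply: inner_eq0.
  by rewrite -/a' -nc z inner0l.
have F : row_free (rows4 p q a' c).
  by apply: rows4_free => //; exact: cross_perp.
have BE : (rows4 p q a' c <= E)%MS.
  rewrite rows4_subP pE qE /= {1}/a' /bar -!scaleNr !addmx_sub ?scalemx_sub //=.
  by rewrite /c /a' cross_bar.
have rk : \rank E = 4.
  by apply/eqP; apply/row_freeP; exists E^T.
have EB : (E <= rows4 p q a' c)%MS by rewrite -(mxrank_leqif_sup BE) (eqP F) rk.
have b'E : (b' <= rows4 p q a' c)%MS.
  apply: submx_trans EB; rewrite /b' /bar -!scaleNr !addmx_sub ?scalemx_sub //.
have /sub_rows4P[d] := b'E.
set d0 := d 0 _; set d1 := d 0 _; set d2 := d 0 _; set d3 := d 0 _ => e.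
have pb' : inner p b' = 0 by exact: inner_p_bar.
have qb' : inner q b' = 0 by exact: inner_q_bar.
have ac : inner a' c = 0 by exact: cross_perp.
clearbody c b'; clear cE ha a0 BE; clearbody a'.
have e0 : d0 = 0.
  by move: pb'; rewrite e !innerE pp pq k1 h1 !mulr0 !addr0 mulr1.
have e1 : d1 = 0.
  by move: qb'; rewrite e !innerE qq (innerC q) pq k2 h2 !mulr0 !addr0 mulr1 add0r.
move: e; rewrite e0 e1 !scale0r !add0r => e.
rewrite e !innerE (innerC c a') ac nc !mulr0 addr0 add0r.
by rewrite scalerDr !scalerA; congr (_ *: _ + _ *: _); ring.
Qed.

End SLPlane.
End Planes.

(** * Calculus on surfaces *)

Section VectorCalculus.
Context {R : realType}.

Lemma differentiable_rV (V : normedModType R) m (F : V -> 'rV[R]_m) x :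
  (forall k, differentiable (fun z => F z 0 k) x) -> differentiable F x.
Proof.
move=> Fx; have -> : F = \sum_(k < m) (fun z => F z 0 k *: (delta_mx 0 k : 'rV[R]_m)).
  by apply/funext => z; rewrite fct_sumE {1}(row_sum_delta (F z)).
by apply: differentiable_sum => k; apply: differentiableZl.
Qed.

Implicit Types (F G : 'rV[R]_2 -> 'rV[R]_8) (y : 'rV[R]_2).

Definition vd m (i : 'I_2) (F : 'rV[R]_2 -> 'rV[R]_m) y : 'rV[R]_m := 'D_(delta_mx 0 i) F y.

Lemma vdef m i (F : 'rV[R]_2 -> 'rV[R]_m) y : vd i F y = 'D_(delta_mx 0 i) F y.
Proof. by []. Qed.

Lemma vdE m i (F : 'rV[R]_2 -> 'rV[R]_m) y k : vanalytic_at F y ->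
  vd i F y 0 k = pd i (fun z => F z 0 k) y.
Proof.
move=> Fy; rewrite /vd derive_mx ?mxE //.
by apply: diff_derivable; exact: vanalytic_differentiable.
Qed.

Lemma vanalytic_near m (F : 'rV[R]_2 -> 'rV[R]_m) y :
  vanalytic_at F y -> \forall z \near y, vanalytic_at F z.
Proof.
move=> Fy; have H : \forall z \near y, forall k, analytic_at (fun w => F w 0 k) z.
  apply: (@filter_forall _ _ _ (nbhs y) _) => k; exact: analytic_at_near (Fy k).
by apply: filterS H => z h k; exact: h.
Qed.

Lemma vanalytic_vd m i (F : 'rV[R]_2 -> 'rV[R]_m) y :
  vanalytic_at F y -> vanalytic_at (vd i F) y.
Proof.
move=> Fy k; apply: (@analytic_near_eq _ (pd i (fun z => F z 0 k))).
  by apply: filterS (vanalytic_near Fy) => z Fz; rewrite vdE.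
exact: analytic_pd.
Qed.

Lemma vanalyticD m (F G : 'rV[R]_2 -> 'rV[R]_m) y :
  vanalytic_at F y -> vanalytic_at G y -> vanalytic_at (fun z => F z + G z) y.
Proof.
move=> Fy Gy k; apply: (@analytic_eq _ (fun z => F z 0 k + G z 0 k)).
  by move=> z; rewrite mxE.
exact: analyticD.
Qed.

Lemma vanalyticZ m (a : 'rV[R]_2 -> R) (F : 'rV[R]_2 -> 'rV[R]_m) y :
  analytic_at a y -> vanalytic_at F y -> vanalytic_at (fun z => a z *: F z) y.
Proof.
move=> ay Fy k; apply: (@analytic_eq _ (fun z => a z * F z 0 k)).
  by move=> z; rewrite mxE.
exact: analyticM.
Qed.

Lemma vanalytic_cst m (v : 'rV[R]_m) y : vanalytic_at (fun=> v) y.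
Proof. by move=> k; exact: analytic_cst. Qed.

Lemma vanalyticN m (F : 'rV[R]_2 -> 'rV[R]_m) y :
  vanalytic_at F y -> vanalytic_at (fun z => - F z) y.
Proof.
move=> Fy k; apply: (@analytic_eq _ (fun z => - F z 0 k)).
  by move=> z; rewrite mxE.
exact: analyticN.
Qed.

Lemma vanalyticB m (F G : 'rV[R]_2 -> 'rV[R]_m) y :
  vanalytic_at F y -> vanalytic_at G y -> vanalytic_at (fun z => F z - G z) y.
Proof. by move=> Fy Gy; apply: vanalyticD => //; exact: vanalyticN. Qed.

Lemma vdD m i (F G : 'rV[R]_2 -> 'rV[R]_m) y : vanalytic_at F y -> vanalytic_at G y ->
  vd i (fun z => F z + G z) y = vd i F y + vd i G y.
Proof.
move=> Fy Gy; apply/rowP => k; rewrite mxE !vdE //; last exact: vanalyticD.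
rewrite -pdD //; congr (pd i _ y); apply/funext => z; by rewrite mxE.
Qed.

Lemma vdZ m i (a : 'rV[R]_2 -> R) (F : 'rV[R]_2 -> 'rV[R]_m) y :
  analytic_at a y -> vanalytic_at F y ->
  vd i (fun z => a z *: F z) y = pd i a y *: F y + a y *: vd i F y.
Proof.
move=> ay Fy; apply/rowP => k; rewrite !mxE !vdE //; last exact: vanalyticZ.
rewrite -pdM //; congr (pd i _ y); apply/funext => z; by rewrite mxE.
Qed.

Lemma vd_cst m i (v : 'rV[R]_m) y : vd i (fun=> v) y = 0.
Proof. by rewrite /vd derive_cst. Qed.

Lemma vdcZ m i (a : R) (F : 'rV[R]_2 -> 'rV[R]_m) y : vanalytic_at F y ->
  vd i (fun z => a *: F z) y = a *: vd i F y.
Proof. by move=> Fy; rewrite vdZ ?pd_cst ?scale0r ?add0r //; exact: analytic_cst. Qed.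

Lemma near_eq_vd m i (F G : 'rV[R]_2 -> 'rV[R]_m) y :
  (\forall z \near y, F z = G z) -> vd i F y = vd i G y.
Proof. exact: near_eq_derive. Qed.

#[local] Opaque vd.

Lemma vd_comm m (F : 'rV[R]_2 -> 'rV[R]_m) y : vanalytic_at F y ->
  vd 0 (vd 1 F) y = vd 1 (vd 0 F) y.
Proof.
move=> Fy; apply/rowP => k.
transitivity (pd 0 (fun z => vd 1 F z 0 k) y); first exact: vdE (vanalytic_vd 1 Fy).
transitivity (pd 1 (fun z => vd 0 F z 0 k) y); last by symmetry; exact: vdE (vanalytic_vd 0 Fy).
rewrite (@near_eq_pd _ 0 _ (pd 1 (fun z => F z 0 k))); last first.
  by apply: filterS (vanalytic_near Fy) => z Fz; rewrite vdE.
rewrite [RHS](@near_eq_pd _ 1 _ (pd 0 (fun z => F z 0 k))); last first.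
  by apply: filterS (vanalytic_near Fy) => z Fz; rewrite vdE.
exact: pdC.
Qed.

(** Expansion in the standard basis reduces the claim to products of coordinates. It is applied to
    the metric, to omega, and to the two middle slots of Re Omega. *)
Lemma bilinear_analytic (B : 'rV[R]_8 -> 'rV[R]_8 -> R) F G y :
  (forall a u v w, B (a *: u + v) w = a * B u w + B v w) ->
  (forall a u v w, B w (a *: u + v) = a * B w u + B w v) ->
  vanalytic_at F y -> vanalytic_at G y ->
  analytic_at (fun z => B (F z) (G z)) y /\
  forall i, pd i (fun z => B (F z) (G z)) y = B (vd i F y) (G y) + B (F y) (vd i G y).
Proof.
move=> Bl Br Fy Gy.
have Bl0 w : B 0 w = 0 by have := Bl (-1) 0 0 w; rewrite scaler0 addr0 mulN1r addNr.
have Br0 w : B w 0 = 0 by have := Br (-1) 0 0 w; rewrite scaler0 addr0 mulN1r addNr.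
have Bsl (f : 'I_8 -> R) (v : 'I_8 -> 'rV[R]_8) w :
    B (\sum_k f k *: v k) w = \sum_k f k * B (v k) w.
  by elim/big_rec2: _ => [|k r s _ <-]; rewrite ?Bl0 ?Bl.
have Bsr (f : 'I_8 -> R) (v : 'I_8 -> 'rV[R]_8) w :
    B w (\sum_k f k *: v k) = \sum_k f k * B w (v k).
  by elim/big_rec2: _ => [|k r s _ <-]; rewrite ?Br0 ?Br.
pose e k : 'rV[R]_8 := delta_mx 0 k.
have E u v : B u v = \sum_k \sum_l (u 0 k * v 0 l) * B (e k) (e l).
  rewrite {1}(row_sum_delta u) Bsl; apply: eq_bigr => k _.
  rewrite {1}(row_sum_delta v) Bsr mulr_sumr; apply: eq_bigr => l _; by rewrite mulrA.
have t k l : analytic_at (fun z => F z 0 k * G z 0 l) y by apply: analyticM.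
have tB k l : analytic_at (fun z => (F z 0 k * G z 0 l) * B (e k) (e l)) y.
  by apply: analyticM => //; exact: analytic_cst.
have sB k : analytic_at (fun z => \sum_l (F z 0 k * G z 0 l) * B (e k) (e l)) y.
  exact: analytic_sum.
have EE : (fun z => B (F z) (G z))
    = (fun z => \sum_k \sum_l (F z 0 k * G z 0 l) * B (e k) (e l)).
  by apply/funext => z; exact: E.
rewrite EE; split; first exact: analytic_sum.
move=> i; rewrite pd_sum // (E (vd i F y)) (E (F y) (vd i G y)) -big_split /=.
apply: eq_bigr => k _; rewrite pd_sum // -big_split /=; apply: eq_bigr => l _.
rewrite pdM // ?pd_cst ?mulr0 ?addr0; last exact: analytic_cst.
by rewrite pdM // -!vdE // mulrDl.
Qed.

Lemma inner_analytic F G y : vanalytic_at F y -> vanalytic_at G y ->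
  analytic_at (fun z => inner (F z) (G z)) y.
Proof.
move=> Fy Gy; have [//||h _] := @bilinear_analytic (@inner R) F G y _ _ Fy Gy => //.
  by move=> a u v w; rewrite innerDl innerZl.
by move=> a u v w; rewrite innerDr innerZr.
Qed.

Lemma pd_inner i F G y : vanalytic_at F y -> vanalytic_at G y ->
  pd i (fun z => inner (F z) (G z)) y = inner (vd i F y) (G y) + inner (F y) (vd i G y).
Proof.
move=> Fy Gy; have [//||_ h] := @bilinear_analytic (@inner R) F G y _ _ Fy Gy => //.
  by move=> a u v w; rewrite innerDl innerZl.
by move=> a u v w; rewrite innerDr innerZr.
Qed.

Lemma pd_omega i F G y : vanalytic_at F y -> vanalytic_at G y ->
  pd i (fun z => omega (F z) (G z)) y = omega (vd i F y) (G y) + omega (F y) (vd i G y).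
Proof.
move=> Fy Gy; have [//||_ h] := @bilinear_analytic (@omega R) F G y _ _ Fy Gy => //.
  by move=> a u v w; rewrite omegaDl omegaZl.
by move=> a u v w; rewrite omegaDr omegaZr.
Qed.

Lemma cross_leibniz F G H y : vanalytic_at F y -> vanalytic_at G y -> vanalytic_at H y ->
  vanalytic_at (fun z => cross (F z) (G z) (H z)) y /\
  forall i, vd i (fun z => cross (F z) (G z) (H z)) y
    = cross (vd i F y) (G y) (H y) + cross (F y) (vd i G y) (H y) + cross (F y) (G y) (vd i H y).
Proof.
move=> Fy Gy Hy; pose e k : 'rV[R]_8 := delta_mx 0 k.
have T0 u v w : ReOmega 0 u v w = 0.
  by have := ReOmega_linear1 (-1) 0 0 u v w; rewrite scaler0 addr0 mulN1r addNr.
have Ts (x u v w : 'rV[R]_8) : ReOmega x u v w = \sum_k x 0 k * ReOmega (e k) u v w.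
  rewrite {1}(row_sum_delta x).
  by elim/big_rec2: _ => [|k r s _ <-]; rewrite ?T0 ?ReOmega_linear1.
have BB k l := @bilinear_analytic (fun u v => ReOmega (e k) u v (e l)) G H y
  (fun a u v w => ReOmega_linear2 a (e k) u v w (e l))
  (fun a u v w => ReOmega_linear3 a (e k) w u v (e l)) Gy Hy.
have FB k l : analytic_at (fun z => F z 0 k * ReOmega (e k) (G z) (H z) (e l)) y.
  by apply: analyticM => //; have [] := BB k l.
have E l : (fun z => cross (F z) (G z) (H z) 0 l)
    = (fun z => \sum_k F z 0 k * ReOmega (e k) (G z) (H z) (e l)).
  by apply/funext => z; rewrite mxE Ts.
have A : vanalytic_at (fun z => cross (F z) (G z) (H z)) y.
  by move=> l; rewrite E; exact: analytic_sum.
split=> // i; apply/rowP => l; rewrite vdE // E pd_sum // !mxE.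
rewrite (Ts (vd i F y)) (Ts (F y) (vd i G y)) (Ts (F y) (G y)) -!big_split /=.
apply: eq_bigr => k _; have [h1 h2] := BB k l.
by rewrite pdM // h2 -vdE // mulrDr addrA.
Qed.

Lemma vanalytic_cross F G H y : vanalytic_at F y -> vanalytic_at G y ->
  vanalytic_at H y -> vanalytic_at (fun z => cross (F z) (G z) (H z)) y.
Proof. by move=> Fy Gy Hy; have [] := cross_leibniz Fy Gy Hy. Qed.

End VectorCalculus.

#[local] Opaque vd.

Section Charts.
Context {R : realType} {S : analyticSurface R}.
Implicit Types (c : chart R S) (u : S).

Lemma cmap_image_nbhs c u : cdom c u -> nbhs (cmap c u) (cmap c @` cdom c).
Proof. by move=> cu; apply: open_nbhs_nbhs; split; [exact: cimg_open|exists u]. Qed.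

Lemma cinv_image c y : (cmap c @` cdom c) y -> cdom c (cinv c y) /\ cmap c (cinv c y) = y.
Proof. by move=> [u cu <-]; rewrite cmapK. Qed.

Lemma near_cinv c u : cdom c u ->
  \forall y \near cmap c u, cdom c (cinv c y) /\ cmap c (cinv c y) = y.
Proof. by move=> /cmap_image_nbhs; apply: filterS => y; exact: cinv_image. Qed.

Lemma near_cinv_in c u (A : set S) : cdom c u -> nbhs u A ->
  \forall y \near cmap c u, A (cinv c y).
Proof.
move=> cu uA; have h : nbhs (cinv c (cmap c u)) A by rewrite cmapK.
exact: (cinv_continuous cu) _ h.
Qed.

Lemma cdom_nbhs c u : cdom c u -> nbhs u (cdom c).
Proof. by move=> cu; apply: open_nbhs_nbhs; split=> //; exact: cdom_open. Qed.

Lemma atlas_coordinates c : atlas c -> coordinates c.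
Proof. by move=> ac c' ac'; exact: atlas_compatible. Qed.

Lemma near_transition c c' u : cdom c u -> cdom c' u ->
  \forall y \near cmap c u, cinv c' (cmap c' (cinv c y)) = cinv c y.
Proof.
move=> cu cu'; apply: filterS (near_cinv_in cu (cdom_nbhs cu')) => y.
by move=> /cmapK.
Qed.

(** Analytic maps are tested on atlas charts only; the transition map carries the property to every
    compatible chart. *)
Lemma analytic_in_coordinates m (f : S -> 'rV[R]_m) c u :
  analytic_map f -> coordinates c -> cdom c u -> vanalytic_at (f \o cinv c) (cmap c u).
Proof.
move=> fa cc cu; have [c' ac' cu'] := atlas_cover u.
have [cc' _] := cc c' ac'.
move=> k; apply: (@analytic_near_eq _
    ((fun y => (f \o cinv c') y 0 k) \o (cmap c' \o cinv c))).
  by apply: filterS (near_transition cu cu') => y /= ->.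
apply: analytic_vcomp; last exact: cc'.
by rewrite /= cmapK //; exact: fa.
Qed.

Definition pv m i c (f : S -> 'rV[R]_m) u : 'rV[R]_m := vd i (f \o cinv c) (cmap c u).

Lemma pvE m i c (f : S -> 'rV[R]_m) u : pv i c f u = vd i (f \o cinv c) (cmap c u).
Proof. by []. Qed.

Lemma partial_sE m c (f : S -> 'rV[R]_m) u : partial_s c f u = pv 0 c f u.
Proof. by []. Qed.
Lemma partial_tE m c (f : S -> 'rV[R]_m) u : partial_t c f u = pv 1 c f u.
Proof. by []. Qed.

Lemma rV2_delta (v : 'rV[R]_2) : v = v 0 0 *: delta_mx 0 0 + v 0 1 *: delta_mx 0 1.
Proof. by apply: rV2P; rewrite !mxE /= ?mulr1 ?mulr0 ?addr0 ?add0r. Qed.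

Lemma pv_change m i c c' (f : S -> 'rV[R]_m) u :
  analytic_map f -> coordinates c' -> transition_analytic c c' -> cdom c u -> cdom c' u ->
  pv i c f u = vd i (cmap c' \o cinv c) (cmap c u) 0 0 *: pv 0 c' f u
             + vd i (cmap c' \o cinv c) (cmap c u) 0 1 *: pv 1 c' f u.
Proof.
move=> fa cc' tr cu cu'.
pose tau := cmap c' \o cinv c.
have tE : tau (cmap c u) = cmap c' u by rewrite /tau /= cmapK.
have dt : differentiable tau (cmap c u) by apply: vanalytic_differentiable; exact: tr.
have df : differentiable (f \o cinv c') (tau (cmap c u)).
  by rewrite tE; apply: vanalytic_differentiable; exact: analytic_in_coordinates.
rewrite /pv (@near_eq_vd _ _ _ _ ((f \o cinv c') \o tau)); last first.
  by apply: filterS (near_transition cu cu') => y /= ->.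
rewrite {1}vdef deriveE; last exact: differentiable_comp.
rewrite diff_comp //= {1}(rV2_delta ('d tau (cmap c u) _)) raddfD /= !linearZ /=.
by rewrite !vdef -tE (deriveE _ dt) !(deriveE _ df).
Qed.

End Charts.

#[local] Opaque pv.

(** * The differential of the ruled parametrization *)

Section Tangent.
Context {R : realType} {S : analyticSurface R}.
Variables phi1 phi2 psi : S -> 'rV[R]_8.
Hypotheses (phi1_analytic : analytic_map phi1) (phi2_analytic : analytic_map phi2)
  (psi_analytic : analytic_map psi).
Implicit Types (c : chart R S) (u : S) (r : 'rV[R]_2).
Local Notation iota := (iota_M phi1 phi2 psi).
Local Notation tangent := (tangent_mx phi1 phi2 psi).

Lemma analytic_map_lin m (f g : S -> 'rV[R]_m) (a : R) : analytic_map f -> analytic_map g ->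
  analytic_map (fun u => a *: f u + g u).
Proof.
move=> fa ga c u ac cu; apply: vanalyticD; last exact: ga.
by apply: vanalyticZ; [exact: analytic_cst|exact: fa].
Qed.

Lemma iota_analytic r : analytic_map (iota r).
Proof.
have -> : iota r = (fun u => r 0 0 *: phi1 u + (r 0 1 *: phi2 u + psi u)).
  by apply/funext => u; rewrite /iota_M addrA.
by apply: analytic_map_lin => //; exact: analytic_map_lin.
Qed.

Lemma pv_iota i c r u : coordinates c -> cdom c u ->
  pv i c (iota r) u = r 0 0 *: pv i c phi1 u + r 0 1 *: pv i c phi2 u + pv i c psi u.
Proof.
move=> cc cu; have a f (fa : analytic_map f) := analytic_in_coordinates fa cc cu.
rewrite !pvE -!vdcZ; try exact: a.
rewrite -vdD; [|by apply: vanalyticZ; [exact: analytic_cst|exact: a]..].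
rewrite -vdD //; last exact: a.
by apply: vanalyticD; apply: vanalyticZ; (exact: analytic_cst || exact: a).
Qed.

Definition frame c r u : 'M[R]_(4, 8) :=
  rows4 (phi1 u) (phi2 u) (pv 0 c (iota r) u) (pv 1 c (iota r) u).

Lemma local_iota_differentiable c r u : coordinates c -> cdom c u ->
  differentiable (local_iota phi1 phi2 psi c) (row_mx r (cmap c u)).
Proof.
move=> cc cu; have a f (fa : analytic_map f) := analytic_in_coordinates fa cc cu.
have d f (fa : analytic_map f) k : differentiable
    (fun y : 'rV[R]_(2 + 2) => f (cinv c (rsubmx y)) 0 k) (row_mx r (cmap c u)).
  apply: (@differentiable_comp _ _ _ _ (fun y : 'rV[R]_(2 + 2) => rsubmx y)
    (fun z => (f \o cinv c) z 0 k)); first exact: differentiable_rsubmx.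
  by rewrite row_mxKr; apply: analytic_differentiable; exact: a.
have l k : differentiable (fun y : 'rV[R]_(2 + 2) => lsubmx y 0 k) (row_mx r (cmap c u)).
  apply: (@differentiable_comp _ _ _ _ (fun y : 'rV[R]_(2 + 2) => lsubmx y)
    (fun z : 'rV[R]_2 => z 0 k)); first exact: differentiable_lsubmx.
  exact: differentiable_coord.
apply: differentiable_rV => k.
have -> : (fun z => local_iota phi1 phi2 psi c z 0 k) = (fun z : 'rV[R]_(2 + 2) =>
    lsubmx z 0 0 * phi1 (cinv c (rsubmx z)) 0 k + lsubmx z 0 1 * phi2 (cinv c (rsubmx z)) 0 k
    + psi (cinv c (rsubmx z)) 0 k).
  by apply/funext => z; rewrite !mxE.
apply: differentiableD; last exact: d.
by apply: differentiableD; apply: differentiableM => //; exact: d.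
Qed.

Lemma derive_eq_path (V V' W : normedModType R) (f : V -> W) (g : V' -> W) a b v w :
  (forall h : R, f (h *: v + a) = g (h *: w + b)) -> 'D_v f a = 'D_w g b.
Proof.
move=> E; have E0 : f a = g b by have := E 0; rewrite !scale0r !add0r.
have -> : 'D_v f a = lim ((fun h => h^-1 *: (f (h *: v + a) - f a)) @ 0^') by [].
have -> : (fun h : R => h^-1 *: (f (h *: v + a) - f a))
        = (fun h : R => h^-1 *: (g (h *: w + b) - g b)).
  by apply/funext => h; rewrite E E0.
by [].
Qed.

Lemma derive_affine (V W : normedModType R) (f : V -> W) a v d :
  (forall h : R, f (h *: v + a) = h *: d + f a) -> 'D_v f a = d.
Proof.
move=> E; apply/lim_near_cst => //=; near=> h.
rewrite E addrK scalerA mulVf ?scale1r //.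
by near: h; exact: nbhs_dnbhs_neq.
Unshelve. all: by end_near. Qed.

(** The rows of the Jacobian are directional derivatives. In the r directions the map is affine with
    slopes phi1 and phi2; in the surface directions one differentiates along a path with r fixed. *)
Lemma tangentE c r u : coordinates c -> cdom c u -> tangent c (r, u) = frame c r u.
Proof.
move=> cc cu; have df := local_iota_differentiable r cc cu.
have D v : v *m tangent c (r, u)
    = 'D_v (local_iota phi1 phi2 psi c) (row_mx r (cmap c u)) by rewrite deriveEjacobian.
have [q0 q1 q2 q3] := quadE (phi1 u) (phi2 u) (pv 0 c (iota r) u) (pv 1 c (iota r) u).
have dl (a b : 'rV[R]_2) : local_iota phi1 phi2 psi c (row_mx a b) = iota a (cinv c b).
  by rewrite /local_iota row_mxKl row_mxKr.
have el (i : 'I_2) : delta_mx 0 (lshift 2 i) = row_mx (delta_mx 0 i) 0 :> 'rV[R]_(2 + 2).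
  by rewrite -(scale1r (delta_mx 0 (lshift 2 i))) delta_mx_lshift scale1r.
have er (i : 'I_2) : delta_mx 0 (rshift 2 i) = row_mx 0 (delta_mx 0 i) :> 'rV[R]_(2 + 2).
  by rewrite -(scale1r (delta_mx 0 (rshift 2 i))) delta_mx_rshift scale1r.
have R0 : row (lshift 2 (0 : 'I_2)) (tangent c (r, u)) = phi1 u.
  rewrite rowE D el; apply: derive_affine => h.
  rewrite scale_row_mx add_row_mx !dl scaler0 add0r (cmapK cu) /iota_M !mxE /= mulr1 mulr0 add0r.
  by rewrite scalerDl -!addrA.
have R1 : row (lshift 2 (1 : 'I_2)) (tangent c (r, u)) = phi2 u.
  rewrite rowE D el; apply: derive_affine => h.
  rewrite scale_row_mx add_row_mx !dl scaler0 add0r (cmapK cu) /iota_M !mxE /= mulr1 mulr0 add0r.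
  by rewrite scalerDl !addrA (addrC (h *: phi2 u)) -!addrA.
have R2 : row (rshift 2 (0 : 'I_2)) (tangent c (r, u)) = pv 0 c (iota r) u.
  rewrite rowE D er pvE vdef; apply: derive_eq_path => h.
  by rewrite scale_row_mx add_row_mx dl scaler0 add0r.
have R3 : row (rshift 2 (1 : 'I_2)) (tangent c (r, u)) = pv 1 c (iota r) u.
  rewrite rowE D er pvE vdef; apply: derive_eq_path => h.
  by rewrite scale_row_mx add_row_mx dl scaler0 add0r.
move: R0 R1 R2 R3; move: (tangent c (r, u)) => T R0 R1 R2 R3.
have ro (i j : 'I_(2 + 2)) : val i = val j -> row i T = row j T by move=> /val_inj ->.
apply/row_matrixP; apply: ord4_ind; rewrite row_rows4 ?q0 ?q1 ?q2 ?q3.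
- by rewrite -R0; exact: ro.
- by rewrite -R1; exact: ro.
- by rewrite -R2; exact: ro.
- by rewrite -R3; exact: ro.
Qed.

Lemma frame_sub c c' r u : coordinates c' -> transition_analytic c c' ->
  cdom c u -> cdom c' u -> (frame c r u <= frame c' r u)%MS.
Proof.
move=> cc' tr cu cu'; have /and4P[m0 m1 m2 m3] :=
  mem_rows4 (phi1 u) (phi2 u) (pv 0 c' (iota r) u) (pv 1 c' (iota r) u).
have L (a b : R) :
    ((a *: pv 0 c' (iota r) u + b *: pv 1 c' (iota r) u)%R <= frame c' r u)%MS.
  by apply: addmx_sub; [exact: scalemx_sub m2|exact: scalemx_sub m3].
rewrite rows4_subP; apply/and4P; split; [exact: m0|exact: m1| |].
  rewrite (pv_change _ (iota_analytic r) cc' tr cu cu'); exact: L.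
rewrite (pv_change _ (iota_analytic r) cc' tr cu cu'); exact: L.
Qed.

Lemma frame_eqmx c c' r u : coordinates c -> coordinates c' -> compatible c c' ->
  cdom c u -> cdom c' u -> (frame c r u :=: frame c' r u)%MS.
Proof.
move=> cc cc' [t t'] cu cu'; apply/eqmxP; apply/andP.
by split; [exact: frame_sub cc' t cu cu'|exact: frame_sub cc t' cu' cu].
Qed.

(** Two coordinate systems are compatible with the atlas but not, by definition, with each other, so
    the comparison passes through an atlas chart. *)
Lemma frame_coord_eqmx c c' r u : coordinates c -> coordinates c' ->
  cdom c u -> cdom c' u -> (frame c r u :=: frame c' r u)%MS.
Proof.
move=> cc cc' cu cu'; have [d ad du] := atlas_cover u; have dd := atlas_coordinates ad.
apply: eqmx_trans (frame_eqmx r cc dd (cc d ad) cu du) _.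
exact: eqmx_sym (frame_eqmx r cc' dd (cc' d ad) cu' du).
Qed.

Lemma immersion_frame c r u : coordinates c -> cdom c u ->
  immersion_at phi1 phi2 psi (r, u) <-> row_free (frame c r u).
Proof.
move=> cc cu; split=> [[c' [ac' cu']]|fr].
  rewrite (tangentE r (atlas_coordinates ac') cu').
  move=> fr; rewrite /row_free (frame_eqmx _ cc (atlas_coordinates ac') (cc _ ac') cu cu').
  exact: fr.
have [c' ac' cu'] := atlas_cover u; exists c'; split; [exact: ac'|exact: cu'|].
rewrite (tangentE r (atlas_coordinates ac') cu').
rewrite /row_free -(frame_eqmx _ cc (atlas_coordinates ac') (cc _ ac') cu cu').
exact: fr.
Qed.

End Tangent.

Section Convergence.
Context {R : realType} {T : Type} {F : set_system T} {FF : Filter F}.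

Lemma cvg_sum_ord n (f : 'I_n -> T -> R) (l : 'I_n -> R) :
  (forall i, f i t @[t --> F] --> l i) ->
  \sum_(i < n) f i t @[t --> F] --> \sum_(i < n) l i.
Proof. by move=> h; apply: cvg_big => [|i _]; [exact: add_continuous|exact: h]. Qed.

Lemma cvg_prod_ord n (f : 'I_n -> T -> R) (l : 'I_n -> R) :
  (forall i, f i t @[t --> F] --> l i) ->
  \prod_(i < n) f i t @[t --> F] --> \prod_(i < n) l i.
Proof. by move=> h; apply: cvg_big => [|i _]; [exact: mul_continuous|exact: h]. Qed.

Lemma cvg_det n (A : T -> 'M[R]_n) (B : 'M[R]_n) :
  (forall i j, A t i j @[t --> F] --> B i j) -> \det (A t) @[t --> F] --> \det B.
Proof.
move=> h; rewrite /determinant; apply: cvg_big => [|s _]; first exact: add_continuous.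
by apply: cvgMl_tmp; apply: cvg_prod_ord => i; exact: h.
Qed.

Lemma cvg_inner (X : T -> 'rV[R]_8) (x w : 'rV[R]_8) :
  (forall k, X t 0 k @[t --> F] --> x 0 k) -> inner (X t) w @[t --> F] --> inner x w.
Proof. by move=> h; apply: cvg_sum_ord => k; apply: cvgMr_tmp; exact: h. Qed.

End Convergence.

#[local] Opaque cross bar vd pv.

(** * Frames that solve the equation span special Lagrangian planes *)

Section FreeFrames.
Context {R : realType}.
Implicit Types (p q a b v : 'rV[R]_8).

Lemma rows4_free_bar_comb p q a b (x y : R) : row_free (rows4 p q a b) ->
  bar p q (x *: a + y *: b) = 0 -> x = 0 /\ y = 0.
Proof.
move=> fr; set z := x *: a + y *: b => z0.
pose c : 'rV[R]_4 := \row_i nth 0 [:: - inner p z; - inner q z; x; y] i.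
have cz : c *m rows4 p q a b = 0.
  have [q0 q1 q2 q3] := quadE p q a b.
  rewrite mulmx_sum_row sum4 !row_rows4 q0 q1 q2 q3 !mxE /=.
  by rewrite !scaleNr -addrA -/z addrC -[RHS]z0 bar_def addrA.
have c0 : c = 0.
  by apply: (row_free_inj fr); rewrite cz mul0mx.
have := congr1 (fun v : 'rV[R]_4 => v 0 (@Ordinal 4 2 isT)) c0.
have := congr1 (fun v : 'rV[R]_4 => v 0 (@Ordinal 4 3 isT)) c0.
by rewrite !mxE.
Qed.

Lemma rows4_free_bar p q a b : row_free (rows4 p q a b) -> bar p q a != 0.
Proof.
move=> fr; apply/eqP => a0; have := @rows4_free_bar_comb p q a b 1 0 fr.
rewrite scale1r scale0r addr0 => /(_ a0)[/eqP].
by rewrite oner_eq0.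
Qed.

Lemma unit_neq0 p : inner p p = 1 -> p != 0.
Proof. by move=> pp; apply/eqP => z; move: pp; rewrite z inner0l => /eqP; rewrite eq_sym oner_eq0. Qed.

Section SL.
Variables p q a b : 'rV[R]_8.
Hypotheses (pp : inner p p = 1) (qq : inner q q = 1) (pq : inner p q = 0)
  (wpq : omega p q = 0) (wpa : omega p a = 0) (wqa : omega q a = 0).
Variables x y : R.
Hypothesis bE : b = cross p q a + x *: p + y *: q.
Hypothesis fr : row_free (rows4 p q a b).

(** Modulo p and q the vector b is J a, and J preserves the norm of bar a. Positivity of this value
    is what makes the coordinates oriented. *)
Lemma sl_frame_value : ReOmega p q a b = inner (bar p q a) (bar p q a).
Proof.
rewrite -crossP bE; have [h1 h2 _ _] := cross_hor p q a.
transitivity (inner (cross p q a) (cross p q a)).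
  by rewrite !innerDr !innerZr (innerC _ p) (innerC _ q) h1 h2 !mulr0 !addr0.
by rewrite -cross_bar cross_norm_hor //; exact: bar_hor.
Qed.

(** With e the normalization of bar a, the basis p, q, e, J e is orthonormal and Re Omega takes the
    value |J e|^2 = 1 on it. *)
Lemma sl_frame_exists : exists E : 'M[R]_(4, 8), [/\ E *m E^T = 1%:M,
  (E :=: rows4 p q a b)%MS & complex.Re (Omega (fun i => row i E)) = 1].
Proof.
set a' := bar p q a; have a0 : a' != 0 := rows4_free_bar fr.
have n0 : 0 < inner a' a' := inner_gt0 a0.
pose k := (Num.sqrt (inner a' a'))^-1; pose e := k *: a'.
have k0 : k != 0 by rewrite invr_eq0 sqrtr_eq0 -ltNge.
have ha : hor p q a' by exact: bar_hor.
have he : hor p q e by exact: horZ.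
have ee : inner e e = 1.
  rewrite innerZl innerZr mulrA /k -invfM -expr2 sqr_sqrtr ?ltW //.
  by rewrite mulVf // gt_eqF.
have [h1 h2 _ _] := he; have [k1 k2 _ _] := cross_hor p q e.
have nc : inner (cross p q e) (cross p q e) = 1 by rewrite cross_norm_hor.
have ec := cross_perp p q e.
have [q0 q1 q2 q3] := quadE p q e (cross p q e).
have E1 : rows4 p q e (cross p q e) *m (rows4 p q e (cross p q e))^T = 1%:M.
  rewrite gram4; apply/matrixP; apply: ord4_ind; apply: ord4_ind;
    rewrite !mxE ?q0 ?q1 ?q2 ?q3 /= ?(innerC q p) ?(innerC e p) ?(innerC e q)
      ?(innerC (cross p q e) p) ?(innerC (cross p q e) q) ?(innerC (cross p q e) e);
    by rewrite ?pp ?qq ?pq ?h1 ?h2 ?k1 ?k2 ?nc ?ec ?ee.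
exists (rows4 p q e (cross p q e)); split; first exact: E1.
- have /and4P[m0 m1 m2 m3] := mem_rows4 p q a b.
  have a'E : (a' <= rows4 p q a b)%MS.
    rewrite /a' bar_def -!scaleNr; apply: addmx_sub; last exact: scalemx_sub m1.
    by apply: addmx_sub; [exact: m2|exact: scalemx_sub m0].
  have cE : (cross p q e <= rows4 p q a b)%MS.
    rewrite crossZ3 cross_bar; apply: scalemx_sub.
    have -> : cross p q a = b + (- x) *: p + (- y) *: q.
      by rewrite bE !scaleNr; apply/rowP => l; rewrite !mxE; ring.
    apply: addmx_sub; last exact: scalemx_sub m1.
    by apply: addmx_sub; [exact: m3|exact: scalemx_sub m0].
  have sub : (rows4 p q e (cross p q e) <= rows4 p q a b)%MS.
    rewrite rows4_subP; apply/and4P; split; [exact: m0|exact: m1| |exact: cE].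
    exact: scalemx_sub a'E.
  have f2 : row_free (rows4 p q e (cross p q e)).
    by apply/row_freeP; exists (rows4 p q e (cross p q e))^T.
  apply/eqmxP; apply/andP; split; first exact: sub.
  have := mxrank_leqif_sup sub => -[_ <-].
  by rewrite (eqP f2) (eqP fr).
- by rewrite Omega_rows4 -/(ReOmega _ _ _ _) -crossP nc.
Qed.

End SL.
End FreeFrames.

(** * From the equations to special Lagrangian *)

Section Converse.
Context {R : realType} {S : analyticSurface R}.
Variables phi1 phi2 psi : S -> 'rV[R]_8.
Hypotheses (phi1_analytic : analytic_map phi1) (phi2_analytic : analytic_map phi2)
  (psi_analytic : analytic_map psi).
Hypotheses (phi1_unit : forall u, inner (phi1 u) (phi1 u) = 1)
  (phi2_unit : forall u, inner (phi2 u) (phi2 u) = 1)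
  (phi_orthogonal : forall u, inner (phi1 u) (phi2 u) = 0)
  (phi_omega : forall u, omega (phi1 u) (phi2 u) = 0).
Implicit Types (c : chart R S) (u : S) (r : 'rV[R]_2).
Local Notation iota := (iota_M phi1 phi2 psi).
Local Notation frame := (frame phi1 phi2 psi).
Local Notation immersion := (immersion_at phi1 phi2 psi).

Definition sl_equations c (f g1 g2 : S -> R) u : Prop :=
  [/\ [/\ omega (phi1 u) (pv 0 c phi1 u) = 0, omega (phi1 u) (pv 0 c phi2 u) = 0,
          omega (phi2 u) (pv 0 c phi1 u) = 0 & omega (phi2 u) (pv 0 c phi2 u) = 0],
      omega (phi1 u) (pv 0 c psi u) = 0 /\ omega (phi2 u) (pv 0 c psi u) = 0,
      pv 1 c phi1 u = cross (phi1 u) (phi2 u) (pv 0 c phi1 u) + f u *: phi2 u,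
      pv 1 c phi2 u = cross (phi1 u) (phi2 u) (pv 0 c phi2 u) - f u *: phi1 u &
      pv 1 c psi u = cross (phi1 u) (phi2 u) (pv 0 c psi u) + g1 u *: phi1 u + g2 u *: phi2 u].

Section AtPoint.
Variables (c : chart R S) (f g1 g2 : S -> R) (u : S) (r : 'rV[R]_2).
Hypotheses (cc : coordinates c) (cu : cdom c u) (eqs : sl_equations c f g1 g2 u).

(** The equations are linear in derivatives, so [iota r] satisfies an equation of the same shape
    modulo phi1 and phi2, for every r at once. *)
Lemma equations_iota : [/\ omega (phi1 u) (pv 0 c (iota r) u) = 0,
  omega (phi2 u) (pv 0 c (iota r) u) = 0 &
  pv 1 c (iota r) u = cross (phi1 u) (phi2 u) (pv 0 c (iota r) u)
    + (g1 u - r 0 1 * f u) *: phi1 u + (g2 u + r 0 0 * f u) *: phi2 u].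
Proof.
have [[e1 e2 e3 e4] [e5 e6] E1 E2 E3] := eqs.
rewrite !(pv_iota phi1_analytic phi2_analytic psi_analytic _ _ cc cu).
split.
- by rewrite !omegaDr !omegaZr e1 e2 e5 !mulr0 !addr0.
- by rewrite !omegaDr !omegaZr e3 e4 e6 !mulr0 !addr0.
rewrite E1 E2 E3 !crossD3 !crossZ3.
move: (cross _ _ (pv 0 c phi1 u)) (cross _ _ (pv 0 c phi2 u)) (cross _ _ (pv 0 c psi u)) => A B C.
move: (phi1 u) (phi2 u) (r 0 0) (r 0 1) (f u) (g1 u) (g2 u) => p q s t f' g h.
by apply/rowP => k; rewrite !mxE; ring.
Qed.

Lemma frame_positive : row_free (frame c r u) ->
  0 < ReOmega (phi1 u) (phi2 u) (pv 0 c (iota r) u) (pv 1 c (iota r) u).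
Proof.
move=> fr; have [w1 w2 E] := equations_iota.
rewrite (sl_frame_value (phi1_unit u) (phi2_unit u) (phi_orthogonal u) (phi_omega u) w1 w2 E).
by apply: inner_gt0; exact: rows4_free_bar fr.
Qed.

Lemma frame_sl : row_free (frame c r u) ->
  exists E : 'M[R]_(4, 8), [/\ E *m E^T = 1%:M, (E :=: frame c r u)%MS &
    complex.Re (Omega (fun i => row i E)) = 1].
Proof.
move=> fr; have [w1 w2 E] := equations_iota.
exact: sl_frame_exists (phi1_unit u) (phi2_unit u) (phi_orthogonal u) (phi_omega u) w1 w2 _ _ E fr.
Qed.

End AtPoint.

(** The orthonormal bases are chosen point by point and need not be continuous. Local constancy of
    the orientation is therefore tested on the coordinate frame, which is continuous. *)
Lemma frame_det_cvg c r u (E : 'M[R]_(4, 8)) : coordinates c -> cdom c u ->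
  \det (frame c p.1 p.2 *m E^T) @[p --> (r, u)] --> \det (frame c r u *m E^T).
Proof.
move=> cc cu.
have cm : cmap c p.2 @[p --> (r, u)] --> cmap c u.
  by apply: (@cvg_comp _ _ _ (fun p : 'rV[R]_2 * S => p.2)); [exact: cvg_snd|exact: cmap_continuous].
have V (G : 'rV[R]_2 -> 'rV[R]_8) k : vanalytic_at G (cmap c u) ->
    G (cmap c p.2) 0 k @[p --> (r, u)] --> G (cmap c u) 0 k.
  move=> Gu; apply: (@cvg_comp _ _ _ (fun p : 'rV[R]_2 * S => cmap c p.2) (fun y => G y 0 k)); first exact: cm.
  exact: analytic_continuous (Gu k).
have near_dom : \forall p \near (r, u), cdom c p.2.
  by apply: (@cvg_snd _ _ (nbhs r) (nbhs u) _); exact: cdom_nbhs.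
have rc (k : 'I_2) : (p.1 : 'rV[R]_2) 0 k @[p --> (r, u)] --> r 0 k.
  apply: (@cvg_comp _ _ _ (fun p : 'rV[R]_2 * S => p.1) (fun s : 'rV[R]_2 => s 0 k)); first exact: cvg_fst.
  exact: coord_continuous.
have a (f : S -> 'rV[R]_8) (fa : analytic_map f) := analytic_in_coordinates fa cc cu.
have P (f : S -> 'rV[R]_8) (fa : analytic_map f) k : f p.2 0 k @[p --> (r, u)] --> f u 0 k.
  have := V _ k (a f fa); rewrite /= (cmapK cu).
  apply: cvg_trans; apply: near_eq_cvg; apply: filterS near_dom => p cp.
  by rewrite /= cmapK.
have D i (f : S -> 'rV[R]_8) (fa : analytic_map f) k : pv i c f p.2 0 k @[p --> (r, u)] --> pv i c f u 0 k.
  by have := V _ k (vanalytic_vd i (a f fa)).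
have Di i k : pv i c (iota p.1) p.2 0 k @[p --> (r, u)] --> pv i c (iota r) u 0 k.
  rewrite (pv_iota phi1_analytic phi2_analytic psi_analytic _ _ cc cu).
  have L : r 0 0 * pv i c phi1 u 0 k + r 0 1 * pv i c phi2 u 0 k + pv i c psi u 0 k
    = (r 0 0 *: pv i c phi1 u + r 0 1 *: pv i c phi2 u + pv i c psi u) 0 k by rewrite !mxE.
  have Lm : (p.1 : 'rV[R]_2) 0 0 * pv i c phi1 p.2 0 k + (p.1 : 'rV[R]_2) 0 1 * pv i c phi2 p.2 0 k
      + pv i c psi p.2 0 k @[p --> (r, u)] -->
      r 0 0 * pv i c phi1 u 0 k + r 0 1 * pv i c phi2 u 0 k + pv i c psi u 0 k.
    apply: cvgD; last exact: D.
    by apply: cvgD; apply: cvgM; (exact: rc || exact: D).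
  rewrite L in Lm; apply: cvg_trans Lm; apply: near_eq_cvg; apply: filterS near_dom => p cp.
  by rewrite /= (pv_iota phi1_analytic phi2_analytic psi_analytic _ _ cc cp) !mxE.
apply: cvg_det => i j; under eq_cvg do rewrite mulmx_trE row_rows4.
rewrite mulmx_trE row_rows4; apply: cvg_inner => k; move: i.
have [q0 q1 q2 q3] := quadE (phi1 u) (phi2 u) (pv 0 c (iota r) u) (pv 1 c (iota r) u).
by apply: ord4_ind; rewrite ?q0 ?q1 ?q2 ?q3; under eq_cvg do rewrite /quad (tnth_nth 0) /=;
  [exact: P|exact: P|exact: Di|exact: Di].
Qed.

Theorem equations_special_lagrangian :
  (forall u0 : S, exists (c : chart R S) (f g1 g2 : S -> R),
    [/\ cdom c u0, coordinates c & forall u, cdom c u -> sl_equations c f g1 g2 u]) ->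
  special_lagrangian phi1 phi2 psi.
Proof.
move=> H.
have EX p : exists E : 'M[R]_(4, 8), immersion p ->
    [/\ E *m E^T = 1%:M, (forall c, coordinates c -> cdom c p.2 -> (E :=: frame c p.1 p.2)%MS) &
      complex.Re (Omega (fun i => row i E)) = 1].
  (* Nothing is asked of E at singular points, so 0 serves there. *)
  case: p => r u; have [im|nim] := pselect (immersion (r, u)); last by exists 0.
  have [c [f [g1 [g2 [cu cc eqs]]]]] := H u.
  have fr := (immersion_frame phi1_analytic phi2_analytic psi_analytic r cc cu).1 im.
  have [E [E1 E2 E3]] := frame_sl cc cu (eqs u cu) fr.
  exists E => _; split; [exact: E1| |exact: E3].
  move=> c' cc' cu'; apply: eqmx_trans E2 _.
  exact: (frame_coord_eqmx phi1_analytic phi2_analytic psi_analytic r cc cc' cu cu').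
have [E EP] := choice EX.
exists E; last first.
  move=> p im v vE; have [E1 _ E3] := EP p im; exact: calibrated E1 E3 v vE.
split.
- by move=> p im; have [] := EP p im.
- move=> [r u] c im ac cu; have [_ E2 _] := EP _ im.
  have cc := atlas_coordinates ac.
  rewrite (tangentE phi1_analytic phi2_analytic psi_analytic r cc cu); exact: E2.
move=> [r u] im; have [c [f [g1 [g2 [cu cc eqs]]]]] := H u.
have [E1 E2 E3] := EP _ im; have cal := calibrated E1 E3.
have imf r' u' (cu' : cdom c u') :=
  immersion_frame phi1_analytic phi2_analytic psi_analytic r' cc cu'.
have pos r' u' : immersion (r', u') -> cdom c u' ->
    0 < \det (frame c r' u' *m (E (r', u'))^T).
  move=> im' cu'; have [F1 F2 F3] := EP _ im'.
  rewrite -(calibrated F1 F3); last by rewrite (F2 c cc cu'); exact: submx_refl.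
  rewrite Omega_rows4; apply: (frame_positive cc cu' (eqs u' cu')).
  exact: (imf r' u' cu').1 im'.
have near_dom : \forall p \near (r, u), cdom c p.2.
  by apply: (@cvg_snd _ _ (nbhs r) (nbhs u) _); exact: cdom_nbhs.
have near_pos : \forall p \near (r, u), 0 < \det (frame c p.1 p.2 *m (E (r, u))^T).
  have := @frame_det_cvg c r u (E (r, u)) cc cu.
  by move=> /(_ _ (open_nbhs_nbhs (conj (@open_gt _ 0) (pos r u im cu)))).
apply: filterS2 near_dom near_pos => -[r' u'] /= cu' d im'.
have [F1 F2 F3] := EP _ im'.
have sub : (frame c r' u' <= E (r', u'))%MS by rewrite (F2 c cc cu'); exact: submx_refl.
(* The determinant of the frame against E at (r, u) is its determinant against E at (r', u') times
   the determinant to be signed; the first two are positive. *)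
have e := sub_orthonormal_proj F1 sub.
move: d; rewrite -e -mulmxA det_mulmx.
by rewrite pmulr_rgt0 //; exact: pos.
Qed.

End Converse.

(** The neighbourhood N allows conditions known only near y0 to be imposed on the whole new
    chart. *)
Lemma chart_change (R : realType) (S : analyticSurface R) (c : chart R S)
    (F G : 'rV[R]_2 -> 'rV[R]_2) (y0 : 'rV[R]_2) (N : set 'rV[R]_2) :
  coordinates c -> (cmap c @` cdom c) y0 -> nbhs y0 N ->
  vanalytic_at F y0 -> vanalytic_at G (F y0) ->
  (\forall y \near y0, G (F y) = y) -> (\forall z \near F y0, F (G z) = z) ->
  exists c' : chart R S, [/\ coordinates c', cdom c' (cinv c y0),
    forall u, cdom c' u -> [/\ cdom c u, N (cmap c u) & vanalytic_at F (cmap c u)] &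
    cmap c' = F \o cmap c].
Proof.
move=> cc cy0 Ny0 Fy0 Gz0 GF FG.
pose A := [set y | [/\ (cmap c @` cdom c) y, N y, vanalytic_at F y & G (F y) = y]]^°.
pose B := [set z | vanalytic_at G z /\ F (G z) = z]^°.
have A0 : A y0.
  have n1 : nbhs y0 (cmap c @` cdom c).
    by apply: open_nbhs_nbhs; split=> //; exact: cimg_open.
  by near=> y; split; near: y; [exact: n1|exact: Ny0|exact: vanalytic_near|exact: GF].
have B0 : B (F y0).
  by near=> z; split; near: z; [exact: vanalytic_near|exact: FG].
have Ap y : A y -> [/\ (cmap c @` cdom c) y, N y, vanalytic_at F y & G (F y) = y].
  exact: nbhs_singleton.
have Bp z : B z -> vanalytic_at G z /\ F (G z) = z by exact: nbhs_singleton.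
have oA : open A by exact: open_interior.
have oB : open B by exact: open_interior.
pose D := [set u | [/\ cdom c u, A (cmap c u) & B (F (cmap c u))]].
have oD : open D.
  rewrite openE => u [cu Au Bu]; have [_ _ Fu _] := Ap _ Au.
  have m1 := cdom_nbhs cu.
  have m2 : nbhs u [set v | A (cmap c v)].
    by apply: (cmap_continuous cu); apply: open_nbhs_nbhs.
  have m3 : nbhs u [set v | B (F (cmap c v))].
    have h : nbhs (cmap c u) [set y | B (F y)].
      by apply: (vanalytic_continuous Fu); exact: open_nbhs_nbhs.
    exact: (@cmap_continuous _ _ c u cu [set y | B (F y)] h).
  by near=> v; split; near: v.
pose cm := F \o cmap c; pose ci := cinv c \o G.
(* The image is described through G rather than F, so its openness follows from continuity of G on
   B. *)
have imD : cm @` D = [set z | B z /\ A (G z)].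
  apply/seteqP; split=> [z [u [cu Au Bu] <-]|z [Bz Az]].
    by split=> //=; have [_ _ _ ->] := Ap _ Au.
  have [/cinv_image [cu e] _ _ _] := Ap _ Az; have [_ FGz] := Bp _ Bz.
  by exists (cinv c (G z)); rewrite /D /cm /= ?e ?FGz.
have oI : open (cm @` D).
  rewrite imD openE => z [Bz Az]; have [Gz _] := Bp _ Bz.
  have m1 : nbhs z B by exact: open_nbhs_nbhs.
  have m2 : nbhs z [set w | A (G w)].
    by apply: (vanalytic_continuous Gz); exact: open_nbhs_nbhs.
  by near=> w; split; near: w.
have K u : D u -> ci (cm u) = u.
  by move=> [cu Au Bu]; rewrite /ci /cm /=; have [_ _ _ ->] := Ap _ Au; rewrite cmapK.
have C1 u : D u -> {for u, continuous cm}.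
  move=> [cu Au Bu]; have [_ _ Fu _] := Ap _ Au.
  by apply: continuous_comp; [exact: cmap_continuous|exact: vanalytic_continuous].
have C2 u : D u -> {for cm u, continuous ci}.
  move=> [cu Au Bu]; have [Gu _] := Bp _ Bu; have [_ _ _ e] := Ap _ Au.
  apply: continuous_comp; first exact: vanalytic_continuous.
  by rewrite /cm /= e; exact: cinv_continuous.
exists (Chart oD oI K C1 C2); split=> /=.
- move=> c' ac'; have [t1 t2] := cc c' ac'; split=> u /=.
    move=> [cu Au Bu] cu' k; have [Gu _] := Bp _ Bu; have [_ _ _ e] := Ap _ Au.
    apply: (@analytic_vcomp _ (fun y => (cmap c' \o cinv c) y 0 k) G) => //.
    by rewrite /cm /= e; exact: t1.
  move=> cu' [cu Au Bu] k; have [_ _ Fu _] := Ap _ Au.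
  apply: (@analytic_vcomp _ (fun y => F y 0 k) (cmap c \o cinv c')); last exact: t2.
  by rewrite /= cmapK.
- by have [cu e] := cinv_image cy0; split; rewrite ?e.
- by move=> u [cu Au Bu]; have [_ Nu Fu _] := Ap _ Au.
- by [].
Unshelve. all: by end_near. Qed.

(** * Rigidity of degenerate rulings *)

Section Pencil.
Context {R : realType}.
Variables p q : 'rV[R]_8.
Hypotheses (pp : inner p p = 1) (qq : inner q q = 1) (pq : inner p q = 0)
  (wpq : omega p q = 0).
Local Notation J := (cross p q).
Implicit Types (a b d v w : 'rV[R]_8).

(** For v in the complex orthogonal of p and q, this is the complex line of v for the complex
    structure J. *)
Definition in_line v w : Prop := exists x y : R, w = x *: v + y *: J v.

Lemma in_lineD v w w' : in_line v w -> in_line v w' -> in_line v (w + w').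
Proof.
move=> [x [y ->]] [x' [y' ->]]; exists (x + x'), (y + y').
by rewrite !scalerDl addrACA.
Qed.

Lemma in_lineZ v w (k : R) : in_line v w -> in_line v (k *: w).
Proof. by move=> [x [y ->]]; exists (k * x), (k * y); rewrite scalerDr !scalerA. Qed.

Lemma in_lineB v w w' : in_line v w -> in_line v w' -> in_line v (w - w').
Proof. by move=> h h'; rewrite -scaleN1r; apply: in_lineD => //; exact: in_lineZ. Qed.

Lemma in_line_J v w : hor p q v -> in_line v w -> in_line v (J w).
Proof.
move=> hv [x [y ->]]; exists (- y), x.
by rewrite crossD3 !crossZ3 (cross_cross pp qq pq wpq hv) scalerN scaleNr addrC.
Qed.

Lemma in_line_self v : in_line v v.
Proof. by exists 1, 0; rewrite scale1r scale0r addr0. Qed.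

Lemma quadratic_coefs (A0 A1 A2 : 'rV[R]_8) : A0 + A1 + A2 = 0 -> A0 - A1 + A2 = 0 ->
  A0 + 2 *: A1 + 4 *: A2 = 0 -> A0 = 0 /\ A1 = 0.
Proof.
move=> e1 e2 e3; have H k : A0 0 k = 0 /\ A1 0 k = 0.
  have := congr1 (fun w : 'rV[R]_8 => w 0 k) e1.
  have := congr1 (fun w : 'rV[R]_8 => w 0 k) e2.
  have := congr1 (fun w : 'rV[R]_8 => w 0 k) e3.
  by rewrite !mxE => h1 h2 h3; split; lra.
by split; apply/rowP => k; rewrite mxE; have [] := H k.
Qed.

(** For a in the complex orthogonal of p and q, this is |a|^2 times the component of d orthogonal to
    a and J a; if a is nonzero, it vanishes exactly when d lies in the complex line of a. *)
Definition pencil a d : 'rV[R]_8 :=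
  inner a a *: d - inner d a *: a - inner d (J a) *: J a.

(* The pencil identity along the line [v + t a] is [t] times a quadratic
   polynomial in [t]; its two lowest coefficients are used. *)
Lemma pencil_line v a d : hor p q v -> hor p q a -> v != 0 -> d != 0 ->
  (forall t : R, pencil (v + t *: a) (t *: d) = 0) -> in_line v d /\ in_line v a.
Proof.
move=> hv ha v0 d0 H.
pose A0 := inner v v *: d - inner d v *: v - inner d (J v) *: J v.
pose A1 := (2 * inner v a) *: d - inner d v *: a - inner d a *: v
   - inner d (J v) *: J a - inner d (J a) *: J v.
pose A2 := inner a a *: d - inner d a *: a - inner d (J a) *: J a.
have E (t : R) : t *: (A0 + t *: A1 + t ^+ 2 *: A2) = 0.
  rewrite -(H t) /pencil /A0 /A1 /A2 crossD3 crossZ3.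
  rewrite !(innerDl, innerDr, innerZl, innerZr) (innerC a v).
  move: (J v) (J a) (inner v v) (inner v a) (inner a a) => Jv Ja vv va aa.
  move: (inner d v) (inner d a) (inner d Jv) (inner d Ja) => dv da dJv dJa.
  by apply/rowP => k; rewrite !mxE; ring.
have [z0 z1] : A0 = 0 /\ A1 = 0.
  clearbody A0 A1 A2; apply: (@quadratic_coefs A0 A1 A2).
  - by have := E 1; rewrite expr1n !scale1r.
  - by have := E (-1); rewrite sqrrN expr1n !scaleN1r scale1r => /eqP; rewrite oppr_eq0 => /eqP.
  - have := E 2; rewrite (_ : 2 ^+ 2 = 4 :> R); last by rewrite expr2; ring.
    by move=> /eqP; rewrite scaler_eq0 pnatr_eq0 /= => /eqP.
have dE : inner v v *: d = inner d v *: v + inner d (J v) *: J v.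
  by apply/eqP; rewrite -subr_eq0 opprD addrA; apply/eqP; exact: z0.
have vv0 : inner v v != 0 by rewrite gt_eqF // inner_gt0.
have ld : in_line v d.
  exists ((inner v v)^-1 * inner d v), ((inner v v)^-1 * inner d (J v)).
  by rewrite -!scalerA -scalerDr -dE scalerA mulVf // scale1r.
split=> //; pose x := inner d v; pose y := inner d (J v).
have lv := in_line_self v.
(* The coefficient A1 says that (x + yJ) a lies in the line of v. Since x^2 + y^2 = |v|^2 |d|^2 is
   nonzero, x + yJ can be inverted and a itself lies there. *)
have lK : in_line v (x *: a + y *: J a).
  have -> : x *: a + y *: J a = (2 * inner v a) *: d - (inner d a *: v + inner d (J a) *: J v).
    apply/eqP; rewrite -subr_eq0 -oppr_eq0 -[X in _ == X]z1 /A1 /x /y.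
    move: (J v) (J a) (inner v a) (inner d v) (inner d a) => Jv Ja va dv da.
    move: (inner d Jv) (inner d Ja) => dJv dJa.
    by apply/eqP/rowP => k; rewrite !mxE; ring.
  apply: in_lineB; first exact: in_lineZ.
  by apply: in_lineD; apply: in_lineZ => //; exact: in_line_J.
have nz : x ^+ 2 + y ^+ 2 != 0.
  have -> : x ^+ 2 + y ^+ 2 = inner v v * inner d d.
    by rewrite -innerZr dE innerDr !innerZr !expr2.
  by rewrite mulf_neq0 // gt_eqF // inner_gt0.
have E2 : x *: (x *: a + y *: J a) - y *: J (x *: a + y *: J a) = (x ^+ 2 + y ^+ 2) *: a.
  rewrite crossD3 !crossZ3 (cross_cross pp qq pq wpq ha).
  clear lK nz; clearbody x y; move: (J a) => Ja.
  by apply/rowP => k; rewrite !mxE; ring.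
have -> : a = (x ^+ 2 + y ^+ 2)^-1 *: ((x ^+ 2 + y ^+ 2) *: a).
  by rewrite scalerA mulVf // scale1r.
apply: in_lineZ; rewrite -E2; apply: in_lineB; first exact: in_lineZ.
by apply: in_lineZ; exact: in_line_J.
Qed.

End Pencil.

Definition inW (R : realType) (p q v x : 'rV[R]_8) : Prop :=
  exists a b c d : R, x = a *: p + b *: q + c *: v + d *: cross p q v.

Lemma bar_of_hor (R : realType) (p q v : 'rV[R]_8) : hor p q v -> bar p q v = v.
Proof. by move=> [h1 h2 _ _]; rewrite bar_def h1 h2 !scale0r !subr0. Qed.

Section Plane.
Context {R : realType}.
Variables p q v : 'rV[R]_8.
Hypotheses (pp : inner p p = 1) (qq : inner q q = 1) (pq : inner p q = 0)
  (wpq : omega p q = 0) (hv : hor p q v) (v0 : v != 0).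
Local Notation J := (cross p q).
Local Notation W := (inW p q v).
Local Notation nv := (inner v v).

Lemma inWD x y : W x -> W y -> W (x + y).
Proof.
move=> [a [b [c [d ->]]]] [a' [b' [c' [d' ->]]]].
exists (a + a'), (b + b'), (c + c'), (d + d'); move: (J v) => Jv.
by apply/rowP => k; rewrite !mxE; ring.
Qed.

Lemma inWZ (k : R) x : W x -> W (k *: x).
Proof.
move=> [a [b [c [d ->]]]]; exists (k * a), (k * b), (k * c), (k * d).
by rewrite !scalerDr !scalerA.
Qed.

Lemma inWN x : W x -> W (- x).
Proof. by rewrite -scaleN1r; exact: inWZ. Qed.

Lemma inWB x y : W x -> W y -> W (x - y).
Proof. by move=> hx hy; apply: inWD => //; exact: inWN. Qed.

Lemma inW_p : W p.
Proof. by exists 1, 0, 0, 0; rewrite scale1r !scale0r !addr0. Qed.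
Lemma inW_q : W q.
Proof. by exists 0, 1, 0, 0; rewrite scale1r !scale0r !addr0 add0r. Qed.
Lemma inW_v : W v.
Proof. by exists 0, 0, 1, 0; rewrite scale1r !scale0r !addr0 !add0r. Qed.
Lemma inW_Jv : W (J v).
Proof. by exists 0, 0, 0, 1; rewrite scale1r !scale0r !add0r. Qed.
Lemma inW_J x : W x -> W (J x).
Proof.
move=> [a [b [c [d ->]]]].
rewrite !crossD3 !crossZ3 cross_xyx cross_xyy (cross_cross pp qq pq wpq hv) !scaler0 !add0r.
by apply: inWD; apply: inWZ; [exact: inW_Jv|apply: inWN; exact: inW_v].
Qed.

Lemma inW_bar x : W (bar p q x) -> W x.
Proof.
move=> hx; rewrite (barE p q x); apply: inWD; last by apply: inWZ; exact: inW_q.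
by apply: inWD => //; apply: inWZ; exact: inW_p.
Qed.

Lemma inW_line x : in_line p q v (bar p q x) -> W x.
Proof.
move=> [c [d e]]; apply: inW_bar; rewrite e.
by apply: inWD; apply: inWZ; [exact: inW_v|exact: inW_Jv].
Qed.

Lemma inW_inner a b c d x : x = a *: p + b *: q + c *: v + d *: J v ->
  [/\ inner p x = a, inner q x = b, nv^-1 * inner v x = c & nv^-1 * inner (J v) x = d].
Proof.
have [h1 h2 _ _] := hv; have [k1 k2 _ _] := cross_hor p q v.
have vv : nv != 0 by rewrite gt_eqF // inner_gt0.
have e := cross_perp p q v; have n := cross_norm_hor pp qq pq wpq hv.
move=> ->; move: (J v) k1 k2 e n => Jv k1 k2 e n; split.
- by rewrite !innerDr !innerZr pp pq h1 k1 !mulr0 !addr0 mulr1.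
- by rewrite !innerDr !innerZr qq (innerC q) pq h2 k2 !mulr0 !addr0 add0r mulr1.
- rewrite !innerDr !innerZr !(innerC v) h1 h2 (innerC Jv) e !mulr0 !addr0 !add0r.
  by rewrite mulrCA mulVf // mulr1.
- rewrite !innerDr !innerZr !(innerC Jv) k1 k2 e n !mulr0 !addr0 !add0r.
  by rewrite mulrCA mulVf // mulr1.
Qed.

Lemma inW_coefs x : W x -> x = inner p x *: p + inner q x *: q
  + (nv^-1 * inner v x) *: v + (nv^-1 * inner (J v) x) *: J v.
Proof. by move=> [a [b [c [d e]]]]; have [-> -> -> ->] := inW_inner e. Qed.

Definition projW x := inner p x *: p + inner q x *: q
  + (nv^-1 * inner v x) *: v + (nv^-1 * inner (J v) x) *: J v.

Lemma inW_proj x : W (projW x).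
Proof.
by exists (inner p x), (inner q x), (nv^-1 * inner v x), (nv^-1 * inner (J v) x).
Qed.

Lemma proj_self_adjoint x y : inner (projW x) y = inner x (projW y).
Proof.
rewrite /projW !(innerDl, innerZl) !(innerDr, innerZr).
rewrite !(innerC x); ring.
Qed.

Lemma proj_id x : W x -> projW x = x.
Proof. by move=> /inW_coefs {2}->. Qed.

Lemma inW_orth x : W x -> inner p x = 0 -> inner q x = 0 -> inner v x = 0 ->
  inner (J v) x = 0 -> x = 0.
Proof. by move=> Wx h1 h2 h3 h4; rewrite (inW_coefs Wx) h1 h2 h3 h4 !mulr0 !scale0r !addr0. Qed.

Lemma omegaW x y : W x -> W y -> omega x y = 0.
Proof.
have [_ _ h3 h4] := hv; have [_ _ k3 k4] := cross_hor p q v.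
have e := omega_cross_self p q v.
move=> [a [b [c [d ->]]]] [a' [b' [c' [d' ->]]]]; move: (J v) k3 k4 e => Jv k3 k4 e.
rewrite !(omegaDl, omegaZl) !(omegaDr, omegaZr).
rewrite !omega_xx (omega_antisym p q) (omega_antisym p v) (omega_antisym p Jv).
rewrite (omega_antisym q v) (omega_antisym q Jv) (omega_antisym v Jv).
by rewrite wpq h3 h4 k3 k4 e; ring.
Qed.

(** J squares to -1 only on the complex orthogonal; components along p and q are harmless modulo
    W. *)
Lemma inW_JJ x : omega p x = 0 -> omega q x = 0 -> W (J (J x) + x).
Proof.
move=> wp wq; have hx := bar_hor pp qq pq wpq wp wq.
rewrite -(cross_bar p q x) (cross_cross pp qq pq wpq hx) {2}(barE p q x).
rewrite -addrA addKr.
by apply: inWD; apply: inWZ; [exact: inW_p|exact: inW_q].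
Qed.

(** Controls the term in which a derivative of J v falls on p. Of the basis of W, p goes to J v, q
    and v go to 0, and J v goes to a multiple of p. *)
Lemma inW_cross1 x : W x -> W (cross x q v).
Proof.
move=> [a [b [c [d ->]]]].
have -> : a *: p + b *: q + c *: v + d *: J v = a *: p + (b *: q + (c *: v + (d *: J v + 0))).
  by rewrite addr0 !addrA.
have c0 : cross 0 q v = 0.
  by have := cross_linear1 (-1) 0 0 q v; rewrite scaler0 addr0 scaleN1r addNr.
rewrite !cross_linear1 c0 cross_xxz cross_xyx (cross_Jv_q pp qq pq wpq hv) !scaler0 !add0r addr0.
apply: inWD; first by apply: inWZ; exact: inW_Jv.
by do 2!apply: inWZ; exact: inW_p.
Qed.

Lemma inW_cross2 x : W x -> W (cross p x v).
Proof.
move=> [a [b [c [d ->]]]].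
have -> : a *: p + b *: q + c *: v + d *: J v = a *: p + (b *: q + (c *: v + (d *: J v + 0))).
  by rewrite addr0 !addrA.
have c0 : cross p 0 v = 0.
  by have := cross_linear2 (-1) p 0 0 v; rewrite scaler0 addr0 scaleN1r addNr.
rewrite !cross_linear2 c0 cross_xxz cross_xyy (cross_p_Jv pp qq pq wpq hv) !scaler0 !add0r addr0.
apply: inWD; first by apply: inWZ; exact: inW_Jv.
by do 2!apply: inWZ; exact: inW_q.
Qed.

End Plane.

Lemma vanalytic_bar (R : realType) (P Q F : 'rV[R]_2 -> 'rV[R]_8) y :
  vanalytic_at P y -> vanalytic_at Q y -> vanalytic_at F y ->
  vanalytic_at (fun z => bar (P z) (Q z) (F z)) y.
Proof.
move=> Py Qy Fy; have -> : (fun z => bar (P z) (Q z) (F z)) =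
    (fun z => F z - inner (P z) (F z) *: P z - inner (Q z) (F z) *: Q z).
  by apply/funext => z; exact: bar_def.
by apply: vanalyticB; [apply: vanalyticB => //|]; apply: vanalyticZ => //; exact: inner_analytic.
Qed.

(** * Local constancy of the plane field of a degenerate ruling *)

Section Rigidity.
Context {R : realType}.
Variables (P Q X V : 'rV[R]_2 -> 'rV[R]_8) (U : set 'rV[R]_2).
Hypothesis U_open : open U.
Hypotheses (P_analytic : forall y, U y -> vanalytic_at P y)
  (Q_analytic : forall y, U y -> vanalytic_at Q y)
  (X_analytic : forall y, U y -> vanalytic_at X y)
  (V_analytic : forall y, U y -> vanalytic_at V y).
Hypotheses (PP : forall y, U y -> inner (P y) (P y) = 1)
  (QQ : forall y, U y -> inner (Q y) (Q y) = 1)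
  (PQ : forall y, U y -> inner (P y) (Q y) = 0)
  (wPQ : forall y, U y -> omega (P y) (Q y) = 0).
Local Notation J y := (cross (P y) (Q y)).
Local Notation W y := (inW (P y) (Q y) (V y)).
Hypotheses (V_hor : forall y, U y -> hor (P y) (Q y) (V y))
  (V_neq0 : forall y, U y -> V y != 0)
  (X_s : forall y, U y -> bar (P y) (Q y) (vd 0 X y) = V y)
  (X_t : forall y, U y -> bar (P y) (Q y) (vd 1 X y) = J y (V y)).
Hypotheses (W_P : forall i y, U y -> W y (vd i P y)) (W_Q : forall i y, U y -> W y (vd i Q y)).
Hypothesis nondegenerate : forall y, U y ->
  bar (P y) (Q y) (vd 1 P y) <> J y (vd 0 P y) \/
  bar (P y) (Q y) (vd 1 Q y) <> J y (vd 0 Q y).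

Lemma U_nbhs y : U y -> nbhs y U.
Proof. by move=> Uy; apply: open_nbhs_nbhs. Qed.

Lemma JV_analytic y : U y -> vanalytic_at (fun z => J z (V z)) y.
Proof.
by move=> Uy; apply: vanalytic_cross; [exact: P_analytic|exact: Q_analytic|exact: V_analytic].
Qed.

Lemma vd_JV i y : U y -> W y (vd i (fun z => J z (V z)) y - J y (vd i V y)).
Proof.
move=> Uy; have [_ ->] := cross_leibniz (P_analytic Uy) (Q_analytic Uy) (V_analytic Uy).
rewrite -addrA subrr addr0; apply: inWD.
  by apply: inW_cross1; [exact: PP|exact: QQ|exact: PQ|exact: wPQ|exact: V_hor|exact: W_P].
by apply: inW_cross2; [exact: PP|exact: QQ|exact: PQ|exact: wPQ|exact: V_hor|exact: W_Q].
Qed.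

Local Notation nV y := (inner (V y) (V y)).

Lemma nV_analytic y : U y -> analytic_at (fun z => (nV z)^-1) y.
Proof.
move=> Uy; have nz : nV y != 0 by rewrite gt_eqF // inner_gt0 //; exact: V_neq0.
by apply: (@analyticV _ (fun z => nV z)) => //; apply: inner_analytic; exact: V_analytic.
Qed.

(** Differentiating a W-valued field F = aP + bQ + cV + dJV, only derivatives of V survive modulo W,
    because those of P and Q stay in W. *)
Lemma vd_inW i F y a b c d :
  (forall z, U z -> vanalytic_at F z) -> (forall z, U z -> W z (F z)) -> U y ->
  F y = a *: P y + b *: Q y + c *: V y + d *: J y (V y) ->
  W y (vd i F y - (c *: vd i V y + d *: J y (vd i V y))).
Proof.
move=> Fa WF Uy EF.
(* The coefficients at y are replaced by inner products, which extend to analytic functions near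
   y. *)
have [_ _ <- <-] := inW_inner (PP Uy) (QQ Uy) (PQ Uy) (wPQ Uy) (V_hor Uy) (V_neq0 Uy) EF.
clear a b c d EF.
have aP := P_analytic Uy; have aQ := Q_analytic Uy; have aV := V_analytic Uy.
have aJ := JV_analytic Uy; have aF := Fa _ Uy; have an := nV_analytic Uy.
pose al z := inner (P z) (F z); pose be z := inner (Q z) (F z).
pose ga z := (nV z)^-1 * inner (V z) (F z); pose de z := (nV z)^-1 * inner (J z (V z)) (F z).
have a1 : analytic_at al y by exact: inner_analytic.
have a2 : analytic_at be y by exact: inner_analytic.
have a3 : analytic_at ga y by apply: analyticM => //; exact: inner_analytic.
have a4 : analytic_at de y by apply: analyticM => //; exact: inner_analytic.
have E : \forall z \near y, F z = al z *: P z + be z *: Q z + ga z *: V z + de z *: J z (V z).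
  apply: filterS (U_nbhs Uy) => z Uz.
  exact: (inW_coefs (PP Uz) (QQ Uz) (PQ Uz) (wPQ Uz) (V_hor Uz) (V_neq0 Uz) (WF _ Uz)).
rewrite (near_eq_vd i E).
have b1 := vanalyticZ a1 aP; have b2 := vanalyticZ a2 aQ.
have b3 := vanalyticZ a3 aV; have b4 := vanalyticZ a4 aJ.
have b12 := vanalyticD b1 b2; have b123 := vanalyticD b12 b3.
rewrite (vdD i b123 b4) (vdD i b12 b3) (vdD i b1 b2).
rewrite (vdZ i a1 aP) (vdZ i a2 aQ) (vdZ i a3 aV) (vdZ i a4 aJ) -/(ga y) -/(de y).
have h := vd_JV i Uy; have hP := W_P i Uy; have hQ := W_Q i Uy.
have -> : forall (p q v j p' q' v' j' k : 'rV[R]_8) (a a' b b' c c' d d' : R),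
  a' *: p + a *: p' + (b' *: q + b *: q') + (c' *: v + c *: v') + (d' *: j + d *: j')
  - (c *: v' + d *: k) = a' *: p + a *: p' + (b' *: q + b *: q') + (c' *: v + d' *: j)
    + d *: (j' - k).
  by move=> *; apply/rowP => l; rewrite !mxE; ring.
apply: inWD; last exact: inWZ.
apply: inWD; last by apply: inWD; apply: inWZ; [exact: inW_v|exact: inW_Jv].
apply: inWD; apply: inWD; apply: inWZ => //; [exact: inW_p|exact: inW_q].
Qed.

Lemma W_X i y : U y -> W y (vd i X y).
Proof.
move=> Uy; apply: inW_bar; case: (ord2_cases i) => ->.
  by rewrite (X_s Uy); exact: inW_v.
by rewrite (X_t Uy); exact: inW_Jv.
Qed.

(** Differentiate omega(P, V) = 0 and omega(Q, V) = 0; the other term vanishes because W is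
    isotropic. *)
Lemma omega_vd_V i y : U y -> omega (P y) (vd i V y) = 0 /\ omega (Q y) (vd i V y) = 0.
Proof.
move=> Uy; have aP := P_analytic Uy; have aQ := Q_analytic Uy; have aV := V_analytic Uy.
have z F (Fy : vanalytic_at F y) (WF : W y (vd i F y)) :
    (forall z, U z -> omega (F z) (V z) = 0) -> omega (F y) (vd i V y) = 0.
  move=> h; have := pd_omega i Fy aV.
  rewrite (omegaW (wPQ Uy) (V_hor Uy) WF (inW_v _ _ _)) add0r => <-.
  rewrite (@near_eq_pd _ i _ (fun=> 0)) ?pd_cst //.
  by apply: filterS (U_nbhs Uy) => z /h.
split; apply: z => //; [exact: W_P| |exact: W_Q|] => z Uz; by have [] := V_hor Uz.
Qed.

(** Since X_s = V and X_t = J V modulo P and Q, equality of the mixed derivatives of X gives V_t = J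
    V_s modulo W. *)
Lemma vd_V_CR y : U y -> W y (vd 1 V y - J y (vd 0 V y)).
Proof.
move=> Uy.
have aX i z : U z -> vanalytic_at (vd i X) z by move=> Uz; apply: vanalytic_vd; exact: X_analytic.
have A : W y (vd 1 (vd 0 X) y - vd 1 V y).
  have -> : vd 1 V y = 1 *: vd 1 V y + 0 *: J y (vd 1 V y) by rewrite scale1r scale0r addr0.
  apply: (@vd_inW 1 (vd 0 X) y (inner (P y) (vd 0 X y)) (inner (Q y) (vd 0 X y)) 1 0 (aX 0) (W_X 0) Uy).
  by rewrite {1}(barE (P y) (Q y) (vd 0 X y)) (X_s Uy) scale1r scale0r addr0 -addrA addrC.
have B : W y (vd 0 (vd 1 X) y - J y (vd 0 V y)).
  have -> : J y (vd 0 V y) = 0 *: vd 0 V y + 1 *: J y (vd 0 V y) by rewrite scale1r scale0r add0r.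
  apply: (@vd_inW 0 (vd 1 X) y (inner (P y) (vd 1 X y)) (inner (Q y) (vd 1 X y)) 0 1 (aX 1) (W_X 1) Uy).
  by rewrite {1}(barE (P y) (Q y) (vd 1 X y)) (X_t Uy) scale1r scale0r addr0 -addrA addrC.
rewrite (vd_comm (X_analytic Uy)) in B.
have := inWB B A; congr (inW _ _ _ _); rewrite opprB addrC.
by rewrite addrA subrK.
Qed.

(** Modulo P and Q write F_s = xV + x'JV and F_t = zV + z'JV. With V_t = J V_s, equality of mixed
    derivatives of F reads (x - z') J V_s - (x' + z) V_s = 0 modulo W. Both coefficients vanish only
    if F_t = J F_s modulo P and Q, so otherwise V_s lies in W. *)
Lemma vd_V_inW_aux F y : (forall z, U z -> vanalytic_at F z) ->
  (forall i z, U z -> W z (vd i F z)) -> U y ->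
  bar (P y) (Q y) (vd 1 F y) <> J y (vd 0 F y) -> W y (vd 0 V y).
Proof.
move=> Fa WF Uy nd; have aF i z : U z -> vanalytic_at (vd i F) z.
  by move=> Uz; apply: vanalytic_vd; exact: Fa.
have [a0 [b0 [x [x' C0]]]] := WF 0 y Uy; have [a1 [b1 [z [z' C1]]]] := WF 1 y Uy.
have B := @vd_inW 1 (vd 0 F) y _ _ _ _ (aF 0) (WF 0) Uy C0.
have A := @vd_inW 0 (vd 1 F) y _ _ _ _ (aF 1) (WF 1) Uy C1.
rewrite (vd_comm (Fa _ Uy)) in A.
have [w1 w2] := omega_vd_V 0 Uy.
have hJJ := inW_JJ (V y) (PP Uy) (QQ Uy) (PQ Uy) (wPQ Uy) w1 w2.
have CR := vd_V_CR Uy.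
have JCR := inW_J (PP Uy) (QQ Uy) (PQ Uy) (wPQ Uy) (V_hor Uy) CR.
rewrite crossD3 crossN3 in JCR.
have D : W y ((x - z') *: J y (vd 0 V y) - (x' + z) *: vd 0 V y).
  have := inWB (inWB A B) (inWD (inWZ x CR) (inWZ x' (inWD JCR hJJ))).
  congr (inW _ _ _ _).
  move: (vd 1 (vd 0 F) y) (vd 0 V y) (vd 1 V y) => g v0 v1.
  move: (J y (J y v0)) (J y v0) (J y v1) => jj j j1.
  by apply/rowP => k; rewrite !mxE; ring.
have D' := inW_J (PP Uy) (QQ Uy) (PQ Uy) (wPQ Uy) (V_hor Uy) D.
rewrite crossD3 crossN3 !crossZ3 in D'.
pose a := x - z'; pose b := x' + z.
have nz : a ^+ 2 + b ^+ 2 != 0.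
  apply/eqP => /eqP; rewrite paddr_eq0 ?sqr_ge0 // !sqrf_eq0 => /andP[/eqP az /eqP bz].
  apply: nd.
  have zE : z = - x' by apply/eqP; rewrite -addr_eq0 addrC; apply/eqP; exact: bz.
  have z'E : z' = x by apply/esym/eqP; rewrite -subr_eq0; apply/eqP; exact: az.
  transitivity (z *: V y + z' *: J y (V y)).
    rewrite C1 !barD !barZ (bar_p (PP Uy) (PQ Uy)) (bar_q (QQ Uy) (PQ Uy)) bar_cross.
    by rewrite (bar_of_hor (V_hor Uy)) !scaler0 !add0r.
  rewrite [vd 0 F y in RHS]C0 !crossD3 !crossZ3 cross_xyx cross_xyy !scaler0 !add0r.
  by rewrite (cross_cross (PP Uy) (QQ Uy) (PQ Uy) (wPQ Uy) (V_hor Uy)) zE z'E scalerN scaleNr addrC.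
have -> : vd 0 V y = (a ^+ 2 + b ^+ 2)^-1 *: ((a ^+ 2 + b ^+ 2) *: vd 0 V y).
  by rewrite scalerA mulVf // scale1r.
apply: inWZ; have := inWD (inWZ (- b) D) (inWZ (- a) (inWB D' (inWZ a hJJ))).
congr (inW _ _ _ _); rewrite -/a -/b; move: (vd 0 V y) => v0; move: (J y (J y v0)) (J y v0) => jj j.
by apply/rowP => k; rewrite !mxE; ring.
Qed.

Lemma vd_V_inW i y : U y -> W y (vd i V y).
Proof.
move=> Uy; have V0 : W y (vd 0 V y).
  have [] := nondegenerate Uy; [apply: vd_V_inW_aux P_analytic W_P Uy|].
  exact: vd_V_inW_aux Q_analytic W_Q Uy.
case: (ord2_cases i) => ->; first exact: V0.
rewrite -[vd 1 V y](subrK (J y (vd 0 V y))); apply: inWD; first exact: vd_V_CR.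
exact: (inW_J (PP Uy) (QQ Uy) (PQ Uy) (wPQ Uy) (V_hor Uy) V0).
Qed.

Definition proj_field n y := projW (P y) (Q y) (V y) n.

Lemma proj_field_analytic n y : U y -> vanalytic_at (proj_field n) y.
Proof.
move=> Uy; have aP := P_analytic Uy; have aQ := Q_analytic Uy; have aV := V_analytic Uy.
have aJ := JV_analytic Uy; have an := nV_analytic Uy; have ac := vanalytic_cst n y.
rewrite /proj_field /projW; apply: vanalyticD; last first.
  by apply: vanalyticZ => //; apply: analyticM => //; exact: inner_analytic.
apply: vanalyticD; last first.
  by apply: vanalyticZ => //; apply: analyticM => //; exact: inner_analytic.
by apply: vanalyticD; apply: vanalyticZ => //; exact: inner_analytic.
Qed.

(** The derivative lies in W, so it suffices to test it against P, Q, V and JV. For each such F both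
    F and its derivative are W-valued; differentiating <F, proj n> = <F, n> and using the same
    identity for the derivative of F leaves 0. *)
Lemma vd_proj_field i n y : U y -> vd i (proj_field n) y = 0.
Proof.
move=> Uy; have am := proj_field_analytic n Uy.
have Wm : W y (vd i (proj_field n) y).
  have [a [b [c [d C]]]] := inW_proj (P y) (Q y) (V y) n.
  have h := @vd_inW i (proj_field n) y _ _ _ _ (@proj_field_analytic n)
    (fun z _ => inW_proj (P z) (Q z) (V z) n) Uy C.
  rewrite -[vd i _ _](subrK (c *: vd i V y + d *: J y (vd i V y))).
  apply: inWD; first exact: h.
  have hV := vd_V_inW i Uy; apply: inWD; apply: inWZ; first exact: hV.
  exact: (inW_J (PP Uy) (QQ Uy) (PQ Uy) (wPQ Uy) (V_hor Uy) hV).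
have key F : vanalytic_at F y -> (forall z, U z -> W z (F z)) -> W y (vd i F y) ->
    inner (F y) (vd i (proj_field n) y) = 0.
  move=> aF WF WdF.
  have E : \forall z \near y, inner (F z) (proj_field n z) = inner (F z) n.
    apply: filterS (U_nbhs Uy) => z Uz; rewrite -proj_self_adjoint.
    by rewrite (proj_id (PP Uz) (QQ Uz) (PQ Uz) (wPQ Uz) (V_hor Uz) (V_neq0 Uz) (WF _ Uz)).
  have := near_eq_pd i E; rewrite (pd_inner i aF am) (pd_inner i aF (vanalytic_cst n y)).
  rewrite vd_cst inner0r addr0 -proj_self_adjoint.
  rewrite (proj_id (PP Uy) (QQ Uy) (PQ Uy) (wPQ Uy) (V_hor Uy) (V_neq0 Uy) WdF).
  by move=> /eqP; rewrite -subr_eq0 addrAC subrr add0r => /eqP.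
have hV := vd_V_inW i Uy.
apply: (inW_orth (PP Uy) (QQ Uy) (PQ Uy) (wPQ Uy) (V_hor Uy) (V_neq0 Uy) Wm).
- by apply: key; [exact: P_analytic|move=> z _; exact: inW_p|exact: W_P].
- by apply: key; [exact: Q_analytic|move=> z _; exact: inW_q|exact: W_Q].
- by apply: (key V); [exact: V_analytic|move=> z _; exact: inW_v|exact: hV].
- apply: (key (fun z => J z (V z))); [exact: JV_analytic|move=> z _; exact: inW_Jv|].
  rewrite -[vd i _ y](subrK (J y (vd i V y))); apply: inWD; first exact: vd_JV.
  exact: (inW_J (PP Uy) (QQ Uy) (PQ Uy) (wPQ Uy) (V_hor Uy) hV).
Qed.

Lemma proj_field_cst n y : U y -> \forall z \near y, proj_field n z = proj_field n y.
Proof.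
move=> Uy; have H : \forall z \near y, forall k, proj_field n z 0 k = proj_field n y 0 k.
  apply: (@filter_forall _ _ _ (nbhs y) _) => k.
  apply: analytic_pd0_cst; first exact: proj_field_analytic.
    apply: filterS (U_nbhs Uy) => z Uz; rewrite -vdE; last exact: proj_field_analytic.
    by rewrite vd_proj_field // mxE.
  apply: filterS (U_nbhs Uy) => z Uz; rewrite -vdE; last exact: proj_field_analytic.
  by rewrite vd_proj_field // mxE.
by apply: filterS H => z h; apply/rowP => k; exact: h.
Qed.

(** The N k, images of the standard basis under projection to the orthogonal of W at y, describe W
    by linear equations. Such equations can be continued analytically, unlike membership in a
    varying span. *)
Theorem rigidity y : U y -> exists N : 'I_8 -> 'rV[R]_8,
  (forall x, (forall k, inner x (N k) = 0) -> W y x) /\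
  \forall z \near y, forall k, [/\ inner (P z) (N k) = 0, inner (Q z) (N k) = 0 &
    inner (X z - X y) (N k) = 0].
Proof.
move=> Uy; pose e k : 'rV[R]_8 := delta_mx 0 k.
have pid z (Uz : U z) x := @proj_id _ _ _ _ (PP Uz) (QQ Uz) (PQ Uz) (wPQ Uz) (V_hor Uz) (V_neq0 Uz) x.
exists (fun k => e k - proj_field (e k) y); split.
  move=> x h; suff -> : x = proj_field x y by exact: inW_proj.
  apply/rowP => k; apply/eqP; rewrite -subr_eq0; apply/eqP.
  have ek (w : 'rV[R]_8) : inner w (e k) = w 0 k.
    rewrite /inner (bigD1 k) //= big1 ?addr0; first by rewrite /e mxE !eqxx mulr1.
    by move=> l lk; rewrite /e mxE (negPf lk) andbF mulr0.
  by have := h k; rewrite innerDr innerNr -proj_self_adjoint !ek.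
have key z n (Uz : U z) x : proj_field n z = proj_field n y -> W z x ->
    inner x (n - proj_field n y) = 0.
  move=> E Wx; rewrite -E innerDr innerNr -proj_self_adjoint (pid _ Uz _ Wx).
  by rewrite subrr.
have H : \forall z \near y, forall k, proj_field (e k) z = proj_field (e k) y.
  by apply: (@filter_forall _ _ _ (nbhs y) _) => k; exact: proj_field_cst.
have HU : \forall z \near y, U z /\ forall k, proj_field (e k) z = proj_field (e k) y.
  by apply: filterS2 (U_nbhs Uy) H => z.
have HX : \forall z \near y, forall k, inner (X z) (e k - proj_field (e k) y)
    = inner (X y) (e k - proj_field (e k) y).
  apply: (@filter_forall _ _ _ (nbhs y) _) => k.
  set n := e k - _; have D i : \forall z \near y, pd i (fun z => inner (X z) n) z = 0.
    apply: filterS HU => z [Uz E].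
    rewrite (pd_inner i (X_analytic Uz) (vanalytic_cst n z)) vd_cst inner0r addr0.
    exact: (key z _ Uz _ (E k) (W_X i Uz)).
  apply: (analytic_pd0_cst _ (D 0) (D 1)).
  exact: inner_analytic (X_analytic Uy) (vanalytic_cst n y).
apply: filterS2 HU HX => z [Uz E] EX k; split.
- by apply: (key z _ Uz _ (E k)); exact: inW_p.
- by apply: (key z _ Uz _ (E k)); exact: inW_q.
- by rewrite innerDl innerNl EX subrr.
Qed.

End Rigidity.

Lemma bar_lin (R : realType) (p q a b : 'rV[R]_8) (k l : R) :
  bar p q (k *: a + l *: b) = k *: bar p q a + l *: bar p q b.
Proof. by rewrite barD !barZ. Qed.

Lemma bar_dependent (R : realType) (p q a b : 'rV[R]_8) (k : R) :
  bar p q b = k *: bar p q a -> bar p q ((- k) *: a + 1 *: b) = 0.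
Proof. by move=> e; rewrite bar_lin e scale1r scaleNr addNr. Qed.

Section PencilTheory.
Context {R : realType}.
Variables p q : 'rV[R]_8.
Local Notation J := (cross p q).
Implicit Types a d : 'rV[R]_8.

Lemma pencil_eq0 a d : inner a a *: d = inner d a *: a + inner d (J a) *: J a -> pencil p q a d = 0.
Proof.
rewrite /pencil => ->; move: (inner d a *: a) (inner d (J a) *: J a) => x y.
by rewrite -addrA -opprD subrr.
Qed.

Lemma pencil_solve a d : a != 0 -> pencil p q a d = 0 ->
  d = ((inner a a)^-1 * inner d a) *: a + ((inner a a)^-1 * inner d (J a)) *: J a.
Proof.
move=> a0; rewrite /pencil => e; have n : inner a a != 0 by rewrite gt_eqF // inner_gt0.
rewrite -!scalerA -scalerDr; apply: (scalerI n); rewrite scalerA mulfV // scale1r.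
move: (inner d a *: a) (inner d (J a) *: J a) e => x y.
by rewrite -addrA -opprD => /eqP; rewrite subr_eq0 => /eqP.
Qed.

(** With Z = B - J A the relation becomes al Z = be J Z after cancelling y. Since Z is orthogonal to
    J Z and al is nonzero, Z vanishes. *)
Lemma beltrami_CR (A B : 'rV[R]_8) (x y al be : R) :
  inner p p = 1 -> inner q q = 1 -> inner p q = 0 -> omega p q = 0 ->
  hor p q A -> hor p q B -> y != 0 -> al != 0 ->
  (x * al - y * be) *: A + (y * al + x * be) *: B
    = x *: (al *: A + be *: B) + y *: J (al *: A + be *: B) -> B = J A.
Proof.
move=> pp qq pq wpq hA hB y0 al0; rewrite crossD3 !crossZ3 => e.
have JJA := cross_cross pp qq pq wpq hA.
pose Z := B - J A.
have e1 : al *: Z = be *: J Z.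
  rewrite /Z crossD3 crossN3 JJA; apply: (scalerI y0).
  apply/eqP; rewrite -subr_eq0; apply/eqP.
  move/eqP: e; rewrite -subr_eq0 => /eqP <-; move: (J A) (J B) => JA JB.
  by apply/rowP => k; rewrite !mxE; ring.
have : Z = 0.
  apply: inner_eq0; apply: (mulfI al0); rewrite mulr0 -innerZr e1 innerZr.
  by rewrite cross_perp mulr0.
by rewrite /Z => /eqP; rewrite subr_eq0 => /eqP.
Qed.

End PencilTheory.

Section PencilPlane.
Context {R : realType}.
Variables p q : 'rV[R]_8.
Hypotheses (pp : inner p p = 1) (qq : inner q q = 1) (pq : inner p q = 0)
  (wpq : omega p q = 0).
Local Notation J := (cross p q).
Implicit Types a d v : 'rV[R]_8.

(** J a lies in the complex line of a, so it contributes nothing. This removes the Cauchy-Riemann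
    part of d. *)
Lemma pencil_twist a d : hor p q a -> pencil p q a (d + J a) = pencil p q a d.
Proof.
move=> ha; rewrite /pencil !(innerDl d) (cross_norm_hor pp qq pq wpq ha).
rewrite (innerC (J a) a) (cross_perp p q a) addr0; move: (J a) => Ja.
by apply/rowP => k; rewrite !mxE; ring.
Qed.

Lemma pencil_lines v a1 a2 d1 d2 : hor p q v -> hor p q a1 -> hor p q a2 -> v != 0 ->
  d1 != 0 \/ d2 != 0 ->
  (forall s t : R, pencil p q (v + (s *: a1 + t *: a2)) (s *: d1 + t *: d2) = 0) ->
  [/\ in_line p q v a1, in_line p q v a2, in_line p q v d1 & in_line p q v d2].
Proof.
move=> hv h1 h2 v0; wlog d10 : a1 a2 d1 d2 h1 h2 / d1 != 0 => [wl [d10|d20] H|_ H].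
- by apply: wl => //; left.
- have H' s t : pencil p q (v + (s *: a2 + t *: a1)) (s *: d2 + t *: d1) = 0.
    by rewrite (addrC (s *: a2)) (addrC (s *: d2)); exact: H.
  by have [l2 l1 m2 m1] := wl a2 a1 d2 d1 h2 h1 d20 (or_introl d20) H'.
have [m1 l1] : in_line p q v d1 /\ in_line p q v a1.
  apply: (pencil_line pp qq pq wpq hv h1 v0 d10) => t.
  by have := H t 0; rewrite !scale0r !addr0.
have [d2z|d20] := eqVneq d2 0; last first.
  have [m2 l2] : in_line p q v d2 /\ in_line p q v a2.
    apply: (pencil_line pp qq pq wpq hv h2 v0 d20) => t.
    by have := H 0 t; rewrite !scale0r !add0r.
  by split.
(* When d2 = 0 the second direction alone gives no information on a2, so the diagonal s = t is
   used. *)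
have [_ l12] : in_line p q v d1 /\ in_line p q v (a1 + a2).
  apply: (pencil_line pp qq pq wpq hv (horD h1 h2) v0 d10) => t.
  by have := H t t; rewrite d2z scaler0 addr0 scalerDr.
have l2 : in_line p q v a2 by rewrite -(addKr a1 a2) addrC; exact: in_lineB.
by split=> //; rewrite d2z -(scale0r v); apply: in_lineZ; exact: in_line_self.
Qed.

Lemma pencil_plane v a1 a2 b1 b2 : hor p q v -> hor p q a1 -> hor p q a2 -> v != 0 ->
  b1 <> J a1 \/ b2 <> J a2 ->
  (forall s t : R, pencil p q (v + (s *: a1 + t *: a2)) (J v + (s *: b1 + t *: b2)) = 0) ->
  [/\ in_line p q v a1, in_line p q v a2, in_line p q v b1 & in_line p q v b2].
Proof.
move=> hv h1 h2 v0 nd H.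
have nd' : b1 - J a1 != 0 \/ b2 - J a2 != 0.
  by case: nd => /eqP n; [left|right]; rewrite subr_eq0.
have [s t|] := pencil_lines hv h1 h2 v0 nd'; last first.
- move=> l1 l2 m1 m2; split=> //.
    by rewrite -(subrK (J a1) b1); apply: in_lineD => //; exact: in_line_J.
  by rewrite -(subrK (J a2) b2); apply: in_lineD => //; exact: in_line_J.
have hh : hor p q (v + (s *: a1 + t *: a2)) by apply: horD => //; apply: horD; exact: horZ.
rewrite -(pencil_twist _ hh) -(H s t); congr (pencil _ _ _ _).
rewrite !crossD3 !crossZ3; move: (J v) (J a1) (J a2) => jv j1 j2.
by apply/rowP => k; rewrite !mxE; ring.
Qed.

Lemma pencil_congr a a' d d' : a = a' -> d = d' -> pencil p q a d = 0 -> pencil p q a' d' = 0.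
Proof. by move=> -> ->. Qed.

End PencilPlane.

(** Every term of omega wedge omega contains a factor in which x is paired with one of the four
    vectors. *)
Lemma Cayley_isotropic (R : realType) (x y z w : 'rV[R]_8) : omega x y = 0 -> omega x z = 0 ->
  omega x w = 0 -> Cayley x y z w = ReOmega x y z w.
Proof.
move=> xy xz xw; have [q0 q1 q2 q3] := quadE x y z w.
have X i : omega (quad x y z w (@Ordinal 4 0 isT)) (quad x y z w i) = 0.
  by move: i; rewrite q0; apply: ord4_ind; rewrite ?q0 ?q1 ?q2 ?q3 ?omega_xx.
have X' i : omega (quad x y z w i) (quad x y z w (@Ordinal 4 0 isT)) = 0.
  by rewrite omega_antisym X oppr0.
rewrite /Cayley /wedge22 big1 ?mulr0 ?add0r // => s _.
have : s (s^-1%g (@Ordinal 4 0 isT)) = @Ordinal 4 0 isT by rewrite permKV.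
by move: (s^-1%g _); apply: ord4_ind => ->; rewrite ?X ?X' ?mulr0 ?mul0r.
Qed.

(** The interior of the zero set is open, nonempty, and closed by [analytic_near0_closure], so it is
    the whole connected surface. *)
Lemma identity_theorem (R : realType) (S : analyticSurface R) (f : S -> R) (u1 : S) :
  connected [set: S] -> (forall c, atlas c -> analytic_on_chart c f) ->
  (\forall u \near u1, f u = 0) -> forall u, f u = 0.
Proof.
move=> Sc fa f1; pose B := [set u | f u = 0]^°.
suff BT : B = [set: S].
  by move=> u; have : B u by [rewrite BT|]; exact: nbhs_singleton.
apply: Sc; first by exists u1.
  by exists B; [exact: open_interior|rewrite setTI].
exists B; last by rewrite setTI.
move=> u clu; have [c ac cu] := atlas_cover u.
have key : near0 (f \o cinv c) (cmap c u).
  apply: analytic_near0_closure; first exact: fa.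
  move=> A nA; have nA' : nbhs u (cdom c `&` [set v | A (cmap c v)]).
    by apply: filterI; [exact: cdom_nbhs|exact: (cmap_continuous cu) _ nA].
  have [v [Bv [cv Av]]] := clu _ nA'.
  by exists (cmap c v); split=> //; exact: (near_cinv_in cv Bv).
have h : nbhs u [set v | (f \o cinv c) (cmap c v) = 0] := cmap_continuous cu key.
apply: filterS2 h (cdom_nbhs cu) => v /= e cv.
by rewrite cmapK in e.
Qed.

Lemma near_neq0 (R : realType) (f : 'rV[R]_2 -> R) x : analytic_at f x -> f x != 0 ->
  \forall y \near x, f y != 0.
Proof.
move=> fx f0; have m : nbhs (f x) [set z : R | z != 0].
  by apply: open_nbhs_nbhs; split; [exact: open_neq|].
exact: (analytic_continuous fx) _ m.
Qed.

(** * From special Lagrangian to the equations *)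

Section Forward.
Context {R : realType} {S : analyticSurface R}.
Variables phi1 phi2 psi : S -> 'rV[R]_8.
Hypotheses (phi1_analytic : analytic_map phi1) (phi2_analytic : analytic_map phi2)
  (psi_analytic : analytic_map psi).
Hypotheses (phi1_unit : forall u, inner (phi1 u) (phi1 u) = 1)
  (phi2_unit : forall u, inner (phi2 u) (phi2 u) = 1)
  (phi_orthogonal : forall u, inner (phi1 u) (phi2 u) = 0).
Hypothesis M_singularities : singularities_nowhere_dense phi1 phi2 psi.
Implicit Types (c : chart R S) (u : S) (r : 'rV[R]_2).
Local Notation iota := (iota_M phi1 phi2 psi).
Local Notation frame := (frame phi1 phi2 psi).
Local Notation immersion := (immersion_at phi1 phi2 psi).
Local Notation barU u := (bar (phi1 u) (phi2 u)).
Local Notation J u := (cross (phi1 u) (phi2 u)).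

(** If h were nonzero at r, it would be so on a neighbourhood consisting of singular points, against
    nowhere density. *)
Lemma immersion_dense u (h : 'rV[R]_2 -> R) : (forall r, analytic_at h r) ->
  (forall r, immersion (r, u) -> h r = 0) -> forall r, h r = 0.
Proof.
move=> ha hz r; apply: contrapT => hr.
have n : nbhs r [set s | h s != 0] by apply: near_neq0 => //; apply/eqP.
have : (closure [set s | ~ immersion (s, u)])^° r.
  apply: filterS n => s /eqP hs; apply: subset_closure => im.
  by apply: hs; exact: hz.
by rewrite (M_singularities u).
Qed.

Lemma immersion_exists u : exists r, immersion (r, u).
Proof.
apply: contrapT => h; have := @immersion_dense u (fun=> 1) (fun r => analytic_cst 1 r).
move=> /(_ _ 0) z; have : (1 : R) = 0 by apply: z => r im; exfalso; apply: h; exists r.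
by move=> /eqP; rewrite oner_eq0.
Qed.

Lemma pv_iota_analytic i c u r : coordinates c -> cdom c u ->
  vanalytic_at (fun s => pv i c (iota s) u) r.
Proof.
move=> cc cu; have -> : (fun s => pv i c (iota s) u) = (fun s : 'rV[R]_2 =>
    s 0 0 *: pv i c phi1 u + s 0 1 *: pv i c phi2 u + pv i c psi u).
  by apply/funext => s; exact: pv_iota.
apply: vanalyticD; last exact: vanalytic_cst.
by apply: vanalyticD; apply: vanalyticZ; (exact: vanalytic_cst || exact: analytic_coord).
Qed.

Hypothesis SL : special_lagrangian phi1 phi2 psi.

Lemma sl_immersion c u r : coordinates c -> cdom c u -> immersion (r, u) ->
  [/\ omega (phi1 u) (phi2 u) = 0,
    (forall i, omega (phi1 u) (pv i c (iota r) u) = 0 /\ omega (phi2 u) (pv i c (iota r) u) = 0) &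
    pencil (phi1 u) (phi2 u) (barU u (pv 0 c (iota r) u)) (barU u (pv 1 c (iota r) u)) = 0].
Proof.
move=> cc cu im; have [E [E1 E2 _] cal] := SL; have [d ad du] := atlas_cover u.
have dd := atlas_coordinates ad; have TE := E2 _ _ im ad du.
rewrite (tangentE phi1_analytic phi2_analytic psi_analytic r dd du) in TE.
have FE := eqmx_trans (frame_coord_eqmx phi1_analytic phi2_analytic psi_analytic r cc dd cu du)
  (eqmx_sym TE).
have [w wa wb _ e] := sl_plane (E1 _ im) (cal _ im) (phi1_unit u) (phi2_unit u) (phi_orthogonal u) FE.
split; [exact: w| |].
  by move=> i; case: (ord2_cases i) => ->; [exact: wa|exact: wb].
exact: pencil_eq0 e.
Qed.

Lemma sl_omega u : omega (phi1 u) (phi2 u) = 0.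
Proof.
have [r im] := immersion_exists u; have [c ac cu] := atlas_cover u.
by have [] := sl_immersion (atlas_coordinates ac) cu im.
Qed.

Lemma sl_omega_iota c u i r : coordinates c -> cdom c u ->
  omega (phi1 u) (pv i c (iota r) u) = 0 /\ omega (phi2 u) (pv i c (iota r) u) = 0.
Proof.
move=> cc cu.
have key (p : 'rV[R]_8) : (forall s, immersion (s, u) -> omega p (pv i c (iota s) u) = 0) ->
    omega p (pv i c (iota r) u) = 0.
  move=> h; move: r; apply: (@immersion_dense u (fun s => omega p (pv i c (iota s) u))) => // s.
  apply: (@analytic_eq _ (fun s => inner (ci p) (pv i c (iota s) u))).
    by move=> s'; rewrite omega_ci.
  by apply: inner_analytic; [exact: vanalytic_cst|exact: pv_iota_analytic].
by split; apply: key => s im; have [_ h _] := sl_immersion cc cu im; have [] := h i.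
Qed.

Lemma sl_pencil c u r : coordinates c -> cdom c u ->
  pencil (phi1 u) (phi2 u) (barU u (pv 0 c (iota r) u)) (barU u (pv 1 c (iota r) u)) = 0.
Proof.
move=> cc cu; pose a i s := barU u (pv i c (iota s) u).
have aa i s : vanalytic_at (a i) s.
  by apply: vanalytic_bar; [exact: vanalytic_cst|exact: vanalytic_cst|exact: pv_iota_analytic].
have aj i s : vanalytic_at (fun s => J u (a i s)) s.
  by apply: vanalytic_cross; [exact: vanalytic_cst|exact: vanalytic_cst|exact: aa].
have ap s : vanalytic_at (fun s => pencil (phi1 u) (phi2 u) (a 0 s) (a 1 s)) s.
  rewrite /pencil; apply: vanalyticB; [apply: vanalyticB|]; apply: vanalyticZ;
  by [apply: inner_analytic; (exact: aa || exact: aj)|exact: aa|exact: aj].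
apply/rowP => k; rewrite [RHS]mxE.
move: r; apply: (@immersion_dense u (fun s => pencil (phi1 u) (phi2 u) (a 0 s) (a 1 s) 0 k)).
  by move=> s; exact: ap.
by move=> s im; have [_ _ e] := sl_immersion cc cu im; rewrite /a e mxE.
Qed.

Lemma sl_hor c u i r : coordinates c -> cdom c u ->
  hor (phi1 u) (phi2 u) (barU u (pv i c (iota r) u)).
Proof.
move=> cc cu; have [w1 w2] := sl_omega_iota i r cc cu.
exact: (bar_hor (phi1_unit u) (phi2_unit u) (phi_orthogonal u) (sl_omega u) w1 w2).
Qed.

(** The pencil identity for [iota r0] provides X and Y, and a solution of the Beltrami equation
    gives the new coordinates; the isothermal relation then follows from [beltrami_CR]. *)
Lemma isothermal_coordinates u0 : exists c r0, [/\ coordinates c, cdom c u0 &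
  forall u, cdom c u -> barU u (pv 0 c (iota r0) u) != 0 /\
    barU u (pv 1 c (iota r0) u) = J u (barU u (pv 0 c (iota r0) u))].
Proof.
have [r0 im] := immersion_exists u0; have [c0 ac0 cu0] := atlas_cover u0.
have cc0 := atlas_coordinates ac0.
have chia : analytic_map (iota r0) := iota_analytic phi1_analytic phi2_analytic psi_analytic r0.
pose P := phi1 \o cinv c0; pose Q := phi2 \o cinv c0; pose y0 := cmap c0 u0.
pose a i y := bar (P y) (Q y) (vd i (iota r0 \o cinv c0) y).
pose X y := (inner (a 0 y) (a 0 y))^-1 * inner (a 1 y) (a 0 y).
pose Y y := (inner (a 0 y) (a 0 y))^-1 * inner (a 1 y) (cross (P y) (Q y) (a 0 y)).
have aE i u : cdom c0 u -> a i (cmap c0 u) = barU u (pv i c0 (iota r0) u).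
  by move=> cu; rewrite /a /P /Q /= (cmapK cu) pvE.
have PE u : cdom c0 u -> P (cmap c0 u) = phi1 u by move=> cu; rewrite /P /= cmapK.
have QE u : cdom c0 u -> Q (cmap c0 u) = phi2 u by move=> cu; rewrite /Q /= cmapK.
have fr := (immersion_frame phi1_analytic phi2_analytic psi_analytic r0 cc0 cu0).1 im.
have a0 : a 0 y0 != 0 by rewrite /y0 (aE 0 _ cu0); exact: rows4_free_bar fr.
have bE u : cdom c0 u -> a 0 (cmap c0 u) != 0 ->
    a 1 (cmap c0 u) = X (cmap c0 u) *: a 0 (cmap c0 u) + Y (cmap c0 u) *: J u (a 0 (cmap c0 u)).
  move=> cu; rewrite /X /Y (PE _ cu) (QE _ cu) (aE 0 _ cu) (aE 1 _ cu) => n0.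
  exact: (pencil_solve n0 (sl_pencil r0 cc0 cu)).
(* If Y vanished, bar chi_t would be a multiple of bar chi_s, contradicting the immersion at (r0,
   u0). This Y is the Jacobian of the coordinate change at y0. *)
have Y0 : Y y0 != 0.
  apply/eqP => Yz; have := bE _ cu0 a0; rewrite -/y0 Yz scale0r addr0 => h.
  rewrite /y0 (aE 0 _ cu0) (aE 1 _ cu0) in h.
  have [_ /eqP] := rows4_free_bar_comb fr (bar_dependent h).
  by rewrite oner_eq0.
have aP : vanalytic_at P y0 by exact: phi1_analytic.
have aQ : vanalytic_at Q y0 by exact: phi2_analytic.
have aa i : vanalytic_at (a i) y0.
  by apply: vanalytic_bar => //; apply: vanalytic_vd; exact: chia.
have n0 : inner (a 0 y0) (a 0 y0) != 0 by rewrite gt_eqF // inner_gt0.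
have an : analytic_at (fun y => inner (a 0 y) (a 0 y)) y0 by exact: inner_analytic.
have aX : analytic_at X y0.
  by apply: analyticM; [exact: analyticV n0 an|exact: inner_analytic].
have aY : analytic_at Y y0.
  apply: analyticM; first exact: analyticV n0 an.
  by apply: inner_analytic => //; apply: vanalytic_cross.
have [u1 [v1 [au av u10 v10 [E1 E2]]]] := beltrami_solution aX aY.
pose F y : 'rV[R]_2 := pt (u1 y) (v1 y).
have F0 : (fun z => F z 0 0) = u1 by apply/funext => z; rewrite /F pt0.
have F1 : (fun z => F z 0 1) = v1 by apply/funext => z; rewrite /F pt1.
have Fa : vanalytic_at F y0.
  by move=> k; case: (ord2_cases k) => ->; rewrite ?F0 ?F1.
have [G [Ga GF FG]] : exists G, [/\ vanalytic_at G (F y0), \forall z \near y0, G (F z) = z &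
    \forall z \near F y0, F (G z) = z].
  apply: inverse_function => //; rewrite F0 F1 u10 v10 mulr0 subr0 mul1r.
  by rewrite (nbhs_singleton E2) u10 v10 mulr0 addr0 mulr1.
pose N := [set y | [/\ inner (a 0 y) (a 0 y) != 0, Y y != 0, pd 0 u1 y != 0 &
  pd 1 u1 y = X y * pd 0 u1 y - Y y * pd 0 v1 y /\ pd 1 v1 y = Y y * pd 0 u1 y + X y * pd 0 v1 y]].
have Ny0 : nbhs y0 N.
  have m3 : \forall y \near y0, pd 0 u1 y != 0.
    by apply: near_neq0; [exact: analytic_pd|rewrite u10 oner_eq0].
  apply: filterS2 (filterI (near_neq0 an n0) (near_neq0 aY Y0)) (filterI m3 (filterI E1 E2)).
  by move=> y [h1 h2] [h3 [h4 h5]]; split.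
have cy0 : (cmap c0 @` cdom c0) y0 by exists u0.
have [c1 [cc1 c1u0 c1P c1E]] := chart_change cc0 cy0 Ny0 Fa Ga GF FG.
exists c1, r0; split; [exact: cc1|by rewrite -(cmapK cu0)|].
move=> u cu1; have [cu Nu Fu] := c1P u cu1.
have tr : transition_analytic c0 c1 by have [] := cc1 c0 ac0.
have T i k : vd i (cmap c1 \o cinv c0) (cmap c0 u) 0 k = pd i (fun z => F z 0 k) (cmap c0 u).
  rewrite (@near_eq_vd _ _ i _ F) ?vdE //.
  by apply: filterS (near_cinv cu) => z [_ e]; rewrite /= c1E /= e.
have D i : a i (cmap c0 u) = pd i u1 (cmap c0 u) *: barU u (pv 0 c1 (iota r0) u)
    + pd i v1 (cmap c0 u) *: barU u (pv 1 c1 (iota r0) u).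
  rewrite (aE i _ cu) (pv_change i chia cc1 tr cu cu1) (T i 0) (T i 1) F0 F1; exact: bar_lin.
have [nz Yz uz [e1 e2]] := Nu.
have nz' : a 0 (cmap c0 u) != 0.
  by apply: contra nz => /eqP ->; rewrite inner0l.
have B := bE u cu nz'; rewrite (D 1) (D 0) e1 e2 in B.
have CR := beltrami_CR (phi1_unit u) (phi2_unit u) (phi_orthogonal u) (sl_omega u)
  (sl_hor 0 r0 cc1 cu1) (sl_hor 1 r0 cc1 cu1) Yz uz B.
split; last exact: CR.
(* If the new s-derivative vanished, so would the t-derivative, its image under J, and then the old
   s-derivative as well. *)
by apply: contra nz' => /eqP z; rewrite (D 0) CR z cross03 !scaler0 addr0.
Qed.

Lemma sl_omega_phi c u i : coordinates c -> cdom c u ->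
  [/\ omega (phi1 u) (pv i c phi1 u) = 0, omega (phi1 u) (pv i c phi2 u) = 0,
    omega (phi2 u) (pv i c phi1 u) = 0, omega (phi2 u) (pv i c phi2 u) = 0 &
    omega (phi1 u) (pv i c psi u) = 0 /\ omega (phi2 u) (pv i c psi u) = 0].
Proof.
move=> cc cu; have H r := sl_omega_iota i r cc cu.
have K (p : 'rV[R]_8) : (forall r, omega p (pv i c (iota r) u) = 0) ->
    [/\ omega p (pv i c phi1 u) = 0, omega p (pv i c phi2 u) = 0 & omega p (pv i c psi u) = 0].
  move=> h; have h' (s t : R) : s * omega p (pv i c phi1 u) + t * omega p (pv i c phi2 u)
      + omega p (pv i c psi u) = 0.
    have := h (pt s t); rewrite (pv_iota phi1_analytic phi2_analytic psi_analytic i _ cc cu).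
    by rewrite pt0 pt1 (omegaDr p (_ + _)) (omegaDr p) !omegaZr.
  move: (omega p (pv i c phi1 u)) (omega p (pv i c phi2 u)) (omega p (pv i c psi u)) h' => x y z h'.
  have := h' 0 0; have := h' 1 0; have := h' 0 1.
  by rewrite !mul0r !mul1r !addr0 !add0r => e1 e2 z0; move: e1 e2; rewrite z0 !addr0 => -> ->.
have [a1 a2 a3] := K (phi1 u) (fun r => (H r).1).
by have [b1 b2 b3] := K (phi2 u) (fun r => (H r).2).
Qed.

Section Isothermal.
Variables (c : chart R S) (r0 : 'rV[R]_2).
Hypothesis cc : coordinates c.
Hypothesis iso : forall u, cdom c u -> barU u (pv 0 c (iota r0) u) != 0 /\
    barU u (pv 1 c (iota r0) u) = J u (barU u (pv 0 c (iota r0) u)).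

Lemma degenerate_lines u : cdom c u ->
  barU u (pv 1 c phi1 u) <> J u (pv 0 c phi1 u) \/
  barU u (pv 1 c phi2 u) <> J u (pv 0 c phi2 u) ->
  forall i, in_line (phi1 u) (phi2 u) (barU u (pv 0 c (iota r0) u)) (barU u (pv i c phi1 u)) /\
    in_line (phi1 u) (phi2 u) (barU u (pv 0 c (iota r0) u)) (barU u (pv i c phi2 u)).
Proof.
rewrite -(cross_bar _ _ (pv 0 c phi1 u)) -(cross_bar _ _ (pv 0 c phi2 u)) => cu nd; have [v0 CR] := iso cu.
have pp := phi1_unit u; have qq := phi2_unit u; have pq := phi_orthogonal u; have wpq := sl_omega u.
have hv := sl_hor 0 r0 cc cu.
have [w1 w2 w3 w4 _] := sl_omega_phi 0 cc cu.
have h1 := bar_hor pp qq pq wpq w1 w3; have h2 := bar_hor pp qq pq wpq w2 w4.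
have H (s t : R) : pencil (phi1 u) (phi2 u)
    (barU u (pv 0 c (iota r0) u) + (s *: barU u (pv 0 c phi1 u) + t *: barU u (pv 0 c phi2 u)))
    (J u (barU u (pv 0 c (iota r0) u)) + (s *: barU u (pv 1 c phi1 u) + t *: barU u (pv 1 c phi2 u))) = 0.
  (* Moving r away from r0 by (s, t) moves the derivatives affinely, which turns [sl_pencil] into
     the two-parameter family of [pencil_plane]. *)
  have E i : barU u (pv i c (iota (pt (r0 0 0 + s) (r0 0 1 + t))) u) =
      barU u (pv i c (iota r0) u) + (s *: barU u (pv i c phi1 u) + t *: barU u (pv i c phi2 u)).
    rewrite !(pv_iota phi1_analytic phi2_analytic psi_analytic i _ cc cu) pt0 pt1.
    move: (pv i c phi1 u) (pv i c phi2 u) (pv i c psi u) => x y z.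
    rewrite -bar_lin -barD; congr (bar _ _ _).
    by apply/rowP => k; rewrite !mxE; ring.
  exact: (pencil_congr (E 0) (eq_trans (E 1) (congr1 (fun w => w + _) CR))
    (sl_pencil (pt (r0 0 0 + s) (r0 0 1 + t)) cc cu)).
have [l1 l2 m1 m2] := pencil_plane pp qq pq wpq hv h1 h2 v0 nd H.
move=> i; case: (ord2_cases i) => ->; split; [exact: l1|exact: l2|exact: m1|exact: m2].
Qed.

Lemma degenerate_planar u1 : connected [set: S] -> cdom c u1 ->
  barU u1 (pv 1 c phi1 u1) <> J u1 (pv 0 c phi1 u1) \/
  barU u1 (pv 1 c phi2 u1) <> J u1 (pv 0 c phi2 u1) -> planar phi1 phi2 psi.
Proof.
move=> Sc cu1 nd1; pose y1 := cmap c u1.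
have chia : analytic_map (iota r0) := iota_analytic phi1_analytic phi2_analytic psi_analytic r0.
pose P := phi1 \o cinv c; pose Q := phi2 \o cinv c; pose X := iota r0 \o cinv c.
pose V y := bar (P y) (Q y) (vd 0 X y).
pose D (F : 'rV[R]_2 -> 'rV[R]_8) y := bar (P y) (Q y) (vd 1 F y) - cross (P y) (Q y) (vd 0 F y).
(* A sum of squares makes failure of either equation a single analytic condition, hence an open
   one. *)
pose nd y := inner (D P y) (D P y) + inner (D Q y) (D Q y).
pose U := [set y | (cmap c @` cdom c) y /\ nd y != 0]^°.
have Ui y : U y -> (cmap c @` cdom c) y /\ nd y != 0 by exact: nbhs_singleton.
have E m (f : S -> 'rV[R]_m) i u : cdom c u -> vd i (f \o cinv c) (cmap c u) = pv i c f u.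
  by move=> _; rewrite pvE.
have aP u : cdom c u -> vanalytic_at P (cmap c u) by move=> cu; exact: analytic_in_coordinates.
have aQ u : cdom c u -> vanalytic_at Q (cmap c u) by move=> cu; exact: analytic_in_coordinates.
have aX u : cdom c u -> vanalytic_at X (cmap c u) by move=> cu; exact: analytic_in_coordinates.
have aV u : cdom c u -> vanalytic_at V (cmap c u).
  by move=> cu; apply: vanalytic_bar; [exact: aP|exact: aQ|apply: vanalytic_vd; exact: aX].
have PE u : cdom c u -> P (cmap c u) = phi1 u by move=> cu; rewrite /P /= cmapK.
have QE u : cdom c u -> Q (cmap c u) = phi2 u by move=> cu; rewrite /Q /= cmapK.
have VE u : cdom c u -> V (cmap c u) = barU u (pv 0 c (iota r0) u).
  by move=> cu; rewrite /V (PE _ cu) (QE _ cu) -(E _ _ _ _ cu).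
have DP u : cdom c u -> D P (cmap c u) = barU u (pv 1 c phi1 u) - J u (pv 0 c phi1 u).
  by move=> cu; rewrite /D (PE _ cu) (QE _ cu) -!(E _ _ _ _ cu).
have DQ u : cdom c u -> D Q (cmap c u) = barU u (pv 1 c phi2 u) - J u (pv 0 c phi2 u).
  by move=> cu; rewrite /D (PE _ cu) (QE _ cu) -!(E _ _ _ _ cu).
have aD F : vanalytic_at F y1 -> vanalytic_at (D F) y1.
  move=> aF; apply: vanalyticB.
    by apply: vanalytic_bar; [exact: aP|exact: aQ|exact: vanalytic_vd].
  by apply: vanalytic_cross; [exact: aP|exact: aQ|exact: vanalytic_vd].
have and_ : analytic_at nd y1.
  by apply: analyticD; apply: inner_analytic; apply: aD; (exact: aP || exact: aQ).
have sub0 (x y : 'rV[R]_8) : x <> y -> 0 < inner (x - y) (x - y).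
  by move=> /eqP n; apply: inner_gt0; rewrite subr_eq0.
have nd0 : nd y1 != 0.
  rewrite gt_eqF // /nd /y1 (DP _ cu1) (DQ _ cu1).
  case: nd1 => n; first by apply: ltr_pwDl; [exact: sub0|exact: inner_ge0].
  by apply: ltr_wpDl; [exact: inner_ge0|exact: sub0].
have Uy1 : U y1 by exact: (filterI (cmap_image_nbhs cu1) (near_neq0 and_ nd0)).
have ndU u : cdom c u -> nd (cmap c u) != 0 -> barU u (pv 1 c phi1 u) <> J u (pv 0 c phi1 u) \/
    barU u (pv 1 c phi2 u) <> J u (pv 0 c phi2 u).
  move=> cu n; apply: contrapT => /not_orP[/contrapT e1 /contrapT e2].
  have z1 : D P (cmap c u) = 0 by rewrite (DP _ cu); apply/eqP; rewrite subr_eq0; apply/eqP; exact: e1.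
  have z2 : D Q (cmap c u) = 0 by rewrite (DQ _ cu); apply/eqP; rewrite subr_eq0; apply/eqP; exact: e2.
  by move/eqP: n; apply; rewrite /nd z1 z2 inner0l addr0.
have R1 (A : 'rV[R]_2 -> Prop) : (forall u, cdom c u -> nd (cmap c u) != 0 -> A (cmap c u)) ->
    forall y, U y -> A y.
  by move=> h y /Ui[[u cu <-] n]; exact: h.
have RW phi : (forall u, cdom c u -> nd (cmap c u) != 0 -> forall i,
    in_line (phi1 u) (phi2 u) (barU u (pv 0 c (iota r0) u)) (barU u (pv i c phi u))) ->
    forall i y, U y -> inW (P y) (Q y) (V y) (vd i (phi \o cinv c) y).
  move=> h i; apply: R1 => u cu n; rewrite (PE _ cu) (QE _ cu) (VE _ cu) (E _ _ _ _ cu).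
  by apply: inW_line; exact: h.
have [N [NW NZ]] : exists N : 'I_8 -> 'rV[R]_8,
  (forall x, (forall k, inner x (N k) = 0) -> inW (P y1) (Q y1) (V y1) x) /\
  \forall z \near y1, forall k, [/\ inner (P z) (N k) = 0, inner (Q z) (N k) = 0 &
    inner (X z - X y1) (N k) = 0].
  apply: (@rigidity R P Q X V U) Uy1.
  - exact: open_interior.
  - by apply: R1 => u cu _; exact: aP.
  - by apply: R1 => u cu _; exact: aQ.
  - by apply: R1 => u cu _; exact: aX.
  - by apply: R1 => u cu _; exact: aV.
  - by apply: R1 => u cu _; rewrite (PE _ cu).
  - by apply: R1 => u cu _; rewrite (QE _ cu).
  - by apply: R1 => u cu _; rewrite (PE _ cu) (QE _ cu).
  - by apply: R1 => u cu _; rewrite (PE _ cu) (QE _ cu); exact: sl_omega.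
  - by apply: R1 => u cu _; rewrite (PE _ cu) (QE _ cu) (VE _ cu); exact: sl_hor.
  - by apply: R1 => u cu _; rewrite (VE _ cu); exact: (iso cu).1.
  - by [].
  - by apply: R1 => u cu _; rewrite (PE _ cu) (QE _ cu) (VE _ cu) (E _ _ _ _ cu); exact: (iso cu).2.
  - by apply: RW => u cu n i; have [] := degenerate_lines cu (ndU _ cu n) i.
  - by apply: RW => u cu n i; have [] := degenerate_lines cu (ndU _ cu n) i.
  - by apply: R1 => u cu n; rewrite (PE _ cu) (QE _ cu) !(E _ _ _ _ cu); exact: ndU.
have Z (f : S -> 'rV[R]_8) (k : 'I_8) : analytic_map f ->
    (\forall z \near y1, inner (f (cinv c z)) (N k) = 0) -> forall u, inner (f u) (N k) = 0.
  move=> fa fz; apply: (identity_theorem Sc (u1 := u1)).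
    by move=> d ad u du; apply: inner_analytic; [exact: fa|exact: vanalytic_cst].
  have h : nbhs u1 [set v | inner (f (cinv c (cmap c v))) (N k) = 0] := cmap_continuous cu1 fz.
  apply: filterS2 h (cdom_nbhs cu1) => v /= e cv.
  by rewrite cmapK in e.
have Z1 k : forall u, inner (phi1 u) (N k) = 0.
  by apply: Z => //; apply: filterS NZ => z /(_ k)[].
have Z2 k : forall u, inner (phi2 u) (N k) = 0.
  by apply: Z => //; apply: filterS NZ => z /(_ k)[].
have ZX k : forall u, inner (iota r0 u - iota r0 u1) (N k) = 0.
  apply: (Z (fun u => iota r0 u - iota r0 u1)).
    by move=> d u ad du; apply: vanalyticB; [exact: chia|exact: vanalytic_cst].
  by apply: filterS NZ => z /(_ k)[_ _]; rewrite /X /y1 /= cmapK.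
exists (iota r0 u1), (rows4 (P y1) (Q y1) (V y1) (cross (P y1) (Q y1) (V y1))); split.
  rewrite /y1 (PE _ cu1) (QE _ cu1) (VE _ cu1).
  have hv := sl_hor 0 r0 cc cu1; have [v0 _] := iso cu1.
  have [h1 h2 _ _] := hv; have [k1 k2 _ _] := cross_hor (phi1 u1) (phi2 u1) (barU u1 (pv 0 c (iota r0) u1)).
  apply: rows4_free.
  - exact: phi_orthogonal.
  - exact: h1.
  - exact: h2.
  - exact: k1.
  - exact: k2.
  - exact: cross_perp.
  - exact: unit_neq0 (phi1_unit u1).
  - exact: unit_neq0 (phi2_unit u1).
  - exact: v0.
  - have n := cross_norm_hor (phi1_unit u1) (phi2_unit u1) (phi_orthogonal u1) (sl_omega u1) hv.
    apply/eqP => z; move: v0; rewrite -[_ == 0]negbK => /negP; apply.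
    by apply/negPn/eqP; apply: inner_eq0; rewrite -n z inner0l.
(* Changing r0 to r adds multiples of phi1 and phi2, which all the N k annihilate. *)
move=> r u; have : inW (P y1) (Q y1) (V y1) (iota r u - iota r0 u1).
  apply: NW => k; have := ZX k u; have := Z1 k u; have := Z2 k u.
  rewrite /iota_M !innerE => z2 z1; rewrite z1 z2 (Z1 k u1) (Z2 k u1) !mulr0 !add0r.
  by [].
by move=> [x [y [z [w ->]]]]; exact: sub_rows4.
Qed.

Lemma inner_cst_pv (f g : S -> 'rV[R]_8) (k : R) i u : analytic_map f -> analytic_map g ->
  (forall v, inner (f v) (g v) = k) -> cdom c u ->
  inner (pv i c f u) (g u) + inner (f u) (pv i c g u) = 0.
Proof.
move=> fa ga h cu; have := pd_inner i (analytic_in_coordinates fa cc cu) (analytic_in_coordinates ga cc cu).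
rewrite -!pvE /= (cmapK cu) => <-.
by rewrite (_ : (fun z => _) = (fun=> k)) ?pd_cst //; apply/funext => z; exact: h.
Qed.

Lemma inner_pv_analytic (f g : S -> 'rV[R]_8) i : analytic_map f -> analytic_map g ->
  analytic_on_chart c (fun u => inner (f u) (pv i c g u)).
Proof.
move=> fa ga u cu.
apply: (@analytic_near_eq _ (fun y => inner ((f \o cinv c) y) (vd i (g \o cinv c) y))).
  by apply: filterS (near_cinv cu) => y [_ e]; rewrite /= pvE e.
by apply: inner_analytic; [|apply: vanalytic_vd]; exact: analytic_in_coordinates.
Qed.

Local Notation ft := (fun u => inner (phi2 u) (pv 1 c phi1 u)).
Local Notation g1t := (fun u => inner (phi1 u) (pv 1 c psi u)).
Local Notation g2t := (fun u => inner (phi2 u) (pv 1 c psi u)).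

Lemma isothermal_equations u : connected [set: S] -> ~ planar phi1 phi2 psi -> cdom c u ->
  sl_equations phi1 phi2 psi c ft g1t g2t u.
Proof.
move=> Sc npl cu; have [w1 w2 w3 w4 w5] := sl_omega_phi 0 cc cu.
have [d1 d2] : barU u (pv 1 c phi1 u) = J u (pv 0 c phi1 u) /\
    barU u (pv 1 c phi2 u) = J u (pv 0 c phi2 u).
  have : ~ (barU u (pv 1 c phi1 u) <> J u (pv 0 c phi1 u) \/
    barU u (pv 1 c phi2 u) <> J u (pv 0 c phi2 u)).
    by move=> nd; apply: npl; exact: degenerate_planar Sc cu nd.
  by move=> /not_orP[/contrapT e1 /contrapT e2].
(* The isothermal relation holds for [iota r0] and now for phi1 and phi2; subtracting the latter
   leaves it for psi. *)
have d3 : barU u (pv 1 c psi u) = J u (pv 0 c psi u).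
  have [_] := iso cu; rewrite cross_bar.
  rewrite !(pv_iota phi1_analytic phi2_analytic psi_analytic _ _ cc cu).
  move: (pv 0 c psi u) (pv 1 c psi u) d1 d2.
  move: (pv 0 c phi1 u) (pv 1 c phi1 u) (pv 0 c phi2 u) (pv 1 c phi2 u) => a1 b1 a2 b2 a3 b3 d1 d2.
  by rewrite !barD !crossD3 !barZ !crossZ3 d1 d2 => /addrI.
have z1 : inner (phi1 u) (pv 1 c phi1 u) = 0.
  have := inner_cst_pv 1 phi1_analytic phi1_analytic phi1_unit cu.
  by rewrite innerC => /eqP; rewrite -mulr2n mulrn_eq0 => /eqP.
have z2 : inner (phi2 u) (pv 1 c phi2 u) = 0.
  have := inner_cst_pv 1 phi2_analytic phi2_analytic phi2_unit cu.
  by rewrite innerC => /eqP; rewrite -mulr2n mulrn_eq0 => /eqP.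
(* Orthogonality of phi1 and phi2 is the reason why the same f occurs in both equations with
   opposite signs. *)
have z3 : inner (phi1 u) (pv 1 c phi2 u) = - inner (phi2 u) (pv 1 c phi1 u).
  have := inner_cst_pv 1 phi1_analytic phi2_analytic phi_orthogonal cu.
  by rewrite addrC innerC => /eqP; rewrite addr_eq0 innerC (innerC (pv _ _ _ _)) => /eqP.
split; [by split|by []| | |].
- by rewrite {1}(barE (phi1 u) (phi2 u) (pv 1 c phi1 u)) d1 z1 scale0r addr0.
- by rewrite {1}(barE (phi1 u) (phi2 u) (pv 1 c phi2 u)) d2 z2 z3 scale0r addr0 scaleNr.
- by rewrite {1}(barE (phi1 u) (phi2 u) (pv 1 c psi u)) d3.
Qed.

End Isothermal.

Theorem special_lagrangian_equations u0 : connected [set: S] -> ~ planar phi1 phi2 psi ->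
  exists (c : chart R S) (f g1 g2 : S -> R), [/\ cdom c u0,
    oriented_coordinates phi1 phi2 psi c,
    [/\ analytic_on_chart c f, analytic_on_chart c g1 & analytic_on_chart c g2] &
    forall u, cdom c u -> sl_equations phi1 phi2 psi c f g1 g2 u].
Proof.
move=> Sc npl; have [c [r0 [cc cu0 iso]]] := isothermal_coordinates u0.
have eqs u := isothermal_equations cc iso Sc npl (u := u).
exists c, (fun u => inner (phi2 u) (pv 1 c phi1 u)), (fun u => inner (phi1 u) (pv 1 c psi u)),
  (fun u => inner (phi2 u) (pv 1 c psi u)); split; [exact: cu0| | |exact: eqs].
- split; first exact: cc.
  move=> u r cu im; rewrite partial_sE partial_tE Cayley_isotropic.
  + apply: (frame_positive phi1_analytic phi2_analytic psi_analytic phi1_unit phi2_unit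
      phi_orthogonal sl_omega cc cu (eqs u cu)).
    exact: (immersion_frame phi1_analytic phi2_analytic psi_analytic r cc cu).1 im.
  + exact: sl_omega.
  + by have [] := sl_omega_iota 0 r cc cu.
  + by have [] := sl_omega_iota 1 r cc cu.
- by split; apply: inner_pv_analytic.
Qed.

End Forward.

Theorem theorem4p8 (R : realType) (S : analyticSurface R)
    (phi1 phi2 psi : S -> 'rV[R]_8)
    (S_connected : connected [set: S])
    (phi1_analytic : analytic_map phi1)
    (phi2_analytic : analytic_map phi2)
    (psi_analytic : analytic_map psi)
    (phi1_unit : forall u, inner (phi1 u) (phi1 u) = 1)
    (phi2_unit : forall u, inner (phi2 u) (phi2 u) = 1)
    (phi_orthogonal : forall u, inner (phi1 u) (phi2 u) = 0)
    (M_singularities : singularities_nowhere_dense phi1 phi2 psi)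
    (M_nonplanar : ~ planar phi1 phi2 psi) :
  special_lagrangian phi1 phi2 psi
  <->
  (forall u, omega (phi1 u) (phi2 u) = 0) /\
  (forall u0 : S, exists (c : chart R S) (f g1 g2 : S -> R),
     [/\ cdom c u0,
         oriented_coordinates phi1 phi2 psi c,
         [/\ analytic_on_chart c f, analytic_on_chart c g1
           & analytic_on_chart c g2] &
         forall u, cdom c u ->
           [/\ [/\ omega (phi1 u) (partial_s c phi1 u) = 0,
                   omega (phi1 u) (partial_s c phi2 u) = 0,
                   omega (phi2 u) (partial_s c phi1 u) = 0
                 & omega (phi2 u) (partial_s c phi2 u) = 0],
               omega (phi1 u) (partial_s c psi u) = 0
               /\ omega (phi2 u) (partial_s c psi u) = 0,
               partial_t c phi1 u
                 = cross (phi1 u) (phi2 u) (partial_s c phi1 u) + f u *: phi2 u,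
               partial_t c phi2 u
                 = cross (phi1 u) (phi2 u) (partial_s c phi2 u) - f u *: phi1 u
             & partial_t c psi u
                 = cross (phi1 u) (phi2 u) (partial_s c psi u)
                   + g1 u *: phi1 u + g2 u *: phi2 u]]).
Proof.
split=> [SL|[w H]].
  split; first exact: sl_omega SL.
  by move=> u0; exact: special_lagrangian_equations.
apply: equations_special_lagrangian => // u0; have [c [f [g1 [g2 [cu [cc _] _ eqs]]]]] := H u0.
by exists c, f, g1, g2.
Qed.
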